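(* Let $\mathcal F$ be any collection of spaces and let $X$ be any space. Then $t_{\mathcal F}(X)\le \mathrm{kl}_{\mathcal F}(X)$. If $\mathcal F$ is closed under suspensions (that is, $A\in\mathcal F$ implies $\Sigma A\in\mathcal F$), then $\mathrm{kl}_{\mathcal F}(X)\le \mathrm{cl}_{\mathcal F}(X)$.
   Context: All spaces are based, connected and have the based homotopy type of CW complexes; maps and homotopies preserve base points; $[X,Y]$ is the set of based homotopy classes and $0$ the constant class; $\equiv$ means same homotopy type. For a collection $\mathcal F$ of spaces, $Z_{\mathcal F}(X)$ is the set of $f\in[X,X]$ such that $f_*:[A,X]\to[A,X]$ is constant at $0$ for every $A\in\mathcal F$; it is a semigroup with zero element $0$ under composition. The nilpotency of a semigroup $S$ with zero is the least $n$ such that $x_1\cdots x_n=0$ for all $x_i\in S$ ($\infty$ if none exists). $t_{\mathcal F}(X)=0$ if $X$ is contractible; otherwise $t_{\mathcal F}(X)$ is the nilpotency of $Z_{\mathcal F}(X)$. Consider a sequence of cofibrations (cofiber sequences) $L_i\to X_i\to X_{i+1}$, $0\le i<m$, with each $L_i$ a wedge of spaces belonging to $\mathcal F$. If $X_0\equiv X$ and $X_m\equiv *$ it is an $\mathcal F$-killing length decomposition of $X$ of length $m$; if $X_0\equiv *$ and $X_m\equiv X$ it is an $\mathcal F$-cone length decomposition of $X$ of length $m$. The $\mathcal F$-killing length $\mathrm{kl}_{\mathcal F}(X)$ is $0$ if $X\equiv *$, and otherwise the smallest $m$ for which an $\mathcal F$-killing length decomposition of length $m$ exists ($\infty$ if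 none exists). The $\mathcal F$-cone length $\mathrm{cl}_{\mathcal F}(X)$ is defined analogously using $\mathcal F$-cone length decompositions. *)

(* Defs.v *)
From HB Require Import structures.
From Stdlib Require Import Relation_Operators.
From mathcomp Require Import all_boot all_order all_algebra generic_quotient.
From mathcomp Require Import all_classical all_reals all_analysis wedge_sigT.

Set Implicit Arguments.
Unset Strict Implicit.
Unset Printing Implicit Defensive.

Import Order.TTheory GRing.Theory Num.Theory.
Import numFieldTopology.Exports numFieldNormedType.Exports.

Local Open Scope classical_set_scope.
Local Open Scope ring_scope.
Local Open Scope quotient_scope.

Definition unit_itv (R : realType) : Type := set_type (`[0, 1]%classic : set R).

HB.instance Definition _ (R : realType) := Topological.on (unit_itv R).

Lemma clamp_subproof (R : realType) (s : R) :
  Num.max 0 (Num.min s 1) \in (`[0, 1]%classic : set R).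
Proof.
rewrite inE /= in_itv /= le_max lexx /= ge_max ler01 /=.
by rewrite ge_min lexx orbT.
Qed.

Definition clamp (R : realType) (s : R) : unit_itv R :=
  exist _ (Num.max 0 (Num.min s 1)) (clamp_subproof s).

Definition itv0 (R : realType) : unit_itv R := clamp 0.
Definition itv1 (R : realType) : unit_itv R := clamp 1.

Definition ival (R : realType) (t : unit_itv R) : R := set_val t.

Lemma ival_continuous (R : realType) : continuous (@ival R).
Proof. exact: initial_continuous. Qed.

Lemma ivalP (R : realType) (t : unit_itv R) : 0 <= ival t <= 1.
Proof. by have := set_valP t; rewrite /= in_itv. Qed.

Lemma ival_clamp (R : realType) (s : R) : 0 <= s <= 1 -> ival (clamp s) = s.
Proof.
by move=> /andP[s0 s1]; rewrite /ival set_valE /= (min_idPl s1) (max_idPr s0).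
Qed.

Lemma ival_inj (R : realType) : injective (@ival R).
Proof. by move=> s t; rewrite /ival !set_valE => /val_inj. Qed.

Lemma clampK (R : realType) (t : unit_itv R) : clamp (ival t) = t.
Proof. by apply: ival_inj; rewrite ival_clamp// ivalP. Qed.

Lemma clamp_continuous (R : realType) : continuous (@clamp R).
Proof.
apply/continuousP => _ [A oA <-].
have c : continuous (fun s : R => Num.max 0 (Num.min s 1) : R).
  move=> s; apply: (@continuous_max R R (cst 0) (fun s => Num.min s 1)).
    exact: cst_continuous.
  by apply: (@continuous_min R R id (cst 1)) => //; exact: cst_continuous.
by have /continuousP/(_ _ oA) := c.
Qed.

Record bmap (X Y : ptopologicalType) := BMap {
  bmap_fun :> X -> Y;
  bmap_cts : continuous bmap_fun;
  bmap_pt : bmap_fun point = point }.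

HB.instance Definition _ (X Y : ptopologicalType) := gen_eqMixin (bmap X Y).
HB.instance Definition _ (X Y : ptopologicalType) := gen_choiceMixin (bmap X Y).

Definition pid (X : ptopologicalType) : bmap X X :=
  @BMap X X id (fun x => @cvg_id _ (nbhs x)) erefl.

Definition pconst (X Y : ptopologicalType) : bmap X Y :=
  @BMap X Y (cst point) (@cst_continuous X Y point) erefl.

Lemma pcomp_cts (X Y Z : ptopologicalType) (g : bmap Y Z) (f : bmap X Y) :
  continuous (g \o f).
Proof. by move=> x; apply: continuous_comp; apply: bmap_cts. Qed.

Lemma pcomp_pt (X Y Z : ptopologicalType) (g : bmap Y Z) (f : bmap X Y) :
  (g \o f) point = point.
Proof. by rewrite /= !bmap_pt. Qed.

Definition pcomp (X Y Z : ptopologicalType) (g : bmap Y Z) (f : bmap X Y) :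
  bmap X Z := BMap (@pcomp_cts X Y Z g f) (pcomp_pt g f).

Definition homotopic (R : realType) (X Y : ptopologicalType) (f g : bmap X Y) :
    Prop :=
  exists H : X * unit_itv R -> Y,
    [/\ continuous H,
        forall x, H (x, itv0 R) = f x,
        forall x, H (x, itv1 R) = g x
      & forall t, H (point, t) = point].

Lemma homotopic_refl (R : realType) (X Y : ptopologicalType) (f : bmap X Y) :
  homotopic R f f.
Proof.
exists (f \o fst); split=> //= [x|t]; last exact: bmap_pt.
by apply: continuous_comp; [exact: cvg_fst|exact: bmap_cts].
Qed.

Section reparametrization.
Variables (R : realType) (X : ptopologicalType).

Definition reparam (u : R -> R) (p : X * unit_itv R) : X * unit_itv R :=
  (p.1, clamp (u (ival p.2))).

Lemma reparam_continuous (u : R -> R) :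
  continuous u -> continuous (reparam u).
Proof.
move=> cu p.
apply: (@cvg_pair _ _ _ (nbhs p) (nbhs p.1) (nbhs (clamp (u (ival p.2))))
  _ _ _ fst (fun q => clamp (u (ival q.2)))); first exact: cvg_fst.
apply: (@continuous_comp _ _ _ (@ival R \o snd) (@clamp R \o u)).
  by apply: continuous_comp; [exact: cvg_snd|exact: ival_continuous].
by apply: continuous_comp; [exact: cu|exact: clamp_continuous].
Qed.

End reparametrization.

Lemma homotopic_sym (R : realType) (X Y : ptopologicalType) (f g : bmap X Y) :
  homotopic R f g -> homotopic R g f.
Proof.
move=> [H [cH H0 H1 Hp]]; exists (H \o reparam (fun s => 1 - s)).
split=> [|x|x|t] /=; last exact: Hp.
- move=> p; apply: continuous_comp; last exact: cH.
  apply: reparam_continuous => s; apply: cvgB; [exact: cvg_cst|exact: cvg_id].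
- by rewrite /reparam /= ival_clamp ?lexx ?ler01// subr0 H1.
- by rewrite /reparam /= ival_clamp ?lexx ?ler01// subrr H0.
Qed.

Lemma homotopic_trans (R : realType) (X Y : ptopologicalType)
    (f g h : bmap X Y) :
  homotopic R f g -> homotopic R g h -> homotopic R f h.
Proof.
move=> [H [cH H0 H1 Hp]] [G [cG G0 G1 Gp]].
pose u (s : R) := s + s; pose v (s : R) := s + s - 1.
have cu : continuous u by move=> s; apply: cvgD; exact: cvg_id.
have cv : continuous v by move=> s; apply: cvgB; [exact: cu|exact: cvg_cst].
pose c (p : X * unit_itv R) := ival p.2.
have cc : continuous c.
  by move=> p; apply: continuous_comp; [exact: cvg_snd|exact: ival_continuous].
pose lo := c @^-1` [set s | s <= 2^-1]; pose hi := c @^-1` [set s | 2^-1 <= s].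
pose K p := if c p <= 2^-1 then H (reparam u p) else G (reparam v p).
have half : 2^-1 + 2^-1 = 1 :> R by rewrite [RHS]splitr !mul1r.
have KG p : hi p -> K p = G (reparam v p).
  rewrite /hi /= /K => hp; case: ifPn => // lp.
  have cE : ival p.2 = 2^-1 by apply/eqP; rewrite eq_le; apply/andP.
  rewrite /reparam /u /v cE half subrr.
  by rewrite -/(itv1 R) -/(itv0 R) H1 G0.
exists K; split=> [|x|x|t].
- apply/continuous_subspace_setT.
  have -> : [set: X * unit_itv R] = lo `|` hi.
    apply/esym; rewrite -subTset => p _; case: (lerP (c p) 2^-1); first by left.
    by move=> /ltW; right.
  apply: withinU_continuous.
  + by apply: preimage_closed => //; exact: closed_le.
  + by apply: preimage_closed => //; exact: closed_ge.
  + apply: (@subspace_eq_continuous _ _ _ (H \o reparam u)).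
      by move=> p /set_mem; rewrite /from_subspace /lo /= /K => ->.
    apply: continuous_subspaceT => p; apply: continuous_comp; last exact: cH.
    exact: reparam_continuous.
  + apply: (@subspace_eq_continuous _ _ _ (G \o reparam v)).
      by move=> p /set_mem hp; exact/esym/KG.
    apply: continuous_subspaceT => p; apply: continuous_comp; last exact: cG.
    exact: reparam_continuous.
- rewrite /K /c /reparam /= ival_clamp ?lexx ?ler01//.
  by rewrite invr_ge0 ler0n /u addr0 -/(itv0 R) H0.
- rewrite KG /hi /c /= ?ival_clamp ?lexx ?ler01//.
    by rewrite /reparam /= ival_clamp ?lexx ?ler01// /v addrK -/(itv1 R) G1.
  by rewrite invf_le1 ?ltr0n// ler1n.
- by rewrite /K /reparam /=; case: ifP; rewrite ?Hp ?Gp.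
Qed.

Section homotopy_classes.
Variables (R : realType) (X Y : ptopologicalType).

Definition homotopicb (f g : bmap X Y) : bool := `[< homotopic R f g >].

Lemma homotopicb_refl : reflexive homotopicb.
Proof. by move=> f; apply/asboolP; exact: homotopic_refl. Qed.

Lemma homotopicb_sym : symmetric homotopicb.
Proof. by move=> f g; apply/asboolP/asboolP; exact: homotopic_sym. Qed.

Lemma homotopicb_trans : transitive homotopicb.
Proof.
move=> g f h /asboolP fg /asboolP gh; apply/asboolP; exact: homotopic_trans gh.
Qed.

Definition homotopy_equiv_rel :=
  EquivRel homotopicb homotopicb_refl homotopicb_sym homotopicb_trans.

Definition hclasses := {eq_quot homotopy_equiv_rel}.

HB.instance Definition _ := Choice.on hclasses.
HB.instance Definition _ := Quotient.on hclasses.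

Definition hclass (f : bmap X Y) : hclasses := \pi_hclasses f.
Definition hzero : hclasses := hclass (pconst X Y).

End homotopy_classes.

(* The induced map f_* : [A, X] -> [A, X] of f is hcomp f. *)
Definition hcomp (R : realType) (X Y Z : ptopologicalType)
    (g : hclasses R Y Z) (f : hclasses R X Y) : hclasses R X Z :=
  hclass R (pcomp (repr g) (repr f)).

Definition hequiv (R : realType) (X Y : ptopologicalType) (f : bmap X Y) : Prop :=
  exists g : bmap Y X,
    homotopic R (pcomp g f) (pid X) /\ homotopic R (pcomp f g) (pid Y).

Definition same_type (R : realType) (X Y : ptopologicalType) : Prop :=
  exists f : bmap X Y, hequiv R f.

Definition one_point : Type := discrete_topology unit.

HB.instance Definition _ := Topological.on one_point.
HB.instance Definition _ := isPointed.Build one_point tt.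

Definition contractible (R : realType) (X : ptopologicalType) : Prop :=
  same_type R X one_point.

(* The n-cell is modelled on the cube [0, 1]^n. *)
Definition cube (R : realType) (n : nat) : set 'rV[R]_n :=
  [set x | forall i, 0 <= x 0 i <= 1].
Definition open_cube (R : realType) (n : nat) : set 'rV[R]_n :=
  [set x | forall i, 0 < x 0 i < 1].

(* E n indexes the n-cells and phi e is the characteristic map of the cell e,
   whose values outside the cube are irrelevant. *)
Record cw_structure (R : realType) (X : topologicalType) (E : nat -> Type)
    (phi : forall n, E n -> 'rV[R]_n -> X) : Prop := {
  cw_hausdorff : hausdorff_space X;
  cw_continuous : forall n (e : E n), {within @cube R n, continuous (phi n e)};
  cw_injective : forall n (e : E n), set_inj (@open_cube R n) (phi n e);
  cw_partition : forall x : X, exists! c : {n & E n},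
    (phi (projT1 c) (projT2 c) @` @open_cube R (projT1 c)) x;
  cw_closure_finite : forall n (e : E n), exists S : set {k & E k},
    [/\ finite_set S,
        forall c, S c -> (projT1 c < n)%N
      & phi n e @` (@cube R n `\` @open_cube R n) `<=`
        \bigcup_(c in S) (phi (projT1 c) (projT2 c) @` @open_cube R (projT1 c))];
  cw_weak : forall A : set X,
    closed A <-> forall n (e : E n), closed (@cube R n `&` phi n e @^-1` A) }.

Definition based_CW_complex (R : realType) (X : ptopologicalType) : Prop :=
  exists (E : nat -> Type) (phi : forall n, E n -> 'rV[R]_n -> X),
    cw_structure phi /\ exists e : E 0%N, phi 0%N e 0 = point.

(* The objects of the theory: connected, of the based homotopy type of a based
   CW complex. *)
Definition is_space (R : realType) (X : ptopologicalType) : Prop :=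
  connected [set: X] /\
  exists2 K : ptopologicalType, based_CW_complex R K & same_type R X K.

Section generated_quotient.
Variables (T : topologicalType) (r : T -> T -> Prop).

Definition generatedb (x y : T) : bool := `[< clos_refl_sym_trans T r x y >].

Lemma generatedb_refl : reflexive generatedb.
Proof. by move=> x; apply/asboolP; exact: rst_refl. Qed.

Lemma generatedb_sym : symmetric generatedb.
Proof. by move=> x y; apply/asboolP/asboolP; exact: rst_sym. Qed.

Lemma generatedb_trans : transitive generatedb.
Proof.
by move=> y x z /asboolP xy /asboolP yz; apply/asboolP; apply: rst_trans yz.
Qed.

Definition generated_equiv_rel :=
  EquivRel generatedb generatedb_refl generatedb_sym generatedb_trans.

Definition glue := {eq_quot generated_equiv_rel}.

HB.instance Definition _ := Topological.copy glue (quotient_topology glue).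
HB.instance Definition _ := Quotient.on glue.

End generated_quotient.

Section mapping_cone.
Variables (R : realType) (A X : ptopologicalType) (f : bmap A X).

Definition cone_part (b : bool) : topologicalType :=
  if b then (A * unit_itv R)%type : topologicalType else X.

Definition cone_sum : topologicalType := {b : bool & cone_part b}.

Definition cone_cyl (a : A) (t : unit_itv R) : cone_sum :=
  existT cone_part true (a, t).
Definition cone_bot (x : X) : cone_sum := existT cone_part false x.

(* The axis {point} x [0, 1] is collapsed as well: the cone is reduced. *)
Variant cone_rel : cone_sum -> cone_sum -> Prop :=
  | ConeBase a : cone_rel (cone_cyl a (itv0 R)) (cone_bot (f a))
  | ConeApex a : cone_rel (cone_cyl a (itv1 R)) (cone_bot point)
  | ConeAxis t : cone_rel (cone_cyl point t) (cone_bot point).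

Definition mapping_cone := glue cone_rel.

HB.instance Definition _ := Topological.on mapping_cone.
HB.instance Definition _ := Quotient.on mapping_cone.
HB.instance Definition _ :=
  isPointed.Build mapping_cone (\pi_mapping_cone (cone_bot point)).

Definition cone_in_fun (x : X) : mapping_cone := \pi_mapping_cone (cone_bot x).

Lemma cone_in_cts : continuous cone_in_fun.
Proof.
move=> x; apply: (@continuous_comp _ _ _ cone_bot).
  exact: existT_continuous.
exact: pi_continuous.
Qed.

Definition cone_in : bmap X mapping_cone := BMap cone_in_cts erefl.

End mapping_cone.

Section suspension.
Variables (R : realType) (A : ptopologicalType).

Variant susp_rel : A * unit_itv R -> A * unit_itv R -> Prop :=
  | SuspBot a : susp_rel (a, itv0 R) (point, itv0 R)
  | SuspTop a : susp_rel (a, itv1 R) (point, itv0 R)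
  | SuspAxis t : susp_rel (point, t) (point, itv0 R).

Definition suspension := glue susp_rel.

HB.instance Definition _ := Topological.on suspension.
HB.instance Definition _ := Quotient.on suspension.
HB.instance Definition _ :=
  isPointed.Build suspension (\pi_suspension (point, itv0 R)).

End suspension.

(* Up to a based homotopy equivalence compatible, up to homotopy, with the maps
   from X, the sequence is A -> X -> (reduced mapping cone of A -> X). *)
Definition cofiber_seq (R : realType) (A X Y : ptopologicalType)
    (f : bmap A X) (g : bmap X Y) : Prop :=
  exists e : bmap (mapping_cone R f) Y,
    hequiv R e /\ homotopic R (pcomp e (cone_in R f)) g.

Local Open Scope ereal_scope.

(* The least element of a set of naturals, +oo for the empty set. *)
Definition least (R : realType) (P : set nat) : \bar R :=
  ereal_inf [set n%:R%:E | n in P].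

(* Products are over nonempty words, as in a semigroup, whence 0 < n. *)
Definition nilpotency (R : realType) (S : choiceType) (op : S -> S -> S)
    (zero : S) (Z : set S) : \bar R :=
  least R [set n | (0 < n)%N /\
    forall (x : S) (s : seq S), size (x :: s) = n ->
      (forall y, y \in x :: s -> Z y) -> foldl op x s = zero].

Section lengths.
Variables (R : realType) (F : ptopologicalType -> Prop).

Definition Z_ (X : ptopologicalType) : set (hclasses R X X) :=
  [set f | forall A, F A ->
     forall u : hclasses R A X, hcomp f u = hzero R A X].

Definition t_ (X : ptopologicalType) : \bar R :=
  if `[< contractible R X >] then 0
  else nilpotency R (@hcomp R X X X) (hzero R X X) (@Z_ X).

(* The index type of pwedge is nonempty; a wedge of the empty family would only
   contribute trivial steps X i ~ X i.+1, so the lengths are not affected. *)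
Definition wedge_cofibration (X Y : ptopologicalType) : Prop :=
  exists (J : pointedType) (A : J -> ptopologicalType),
    (forall j, F (A j)) /\
    exists (f : bmap (pwedge A) X) (g : bmap X Y), cofiber_seq R f g.

Definition decomposition (m : nat) (X : nat -> ptopologicalType) : Prop :=
  (forall i, (i <= m)%N -> is_space R (X i)) /\
  (forall i, (i < m)%N -> wedge_cofibration (X i) (X i.+1)).

Definition killing_decomposition (X : ptopologicalType) (m : nat) : Prop :=
  exists X_ : nat -> ptopologicalType,
    [/\ decomposition m X_, same_type R (X_ 0%N) X
      & same_type R (X_ m) one_point].

Definition cone_decomposition (X : ptopologicalType) (m : nat) : Prop :=
  exists X_ : nat -> ptopologicalType,
    [/\ decomposition m X_, same_type R (X_ 0%N) one_point
      & same_type R (X_ m) X].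

Definition kl (X : ptopologicalType) : \bar R :=
  if `[< contractible R X >] then 0 else least R (killing_decomposition X).

Definition cl (X : ptopologicalType) : \bar R :=
  if `[< contractible R X >] then 0 else least R (cone_decomposition X).

End lengths.

(* Main.v *)
Require Import Defs.
From Stdlib Require Import Relation_Operators.
From mathcomp Require Import all_boot all_order all_algebra generic_quotient.
From mathcomp Require Import all_classical all_reals all_analysis wedge_sigT.
From mathcomp Require Import ring lra.
(* Imported last, so that glue denotes the quotient space. *)
Require Import Defs.

Set Implicit Arguments.
Unset Strict Implicit.
Unset Printing Implicit Defensive.

Import Order.TTheory GRing.Theory Num.Theory.
Import numFieldTopology.Exports numFieldNormedType.Exports.

Local Open Scope classical_set_scope.
Local Open Scope ring_scope.
Local Open Scope quotient_scope.

(** Let L_i -> X_i -> X_(i+1) be a killing decomposition of X, let h be a map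
    X_i -> X and a an element of Z_F(X). The composite of a and h with the map
    L_i -> X_i is null on every member of F in the wedge L_i, hence null, so
    a \o h extends over X_(i+1). Starting from an equivalence X_0 -> X, a product
    of m elements of Z_F(X) therefore factors through X_m, which is contractible,
    and is zero ([killing_word], [t_le_kl]).

    Let now L_i -> X_i -> X_(i+1) be a cone decomposition of X of length m, and
    let Z be a complex of the homotopy type of X. Compose the maps X_i -> X_m with
    an equivalence X_m -> Z to g_i : X_i -> Z, and let Y_i be the mapping cone of
    g_i. As X_0 is contractible, Y_0 has the type of Z, hence of X; as g_m is an
    equivalence, Y_m is contractible. Passing from Y_i to Y_(i+1) enlarges
    the cone on X_i to a cone on the mapping cone of L_i -> X_i, that is, it
    attaches over each point of L_i a square of which two adjacent edges already
    lie in Y_i and the other two are collapsed. Such a square is a cone on the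
    first two edges, and over L_i these edges form the suspension of L_i, so that
    Susp L_i -> Y_i -> Y_(i+1) is a cofibre sequence ([puppe_cofiber]). Since
    Susp L_i is the wedge of the suspensions of the summands ([susp_wedge]), the
    Y_i form a killing decomposition of X of the same length
    ([cone_to_killing], [kl_le_cl]).

    It remains to see that the Y_i are spaces, that is, have the homotopy
    type of complexes. This is the main part of the work. The mapping cone
    depends only on the homotopy class of the map and on the homotopy type of its
    source ([cone_homotopic], [cone_pre_hequiv]), so X_i may be taken to be a
    complex, and by cellular approximation the map to Z may be taken cellular;
    the reduced cone of a cellular map has an evident cell structure
    ([cone_based_CW]). Cellular approximation compresses the cells one dimension
    after the other ([cellular_approximation]). The essential step moves a map
    from an n-cube off a cell of dimension k > n ([push_off_top_cell]): near the
    centre of the cell the map is approximated by a Lipschitz map, which misses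
    points by a counting argument ([lipschitz_misses]), and the complement of a
    missed point is projected to the boundary of the cell. *)

(** * Continuous functions *)

Section continuity.
Variables (R : realType) (T : topologicalType).

Lemma cts_id : continuous (fun x : T => x).
Proof. by move=> x; exact: cvg_id. Qed.

Lemma cts_eq (Y : topologicalType) (f g : T -> Y) :
  f =1 g -> continuous f -> continuous g.
Proof. by move=> /funext ->. Qed.

Lemma cts_cst (Y : topologicalType) (y : Y) : continuous (fun _ : T => y).
Proof. exact: cst_continuous. Qed.

Lemma cts_comp (Y Z : topologicalType) (g : Y -> Z) (f : T -> Y) :
  continuous g -> continuous f -> continuous (fun x => g (f x)).
Proof. by move=> cg cf x; apply: continuous_comp; [exact: cf|exact: cg]. Qed.

Lemma cts_pair (Y Z : topologicalType) (f : T -> Y) (g : T -> Z) :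
  continuous f -> continuous g -> continuous (fun x => (f x, g x)).
Proof. by move=> cf cg x; apply: cvg_pair; [exact: cf|exact: cg]. Qed.

Lemma cts_fst (Y Z : topologicalType) (f : T -> Y * Z) :
  continuous f -> continuous (fun x => (f x).1).
Proof. by move=> cf; apply: (@cts_comp _ _ fst) => // x; exact: cvg_fst. Qed.

Lemma cts_snd (Y Z : topologicalType) (f : T -> Y * Z) :
  continuous f -> continuous (fun x => (f x).2).
Proof. by move=> cf; apply: (@cts_comp _ _ snd) => // x; exact: cvg_snd. Qed.

Lemma cts_ival (f : T -> unit_itv R) :
  continuous f -> continuous (fun x => ival (f x)).
Proof. by move=> cf; apply: cts_comp => //; exact: ival_continuous. Qed.

Lemma cts_clamp (f : T -> R) : continuous f -> continuous (fun x => clamp (f x)).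
Proof. by move=> cf; apply: cts_comp => //; exact: clamp_continuous. Qed.

Lemma cts_add (V : normedModType R) (f g : T -> V) :
  continuous f -> continuous g -> continuous (fun x => f x + g x).
Proof. by move=> cf cg x; apply: cvgD; [exact: cf|exact: cg]. Qed.

Lemma cts_opp (V : normedModType R) (f : T -> V) :
  continuous f -> continuous (fun x => - f x).
Proof. by move=> cf x; apply: cvgN; exact: cf. Qed.

Lemma cts_addR (f g : T -> R) :
  continuous f -> continuous g -> continuous (fun x => f x + g x).
Proof. exact: cts_add. Qed.

Lemma cts_oppR (f : T -> R) : continuous f -> continuous (fun x => - f x).
Proof. exact: cts_opp. Qed.

Lemma cts_mul (f g : T -> R) :
  continuous f -> continuous g -> continuous (fun x => f x * g x).
Proof. by move=> cf cg x; apply: cvgM; [exact: cf|exact: cg]. Qed.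

Lemma cts_scale (V : normedModType R) (f : T -> R) (g : T -> V) :
  continuous f -> continuous g -> continuous (fun x => f x *: g x).
Proof. by move=> cf cg x; apply: cvgZ; [exact: cf|exact: cg]. Qed.

Lemma cts_norm (V : normedModType R) (f : T -> V) :
  continuous f -> continuous (fun x => `|f x|).
Proof. by move=> cf x; apply: cvg_norm; exact: cf. Qed.

Lemma cts_inv (f : T -> R) :
  (forall x, f x != 0) -> continuous f -> continuous (fun x => (f x)^-1).
Proof. by move=> f0 cf x; apply: cvgV => //; exact: cf. Qed.

Lemma cts_max (f g : T -> R) :
  continuous f -> continuous g -> continuous (fun x => Num.max (f x) (g x)).
Proof.
move=> cf cg x; apply: (@continuous_max R T f g x); [exact: cf|exact: cg].
Qed.

Lemma cts_min (f g : T -> R) :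
  continuous f -> continuous g -> continuous (fun x => Num.min (f x) (g x)).
Proof.
move=> cf cg x; apply: (@continuous_min R T f g x); [exact: cf|exact: cg].
Qed.

End continuity.

(* Dispatching on the head symbol keeps unification of the composition lemmas
   from being tried on goals that they do not fit. *)
Ltac cts :=
  cbv beta; lazymatch goal with |- forall x, @continuous_at _ _ x ?F =>
    lazymatch F with
    | fun y => y => exact: cts_id
    | fun y => (@?f y, @?g y) => apply: cts_pair; cts
    | fun y => clamp (@?f y) => apply: cts_clamp; cts
    | fun y => ival (@?f y) => apply: cts_ival; cts
    | fun y => (@?f y + @?g y)%R => (first [apply: cts_addR | apply: cts_add]); cts
    | fun y => (- @?f y)%R => (first [apply: cts_oppR | apply: cts_opp]); cts
    | fun y => (@?f y * @?g y)%R => apply: cts_mul; cts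
    | fun y => Num.max (@?f y) (@?g y) => apply: cts_max; cts
    | fun y => Num.min (@?f y) (@?g y) => apply: cts_min; cts
    | fun y => fst (@?f y) => apply: cts_fst; cts
    | fun y => snd (@?f y) => apply: cts_snd; cts
    | fst => exact: (cts_fst (@cts_id _))
    | snd => exact: (cts_snd (@cts_id _))
    | _ => first [assumption | exact: cts_cst | exact: bmap_cts | exact: cts_id | idtac]
    end
  | _ => idtac
  end.

Section unit_interval.
Variable R : realType.

Lemma ival0 : ival (itv0 R) = 0.
Proof. by rewrite ival_clamp // lexx ler01. Qed.

Lemma ival1 : ival (itv1 R) = 1.
Proof. by rewrite ival_clamp // lexx ler01. Qed.

Lemma clamp_le0 (s : R) : s <= 0 -> clamp s = itv0 R.
Proof.
move=> s0; apply: ival_inj; rewrite ival0 /ival set_valE /=.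
by rewrite (min_idPl (le_trans s0 ler01)) (max_idPl s0).
Qed.

Lemma clamp_ge1 (s : R) : 1 <= s -> clamp s = itv1 R.
Proof.
move=> s1; apply: ival_inj; rewrite ival1 /ival set_valE /=.
by rewrite (min_idPr s1) (max_idPr ler01).
Qed.

Lemma ival_ge0 (t : unit_itv R) : 0 <= ival t.
Proof. by have /andP[] := ivalP t. Qed.

Lemma ival_le1 (t : unit_itv R) : ival t <= 1.
Proof. by have /andP[] := ivalP t. Qed.

Lemma ival_eq0 (t : unit_itv R) : ival t = 0 -> t = itv0 R.
Proof. by move=> t0; apply: ival_inj; rewrite ival0. Qed.

Lemma ival_eq1 (t : unit_itv R) : ival t = 1 -> t = itv1 R.
Proof. by move=> t1; apply: ival_inj; rewrite ival1. Qed.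

End unit_interval.

(** * Compact Hausdorff subtypes *)

Lemma set_val_inj (T : Type) (A : set T) : injective (set_val : A -> T).
Proof. by move=> x y; rewrite !set_valE => /val_inj. Qed.

Lemma set_type_hausdorff (T : topologicalType) (A : set T) :
  hausdorff_space T -> hausdorff_space (set_type A).
Proof.
rewrite !open_hausdorff => h x y /eqP xy.
have /h : set_val x != set_val y by apply/eqP => /set_val_inj.
move=> [[U V] /= [Ux Vy] [oU oV UV]].
exists (set_val @^-1` U, set_val @^-1` V) => /=; first by rewrite !inE in Ux Vy *.
split; [by exists U|by exists V|].
by rewrite -preimage_setI (eqP UV) preimage_set0.
Qed.

Lemma set_type_compact (T : topologicalType) (A : set T) :
  compact A -> compact [set: set_type A].
Proof.
move=> cA F PF FT.
have FA : (set_val @ F : set_system T) A.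
  have : F ((set_val : set_type A -> T) @^-1` A); last exact.
  by apply: filterS FT => x _; exact: (set_valP x).
have [x [Ax clx]] := cA _ (fmap_proper_filter _ PF) FA.
exists (SigSub (mem_set Ax)); split => // B C FB [_ [[U oU <-] Ux UC]].
have := clx (set_val @` B) U; case.
- have : F ((set_val : set_type A -> T) @^-1` (set_val @` B)); last exact.
  by apply: filterS FB => y By; exists y.
- by apply: open_nbhs_nbhs; split => //; rewrite set_valE in Ux.
by move=> z [[y By <-] Uy]; exists y; split => //; apply: UC.
Qed.

Lemma set_val_cts (T : topologicalType) (A : set T) :
  continuous (set_val : A -> T).
Proof. exact: initial_continuous. Qed.

Lemma set_type_cts (S T : topologicalType) (A : set T) (f : S -> A) :
  continuous (fun x => set_val (f x)) -> continuous f.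
Proof.
move=> /continuousP cf; apply/continuousP => _ [U oU <-]; exact: cf.
Qed.

Lemma cts_paste_sub (R : realType) (T Y : topologicalType) (c : T -> R)
    (F : T -> Y) : continuous c ->
  continuous (fun x : set_type [set x | c x <= 0] => F (set_val x)) ->
  continuous (fun x : set_type [set x | 0 <= c x] => F (set_val x)) ->
  continuous F.
Proof.
move=> cc /continuousP cl /continuousP cr; apply/continuousP => A oA.
have [U oU UE] := cl A oA; have [V oV VE] := cr A oA.
have Ul x : c x <= 0 -> U x <-> A (F x).
  move=> xl; pose z : set_type [set x | c x <= 0] := exist _ x (mem_set xl).
  have : (set_val @^-1` U) z <-> A (F (set_val z)) by rewrite UE.
  by rewrite /preimage /mkset set_valE.
have Vr x : 0 <= c x -> V x <-> A (F x).
  move=> xr; pose z : set_type [set x | 0 <= c x] := exist _ x (mem_set xr).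
  have : (set_val @^-1` V) z <-> A (F (set_val z)) by rewrite VE.
  by rewrite /preimage /mkset set_valE.
have -> : F @^-1` A = (U `&` V) `|` (U `&` c @^-1` [set s | s < 0])
    `|` (V `&` c @^-1` [set s | 0 < s]).
  apply/seteqP; split => x /=.
    move=> Ax; have [cx|cx|cx] := ltgtP (c x) 0.
    - by left; right; split => //; apply/Ul => //; exact: ltW.
    - by right; split => //; apply/Vr => //; exact: ltW.
    - by left; left; split; [apply/Ul|apply/Vr]; rewrite ?cx.
  case; first case.
  - move=> [Ux Vx]; have /orP[h|h] := le_total (c x) 0; first exact/Ul.
    exact/Vr.
  - by move=> [Ux cx]; apply/Ul => //; exact: ltW.
  - by move=> [Vx cx]; apply/Vr => //; exact: ltW.
apply: openU; first apply: openU; apply: openI => //.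
- by apply: open_comp => [x _|]; [exact: cc|exact: open_lt].
- by apply: open_comp => [x _|]; [exact: cc|exact: open_gt].
Qed.

Lemma cts_paste (R : realType) (T Y : topologicalType) (c : T -> R)
    (f g : T -> Y) :
  continuous c -> continuous f -> continuous g ->
  (forall x, c x = 0 -> f x = g x) ->
  continuous (fun x => if c x <= 0 then f x else g x).
Proof.
move=> cc cf cg fg; apply: (cts_paste_sub cc).
  set S := set_type _; apply: (@cts_eq _ _ (fun x : S => f (set_val x))) => [x|].
    by have /= -> := set_valP x.
  by apply: (@cts_comp _ _ _ f) => //; exact: set_val_cts.
set S := set_type _; apply: (@cts_eq _ _ (fun x : S => g (set_val x))) => [x|].
  have x0 : 0 <= c (set_val x) := set_valP x.
  by case: ifPn => // xl; rewrite fg//; apply/eqP; rewrite eq_le xl.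
by apply: (@cts_comp _ _ _ g) => //; exact: set_val_cts.
Qed.

Lemma unit_itv_compact (R : realType) : compact [set: unit_itv R].
Proof. by apply: set_type_compact; exact: segment_compact. Qed.

Lemma unit_itv_hausdorff (R : realType) : hausdorff_space (unit_itv R).
Proof. by apply: set_type_hausdorff; exact: Rhausdorff. Qed.

Lemma prod_compact (S T : topologicalType) :
  compact [set: S] -> compact [set: T] -> compact [set: S * T].
Proof. by move=> cS cT; rewrite -setXTT; exact: compact_setX. Qed.

Lemma prod_hausdorff (S T : topologicalType) :
  hausdorff_space S -> hausdorff_space T -> hausdorff_space (S * T)%type.
Proof.
move=> hS hT [a b] [c d] cl; congr pair.
- apply: hS => U V Ua Vc.
  have [||[x y] [/= ? ?]] := cl (fst @^-1` U) (fst @^-1` V).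
  + exact: (cvg_fst (F := nbhs a) (G := nbhs b) Ua).
  + exact: (cvg_fst (F := nbhs c) (G := nbhs d) Vc).
  by exists x.
- apply: hT => U V Ua Vc.
  have [||[x y] [/= ? ?]] := cl (snd @^-1` U) (snd @^-1` V).
  + exact: (cvg_snd (F := nbhs a) (G := nbhs b) Ua).
  + exact: (cvg_snd (F := nbhs c) (G := nbhs d) Vc).
  by exists y.
Qed.

(** * Quotient maps *)

(** Topologies that are final for a family of maps: quotient topologies, but also
    the weak topology of a complex, for its characteristic maps. *)
Definition quotient_family (I : Type) (S : I -> topologicalType)
    (Q : topologicalType) (q : forall i, S i -> Q) : Prop :=
  (forall y, exists i x, q i x = y) /\
  forall V : set Q, (forall i, open (q i @^-1` V)) -> open V.

Definition quotient_map (S Q : topologicalType) (q : S -> Q) : Prop :=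
  quotient_family (fun _ : unit => q).

Lemma quotient_family_cts (I : Type) (S : I -> topologicalType)
    (Q Y : topologicalType) (q : forall i, S i -> Q) (f : Q -> Y) :
  quotient_family q -> (forall i, continuous (fun x => f (q i x))) ->
  continuous f.
Proof.
move=> [_ qq] c; apply/continuousP => A oA; apply: qq => i.
by have /continuousP/(_ A oA) := c i.
Qed.

Lemma quotient_map_cts (S Q Y : topologicalType) (q : S -> Q) (f : Q -> Y) :
  quotient_map q -> continuous (fun x => f (q x)) -> continuous f.
Proof. by move=> qq c; apply: (quotient_family_cts qq) => _. Qed.

Lemma tube_open (S P : topologicalType) (N : set P) (O : set (S * P)) :
  compact N -> open O -> open [set s | forall p, N p -> O (s, p)].
Proof.
move=> /compact_near_coveringP cN oO; rewrite openE => s /= sN.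
apply: (cN S (nbhs s) (fun s p => O (s, p))) => p Np /=.
have [[U V] /= [Us Vp] UV] : nbhs (s, p) O.
  by apply: open_nbhs_nbhs; split => //; exact: sN.
by exists (V, U) => //= -[p' s'] [/= ? ?]; apply: UV.
Qed.

(** J. H. C. Whitehead: a point of an open saturated set has a neighbourhood
    V x N with N compact, where V consists of all y with {y} x N in the set and
    is open by the tube lemma. *)
Lemma quotient_family_prod (I : Type) (S : I -> topologicalType)
    (Q P : topologicalType) (q : forall i, S i -> Q) :
  compact [set: P] -> hausdorff_space P -> quotient_family q ->
  quotient_family (fun i (x : S i * P) => (q i x.1, x.2)).
Proof.
move=> cP hP [qs qq]; split=> [[y p]|O oO].
  by have [i [x <-]] := qs y; exists i, (x, p).
rewrite openE => -[y0 p0] Oyp; have [i [s0 sy]] := qs y0.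
have O'sp : nbhs (s0, p0) ((fun x : S i * P => (q i x.1, x.2)) @^-1` O).
  by apply: open_nbhs_nbhs; split => //=; rewrite sy.
have [[U N] /= [Us Np] UN] := O'sp.
have [N' N'p N'N] := @compact_regular _ p0 _ hP cP filterT _ Np.
have cN : compact (closure N').
  by apply: (subclosed_compact _ cP) => //; exact: closed_closure.
pose V := [set y | forall p, closure N' p -> O (y, p)].
exists (V, N') => /=.
  split => //; apply: open_nbhs_nbhs; split.
    apply: qq => j; rewrite [X in open X](_ : _ = [set s | forall p,
      closure N' p -> ((fun x : S j * P => (q j x.1, x.2)) @^-1` O) (s, p)]) //.
    exact: tube_open.
  move=> p /N'N Np'; rewrite -sy; apply: (UN (s0, p)); split => //=.
  exact: nbhs_singleton.
by move=> [y p] [/= Vy N'p']; apply: Vy; exact: subset_closure.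
Qed.

Lemma quotient_map_prod (S Q P : topologicalType) (q : S -> Q) :
  compact [set: P] -> hausdorff_space P -> quotient_map q ->
  quotient_map (fun x : S * P => (q x.1, x.2)).
Proof. by move=> cP hP; exact: quotient_family_prod. Qed.

Lemma glue_quotient_map (T : topologicalType) (r : T -> T -> Prop) :
  quotient_map (\pi_(glue r) : T -> glue r).
Proof. by split=> [y|V /(_ tt)//]; exists tt, (repr y); rewrite reprK. Qed.

(** Topological sums commute with products. *)
Lemma sigT_quotient_cts (I : choiceType) (X : I -> topologicalType)
    (P Y : topologicalType) (f : {i & X i} * P -> Y) :
  (forall i, continuous (fun x : X i * P => f (existT X i x.1, x.2))) ->
  continuous f.
Proof.
move=> cf; apply/continuousP => A oA; rewrite openE => -[[i x] p] /= Afx.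
have /= : nbhs (x, p) ((fun x : X i * P => f (existT X i x.1, x.2)) @^-1` A).
  apply: open_nbhs_nbhs; split => //.
  by have /continuousP/(_ _ oA) := cf i.
move=> [[U V] /= [Ux Vp] UV]; exists (existT X i @` U, V) => /=.
  by split => //; exact: existT_nbhs.
by move=> [_ p'] [/= [x' Ux' <-] Vp']; exact: (UV (x', p')).
Qed.

(** * The homotopy category *)

Lemma bmap_ext (X Y : ptopologicalType) (f g : bmap X Y) :
  (forall x, f x = g x) -> f = g.
Proof.
case: f => f cf pf; case: g => g cg pg /= /funext fg.
by rewrite -{}fg in cg pg *; congr BMap; exact: Prop_irrelevance.
Qed.

Section homotopy_category.
Variable R : realType.
Implicit Types X Y Z W : ptopologicalType.

Lemma homotopic_pcompl X Y Z (h : bmap Y Z) (f g : bmap X Y) :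
  homotopic R f g -> homotopic R (pcomp h f) (pcomp h g).
Proof.
move=> [H [cH H0 H1 Hp]]; exists (h \o H); split=> [|x|x|t] /=.
- by apply: cts_comp => //; exact: bmap_cts.
- by rewrite H0.
- by rewrite H1.
- by rewrite Hp bmap_pt.
Qed.

Lemma homotopic_pcompr X Y Z (h : bmap X Y) (f g : bmap Y Z) :
  homotopic R f g -> homotopic R (pcomp f h) (pcomp g h).
Proof.
move=> [H [cH H0 H1 Hp]]; exists (fun p => H (h p.1, p.2)).
split=> [|x|x|t] /=; rewrite ?H0 ?H1 ?bmap_pt ?Hp //.
apply: (@cts_comp _ _ _ H) => //; apply: cts_pair; last by apply: cts_snd; cts.
by apply: (@cts_comp _ _ _ h); [cts|apply: cts_fst; cts].
Qed.

Lemma hclassP X Y (f g : bmap X Y) :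
  hclass R f = hclass R g <-> homotopic R f g.
Proof.
split=> [/eqP|fg].
  by rewrite /hclass eqmodE => /asboolP.
by apply/eqP; rewrite /hclass eqmodE; apply/asboolP.
Qed.

Lemma hclass_repr X Y (a : hclasses R X Y) : hclass R (repr a) = a.
Proof. exact: reprK. Qed.

Lemma hclass_ind X Y (P : hclasses R X Y -> Prop) :
  (forall f, P (hclass R f)) -> forall a, P a.
Proof. by move=> Pf a; rewrite -(hclass_repr a). Qed.

Lemma hcompE X Y Z (g : bmap Y Z) (f : bmap X Y) :
  hcomp (hclass R g) (hclass R f) = hclass R (pcomp g f).
Proof.
rewrite /hcomp; apply/hclassP.
apply: (@homotopic_trans _ _ _ _ (pcomp g (repr (hclass R f)))).
  by apply: homotopic_pcompr; apply/hclassP; rewrite hclass_repr.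
by apply: homotopic_pcompl; apply/hclassP; rewrite hclass_repr.
Qed.

Definition hid X : hclasses R X X := hclass R (pid X).

Lemma hcompA X Y Z W (c : hclasses R Z W) (b : hclasses R Y Z)
    (a : hclasses R X Y) : hcomp c (hcomp b a) = hcomp (hcomp c b) a.
Proof.
elim/hclass_ind: a => f; elim/hclass_ind: b => g; elim/hclass_ind: c => h.
by rewrite !hcompE; congr hclass; exact: bmap_ext.
Qed.

Lemma hcomp1f X Y (a : hclasses R X Y) : hcomp (hid Y) a = a.
Proof.
by elim/hclass_ind: a => f; rewrite /hid hcompE; congr hclass; exact: bmap_ext.
Qed.

Lemma hcompf1 X Y (a : hclasses R X Y) : hcomp a (hid X) = a.
Proof.
by elim/hclass_ind: a => f; rewrite /hid hcompE; congr hclass; exact: bmap_ext.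
Qed.

Lemma hcomp0f X Y Z (a : hclasses R X Y) : hcomp (hzero R Y Z) a = hzero R X Z.
Proof.
by elim/hclass_ind: a => f; rewrite /hzero hcompE; congr hclass; exact: bmap_ext.
Qed.

(** Isomorphisms of the homotopy category; working with them makes the
    manipulation of equivalences equational. *)
Definition hiso X Y (a : hclasses R X Y) : Prop :=
  exists b : hclasses R Y X, hcomp b a = hid X /\ hcomp a b = hid Y.

Lemma hequivP X Y (f : bmap X Y) : hequiv R f <-> hiso (hclass R f).
Proof.
split=> [[g [/hclassP gf /hclassP fg]]|[b []]].
  by exists (hclass R g); rewrite !hcompE.
elim/hclass_ind: b => g; rewrite !hcompE => /hclassP gf /hclassP fg.
by exists g.
Qed.

Lemma hiso_id X : hiso (hid X).
Proof. by exists (hid X); rewrite hcomp1f. Qed.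

Lemma hiso_comp X Y Z (b : hclasses R Y Z) (a : hclasses R X Y) :
  hiso a -> hiso b -> hiso (hcomp b a).
Proof.
move=> [a' [a'a aa']] [b' [b'b bb']]; exists (hcomp a' b'); split.
  by rewrite -hcompA (hcompA b') b'b hcomp1f.
by rewrite -hcompA (hcompA a) aa' hcomp1f.
Qed.

Lemma hiso_inverses X Y (a : hclasses R X Y) (l r : hclasses R Y X) :
  hcomp l a = hid X -> hcomp a r = hid Y -> hiso a.
Proof.
move=> la ar; exists l; split => //.
suff -> : l = r by [].
by rewrite -(hcompf1 l) -ar hcompA la hcomp1f.
Qed.

(** The middle map of two-out-of-six: it has a left and a right inverse. *)
Lemma hiso_2of6 X Y Z W (c : hclasses R Z W) (b : hclasses R Y Z)
    (a : hclasses R X Y) : hiso (hcomp b a) -> hiso (hcomp c b) -> hiso b.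
Proof.
move=> [p [_ bap]] [q [qcb _]].
apply: (@hiso_inverses _ _ _ (hcomp q c) (hcomp a p)); first by rewrite -hcompA.
by rewrite hcompA.
Qed.

Lemma same_typeP X Y : same_type R X Y <-> exists a : hclasses R X Y, hiso a.
Proof.
split=> [[f /hequivP]|[a]]; first by exists (hclass R f).
by elim/hclass_ind: a => f /hequivP; exists f.
Qed.

Lemma same_type_sym X Y : same_type R X Y -> same_type R Y X.
Proof.
by move=> /same_typeP[a [b [? ?]]]; apply/same_typeP; exists b, a.
Qed.

Lemma same_type_trans X Y Z :
  same_type R X Y -> same_type R Y Z -> same_type R X Z.
Proof.
move=> /same_typeP[a ha] /same_typeP[b hb]; apply/same_typeP.
by exists (hcomp b a); exact: hiso_comp.
Qed.

Lemma hclasses_one_point X (a : hclasses R one_point X) :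
  a = hzero R one_point X.
Proof.
elim/hclass_ind: a => f; congr hclass; apply: bmap_ext => -[] /=.
exact: (bmap_pt f).
Qed.

Lemma contractible_zero X Y (a : hclasses R X Y) :
  same_type R X one_point -> a = hzero R X Y.
Proof.
move=> /same_typeP[b [c [cb _]]].
by rewrite -(hcompf1 a) -cb hcompA (hclasses_one_point (hcomp a c)) hcomp0f.
Qed.

End homotopy_category.

(** * Mapping cones *)

Lemma glue_eqP (T : topologicalType) (r : T -> T -> Prop) (x y : T) :
  \pi_(glue r) x = \pi_(glue r) y <-> clos_refl_sym_trans T r x y.
Proof.
by split=> [/eqmodP/asboolP|xy] //; exact/eqmodP/asboolP.
Qed.

Lemma clos_compat (T : Type) (Z : Type) (r : T -> T -> Prop) (F : T -> Z) :
  (forall x y, r x y -> F x = F y) ->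
  forall x y, clos_refl_sym_trans T r x y -> F x = F y.
Proof.
by move=> rF x y; elim=> [? ? /rF|//|? ? _ ->|? ? ? _ -> _ ->].
Qed.

Lemma glue_recE (T : topologicalType) (Z : Type) (r : T -> T -> Prop)
    (F : T -> Z) : (forall x y, r x y -> F x = F y) ->
  forall x, F (repr (\pi_(glue r) x)) = F x.
Proof. by move=> rF x; apply: (clos_compat rF); apply/glue_eqP; rewrite reprK. Qed.

Section cone.
Variables (R : realType) (A X : ptopologicalType) (f : bmap A X).
Let C : ptopologicalType := mapping_cone R f.

Definition cn (a : A) (t : unit_itv R) : C := \pi_C (cone_cyl X a t).

Lemma cn0 a : cn a (itv0 R) = cone_in R f (f a).
Proof. by apply/glue_eqP; apply: rst_step; constructor. Qed.

Lemma cn1 a : cn a (itv1 R) = point.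
Proof. by apply/glue_eqP; apply: rst_step; constructor. Qed.

Lemma cnp t : cn point t = point.
Proof. by apply/glue_eqP; apply: rst_step; constructor. Qed.

Lemma cn_cts : continuous (fun p : A * unit_itv R => cn p.1 p.2).
Proof.
move=> p; apply: (@continuous_comp _ _ _
  (fun q : A * unit_itv R => cone_cyl X q.1 q.2)); last exact: pi_continuous.
rewrite (_ : (fun _ => _) = existT (cone_part R A X) true).
  exact: existT_continuous.
by apply/funext => -[].
Qed.

Lemma cone_case (c : C) :
  (exists x, c = cone_in R f x) \/ exists a t, c = cn a t.
Proof.
rewrite -(reprK c); case: (repr c) => -[[a t]|x]; first by right; exists a, t.
by left; exists x.
Qed.

Definition cone_fun (Z : Type) (g : X -> Z) (H : A * unit_itv R -> Z)
    (z : cone_sum R A X) : Z :=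
  match z with
  | existT b y => (if b as b return cone_part R A X b -> Z then H else g) y
  end.

Definition cone_rec (Z : Type) (g : X -> Z) (H : A * unit_itv R -> Z) (c : C) :=
  cone_fun g H (repr c).

Section compatible.
Variables (Z : ptopologicalType) (g : X -> Z) (H : A * unit_itv R -> Z).
Hypotheses (H0 : forall a, H (a, itv0 R) = g (f a))
  (H1 : forall a, H (a, itv1 R) = point) (Hp : forall t, H (point, t) = point)
  (gp : g point = point).

Lemma cone_fun_rel x y : cone_rel f x y -> cone_fun g H x = cone_fun g H y.
Proof. by case=> [a|a|t] /=; rewrite ?H0 ?H1 ?Hp ?gp. Qed.

Lemma cone_rec_in x : cone_rec g H (cone_in R f x) = g x.
Proof. exact: (glue_recE cone_fun_rel). Qed.

Lemma cone_rec_cn a t : cone_rec g H (cn a t) = H (a, t).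
Proof. exact: (glue_recE cone_fun_rel). Qed.

End compatible.

(** The product with P keeps the cone a quotient of its two parts; with P an
    interval or a square this is what makes homotopies on the cone continuous. *)
Lemma cone_prod_cts (P Y : topologicalType) (h : C * P -> Y) :
  compact [set: P] -> hausdorff_space P ->
  continuous (fun x : X * P => h (cone_in R f x.1, x.2)) ->
  continuous (fun x : (A * unit_itv R) * P => h (cn x.1.1 x.1.2, x.2)) ->
  continuous h.
Proof.
move=> cP hP cX cA.
apply: (quotient_map_cts (quotient_map_prod cP hP (@glue_quotient_map _ (cone_rel f)))).
apply: sigT_quotient_cts => -[] //=.
by apply: cts_eq cA => -[[a t] p].
Qed.

Lemma cone_cts (Y : topologicalType) (h : C -> Y) :
  continuous (fun x => h (cone_in R f x)) ->
  continuous (fun x : A * unit_itv R => h (cn x.1 x.2)) ->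
  continuous h.
Proof.
move=> cX cA.
apply: (quotient_map_cts (@glue_quotient_map _ (cone_rel f))).
apply: cts_eq (@sigT_continuous _ (cone_part R A X) _
  (fun b x => h (\pi_C (existT _ b x))) _) => [[b x]//|[] //=].
by apply: cts_eq cA => -[a t].
Qed.

Lemma cone_map_cts (Z : ptopologicalType) (g : X -> Z) (H : A * unit_itv R -> Z) :
  continuous g -> continuous H ->
  (forall a, H (a, itv0 R) = g (f a)) -> (forall a, H (a, itv1 R) = point) ->
  (forall t, H (point, t) = point) -> g point = point ->
  continuous (cone_rec g H).
Proof.
move=> cg cH H0 H1 Hp gp; apply: cone_cts.
  by under eq_fun do rewrite cone_rec_in //.
by under eq_fun do rewrite cone_rec_cn // -surjective_pairing.
Qed.

(** The universal property of the cone. It returns the map as data together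
    with its values on both parts, which enter the explicit homotopies below. *)
Lemma cone_mapP (Z : ptopologicalType) (g : bmap X Z) (H : A * unit_itv R -> Z) :
  continuous H -> (forall a, H (a, itv0 R) = g (f a)) ->
  (forall a, H (a, itv1 R) = point) -> (forall t, H (point, t) = point) ->
  {h : bmap C Z | (forall x, h (cone_in R f x) = g x) &
                  (forall a t, h (cn a t) = H (a, t))}.
Proof.
move=> cH H0 H1 Hp.
have gp : g point = point := bmap_pt g.
have cg : continuous g := @bmap_cts _ _ g.
have hp : cone_rec g H point = point.
  by rewrite -[RHS]gp -(cone_rec_in H0 H1 Hp gp point).
exists (BMap (cone_map_cts cg cH H0 H1 Hp gp) hp) => /= *.
  by rewrite cone_rec_in.
by rewrite cone_rec_cn.
Qed.

Lemma cone_homotopy (Z : ptopologicalType) (u v : bmap C Z)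
    (K : X * unit_itv R -> Z) (G : (A * unit_itv R) * unit_itv R -> Z) :
  continuous K -> continuous G ->
  (forall x, K (x, itv0 R) = u (cone_in R f x)) ->
  (forall x, K (x, itv1 R) = v (cone_in R f x)) ->
  (forall s, K (point, s) = point) ->
  (forall a t, G (a, t, itv0 R) = u (cn a t)) ->
  (forall a t, G (a, t, itv1 R) = v (cn a t)) ->
  (forall a s, G (a, itv0 R, s) = K (f a, s)) ->
  (forall a s, G (a, itv1 R, s) = point) ->
  (forall t s, G (point, t, s) = point) ->
  homotopic R u v.
Proof.
move=> cK cG K0 K1 Kp G0 G1 Ga0 Ga1 Gp.
pose h (p : C * unit_itv R) :=
  cone_rec (fun x => K (x, p.2)) (fun q => G (q, p.2)) p.1.
have hin x s : h (cone_in R f x, s) = K (x, s) by rewrite /h cone_rec_in.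
have hcn a t s : h (cn a t, s) = G (a, t, s) by rewrite /h cone_rec_cn.
exists h; split=> [|c|c|s].
- apply: cone_prod_cts; first exact: unit_itv_compact.
  + exact: unit_itv_hausdorff.
  + by under eq_fun do rewrite hin -surjective_pairing.
  + by under eq_fun do rewrite hcn -!surjective_pairing.
- by case: (cone_case c) => [[x ->]|[a [t ->]]]; rewrite ?hin ?hcn.
- by case: (cone_case c) => [[x ->]|[a [t ->]]]; rewrite ?hin ?hcn.
- by rewrite (hin point).
Qed.

End cone.

(** * Homotopy invariance of the mapping cone *)

Section change_of_map.
Variables (R : realType) (A X : ptopologicalType).
Implicit Types (f : bmap A X) (H : A * unit_itv R -> X).
Local Notation I := (unit_itv R).

(** The cone on f with a collar: for negative s, the point at height s is moved
    along a homotopy H that ends at f. *)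
Definition collar f H (p : A * R) : mapping_cone R f :=
  if p.2 <= 0 then cone_in R f (H (p.1, clamp (1 + p.2)))
  else cn f p.1 (clamp p.2).

Lemma collar_lo f H a s :
  s <= 0 -> collar f H (a, s) = cone_in R f (H (a, clamp (1 + s))).
Proof. by rewrite /collar /= => ->. Qed.

Lemma collar_hi f H a s : (forall a, H (a, itv1 R) = f a) ->
  0 <= s -> collar f H (a, s) = cn f a (clamp s).
Proof.
move=> H1; rewrite /collar /= le_eqVlt => /orP[/eqP <-|s0].
  by rewrite lexx addr0 -/(itv1 R) H1 -/(itv0 R) cn0.
by rewrite leNgt s0.
Qed.

Lemma collar_cts f H : continuous H -> (forall a, H (a, itv1 R) = f a) ->
  continuous (collar f H).
Proof.
move=> cH H1; apply: cts_paste; first by cts.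
- apply: (@cts_comp _ _ _ (cone_in R f)); first by cts.
  by apply: (@cts_comp _ _ _ H) => //; cts.
- apply: (@cts_comp _ _ _ (fun p => cn f p.1 p.2) (fun p => (p.1, clamp p.2))).
    exact: cn_cts.
  by cts.
- by move=> [a s] /= ->; rewrite addr0 -/(itv1 R) H1 -/(itv0 R) cn0.
Qed.

Definition rev_homotopy H (p : A * I) : X :=
  H (p.1, clamp (1 - ival p.2)).

Lemma rev_homotopyK H : rev_homotopy (rev_homotopy H) = H.
Proof.
apply/funext => -[a t]; rewrite /rev_homotopy /= ival_clamp ?subKr ?clampK //.
by rewrite subr_ge0 ival_le1 gerBl ival_ge0.
Qed.

Lemma rev_homotopy_cts H : continuous H -> continuous (rev_homotopy H).
Proof. by move=> cH; apply: (@cts_comp _ _ _ H) => //; cts. Qed.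

Lemma rev_homotopy0 H a : rev_homotopy H (a, itv0 R) = H (a, itv1 R).
Proof. by rewrite /rev_homotopy /= ival0 subr0. Qed.

Lemma rev_homotopy1 H a : rev_homotopy H (a, itv1 R) = H (a, itv0 R).
Proof. by rewrite /rev_homotopy /= ival1 subrr. Qed.

(** The homotopy occupies the lower half of the cylinder, the cone the upper. *)
Lemma cone_shift f f' H : continuous H ->
  (forall a, H (a, itv0 R) = f a) -> (forall a, H (a, itv1 R) = f' a) ->
  (forall t, H (point, t) = point) ->
  {h : bmap (mapping_cone R f) (mapping_cone R f') |
    (forall x, h (cone_in R f x) = cone_in R f' x) &
    (forall a t, h (cn f a t) = collar f' H (a, ival t + ival t - 1))}.
Proof.
move=> cH H0 H1 Hp.
apply: (@cone_mapP _ _ _ f _ (cone_in R f')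
  (fun p => collar f' H (p.1, ival p.2 + ival p.2 - 1))) => [|a|a|t] /=.
- by apply: (@cts_comp _ _ _ (collar f' H)); [exact: collar_cts|cts].
- rewrite collar_lo ival0 addr0 add0r ?oppr_le0 ?ler01//.
  by rewrite subrr -/(itv0 R) H0.
- by rewrite collar_hi ?ival1 ?addrK ?ler01// -/(itv1 R) cn1.
- have [t0|t0] := leP (ival t + ival t - 1) 0.
    by rewrite collar_lo// Hp bmap_pt.
  by rewrite collar_hi// ?cnp// ltW.
Qed.

(** Traversing H and then its reverse: the excursion along H is first shrunk,
    then the cone is reparametrized. *)
Lemma cone_shiftK f f' H (h : bmap (mapping_cone R f) (mapping_cone R f'))
    (h' : bmap (mapping_cone R f') (mapping_cone R f)) : continuous H ->
  (forall a, H (a, itv0 R) = f a) -> (forall a, H (a, itv1 R) = f' a) ->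
  (forall t, H (point, t) = point) ->
  (forall x, h (cone_in R f x) = cone_in R f' x) ->
  (forall a t, h (cn f a t) = collar f' H (a, ival t + ival t - 1)) ->
  (forall x, h' (cone_in R f' x) = cone_in R f x) ->
  (forall a t, h' (cn f' a t) =
     collar f (rev_homotopy H) (a, ival t + ival t - 1)) ->
  homotopic R (pcomp h' h) (pid (mapping_cone R f)).
Proof.
move=> cH H0 H1 Hp hin hcn h'in h'cn.
(* The cone coordinate reached once the two excursions along H, which take the
   times [0, 1/2] and [1/2, 3/4], are over. *)
pose q (t : I) : R := ival t + ival t + ival t + ival t - 3.
have [m min mcn] : {m : bmap (mapping_cone R f) (mapping_cone R f) |
    (forall x, m (cone_in R f x) = cone_in R f x) &
    (forall a t, m (cn f a t) = cn f a (clamp (q t)))}.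
  apply: (@cone_mapP _ _ _ f _ (cone_in R f) (fun p => cn f p.1 (clamp (q p.2)))).
  - apply: (@cts_comp _ _ _ (fun p => cn f p.1 p.2)
      (fun p => (p.1, clamp (q p.2)))); first exact: cn_cts.
    by rewrite /q; cts.
  - by move=> a; rewrite clamp_le0 ?cn0// /q ival0; lra.
  - by move=> a; rewrite /= clamp_ge1 ?cn1// /q ival1; lra.
  - by move=> t; rewrite cnp.
apply: (@homotopic_trans _ _ _ _ m); last first.
  pose v (t s : I) : R := (1 - ival s) * q t + ival s * ival t.
  apply: (@cone_homotopy _ _ _ f _ m (pid _) (fun p => cone_in R f p.1)
    (fun p => cn f p.1.1 (clamp (v p.1.2 p.2)))) => //=.
  - by apply: (@cts_comp _ _ _ (cone_in R f)); cts.
  - apply: (@cts_comp _ _ _ (fun p => cn f p.1 p.2)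
      (fun p => (p.1.1, clamp (v p.1.2 p.2)))); first exact: cn_cts.
    by rewrite /v /q; cts.
  - by move=> x; rewrite -/(cone_in R f x) min.
  - by move=> a t; rewrite mcn /v ival0 subr0 mul1r mul0r addr0.
  - by move=> a t; rewrite /v ival1 subrr mul1r mul0r add0r clampK.
  - move=> a s; rewrite clamp_le0 ?cn0// /v /q ival0.
    by have := ival_ge0 s; have := ival_le1 s; nra.
  - move=> a s; rewrite clamp_ge1 ?cn1// /v /q ival1.
    by have := ival_ge0 s; have := ival_le1 s; nra.
  - by move=> t s; rewrite cnp.
(* The position on H: out at speed 2, back at speed 4. *)
pose w (t : I) := Num.min (ival t + ival t) (- q t).
pose G (p : (A * I) * I) : mapping_cone R f :=
  if q p.1.2 <= 0 then cone_in R f (H (p.1.1, clamp ((1 - ival p.2) * w p.1.2)))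
  else cn f p.1.1 (clamp (q p.1.2)).
apply: (@cone_homotopy _ _ _ f _ (pcomp h' h) m (fun p => cone_in R f p.1) G).
- by apply: (@cts_comp _ _ _ (cone_in R f)); cts.
- apply: cts_paste.
  + by rewrite /q; cts.
  + apply: (@cts_comp _ _ _ (cone_in R f)); first by cts.
    by apply: (@cts_comp _ _ _ H) => //; rewrite /w /q; cts.
  + apply: (@cts_comp _ _ _ (fun p => cn f p.1 p.2)
      (fun p => (p.1.1, clamp (q p.1.2)))); first exact: cn_cts.
    by rewrite /q; cts.
  + move=> [[a t] s] /= q0; rewrite q0 -/(itv0 R) cn0 -H0 /w q0 oppr0.
    rewrite (@clamp_le0 _ (_ * _))// mulr_ge0_le0 ?subr_ge0 ?ival_le1//.
    by rewrite ge_min lexx orbT.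
- by move=> x /=; rewrite hin h'in.
- by move=> x; rewrite min.
- by move=> s; rewrite bmap_pt.
- move=> a t; rewrite /G /= hcn ival0 subr0 mul1r.
  have t0 := ival_ge0 t; have t1 := ival_le1 t.
  have [t12|t12] := leP (ival t + ival t - 1) 0.
    rewrite collar_lo// h'in; have -> : q t <= 0 by rewrite /q; lra.
    rewrite /w (min_idPl _); last by rewrite /q; lra.
    by congr (cone_in R f (H (a, clamp _))); lra.
  rewrite collar_hi//; last exact: ltW.
  rewrite h'cn ival_clamp; last by apply/andP; split; lra.
  have -> : ival t + ival t - 1 + (ival t + ival t - 1) - 1 = q t.
    by rewrite /q; lra.
  have [q0|q0] := leP (q t) 0; last first.
    by rewrite collar_hi ?ltW// => b; rewrite rev_homotopy1.
  rewrite collar_lo// /rev_homotopy /= ival_clamp; last first.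
    by move: q0; rewrite /q => q0; apply/andP; split; lra.
  rewrite /w (min_idPr _); last by rewrite /q; lra.
  by congr (cone_in R f (H (a, clamp _))); lra.
- move=> a t; rewrite /G /= mcn ival1 subrr mul0r -/(itv0 R) H0.
  by case: ifPn => // q0; rewrite clamp_le0// cn0.
- move=> a s; rewrite /G /= /q /w ival0; case: ifPn => [_|]; last first.
    by rewrite -ltNge => ?; exfalso; lra.
  rewrite (min_idPl _); last by rewrite /q ival0; lra.
  by rewrite addr0 mulr0 -/(itv0 R) H0.
- move=> a s; rewrite /G /= /q ival1; case: ifPn => [?|_].
    by exfalso; lra.
  by rewrite clamp_ge1 ?cn1//; lra.
- move=> t s; rewrite /G /=; case: ifP => _; last by rewrite cnp.
  by rewrite Hp.
Qed.

Lemma cone_shift_hequiv f f' H (h : bmap (mapping_cone R f) (mapping_cone R f')) :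
  continuous H ->
  (forall a, H (a, itv0 R) = f a) -> (forall a, H (a, itv1 R) = f' a) ->
  (forall t, H (point, t) = point) ->
  (forall x, h (cone_in R f x) = cone_in R f' x) ->
  (forall a t, h (cn f a t) = collar f' H (a, ival t + ival t - 1)) ->
  hequiv R h.
Proof.
move=> cH H0 H1 Hp hin hcn; have cH' := rev_homotopy_cts cH.
have H'0 a : rev_homotopy H (a, itv0 R) = f' a by rewrite rev_homotopy0.
have H'1 a : rev_homotopy H (a, itv1 R) = f a by rewrite rev_homotopy1.
have H'p t : rev_homotopy H (point, t) = point by rewrite /rev_homotopy Hp.
have [h' h'in h'cn] := cone_shift cH' H'0 H'1 H'p.
exists h'; split; first exact: cone_shiftK h'in h'cn.
by apply: (cone_shiftK cH' H'0 H'1 H'p h'in h'cn hin); rewrite rev_homotopyK.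
Qed.

Lemma cone_homotopic f f' : homotopic R f f' ->
  same_type R (mapping_cone R f) (mapping_cone R f').
Proof.
move=> [H [cH H0 H1 Hp]]; have [h hin hcn] := cone_shift cH H0 H1 Hp.
by exists h; exact: cone_shift_hequiv hin hcn.
Qed.

End change_of_map.

Section change_of_source.
Variable R : realType.
Implicit Types A K X : ptopologicalType.

(** The composite f \o al is only required up to extensional equality: the two
    bracketings of a triple composite have different proofs of continuity. *)
Lemma cone_pre K A X (al : bmap K A) (f : bmap A X) (f' : bmap K X) :
  (forall k, f' k = f (al k)) ->
  {h : bmap (mapping_cone R f') (mapping_cone R f) |
    (forall x, h (cone_in R f' x) = cone_in R f x) &
    (forall k t, h (cn f' k t) = cn f (al k) t)}.
Proof.
move=> ff'; apply: (@cone_mapP _ _ _ f' _ (cone_in R f)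
  (fun p => cn f (al p.1) p.2)) => [|k|k|t] /=.
- apply: (@cts_comp _ _ _ (fun p => cn f p.1 p.2) (fun p => (al p.1, p.2))).
    exact: cn_cts.
  apply: cts_pair; last by cts.
  by apply: (@cts_comp _ _ _ al); cts.
- by rewrite cn0 ff'.
- by rewrite cn1.
- by rewrite bmap_pt cnp.
Qed.

(** A homotopy from al to the identity deforms h into the map of cones that
    comes from the resulting homotopy between f \o al and f, which is known to be
    an equivalence. *)
Lemma cone_pre_id A X (al : bmap A A) (f f' : bmap A X)
    (h : bmap (mapping_cone R f') (mapping_cone R f)) :
  homotopic R al (pid A) -> (forall a, f' a = f (al a)) ->
  (forall x, h (cone_in R f' x) = cone_in R f x) ->
  (forall a t, h (cn f' a t) = cn f (al a) t) -> hequiv R h.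
Proof.
move=> [H [cH H0 H1 Hp]] ff' hin hcn.
pose K p := f (H p).
have cK : continuous K by apply: cts_comp => //; cts.
have K0 a : K (a, itv0 R) = f' a by rewrite /K H0 ff'.
have K1 a : K (a, itv1 R) = f a by rewrite /K H1.
have Kp t : K (point, t) = point by rewrite /K Hp bmap_pt.
have [g gin gcn] := cone_shift cK K0 K1 Kp.
have /hequivP := cone_shift_hequiv cK K0 K1 Kp gin gcn.
suff /hclassP -> : homotopic R g h by move/hequivP.
apply: homotopic_sym.
pose v (t s : unit_itv R) := ival t - ival s * (1 - ival t).
apply: (@cone_homotopy _ _ _ f' _ h g (fun p => cone_in R f p.1)
    (fun p => cn f (H (p.1.1, clamp (ival p.2 * (ival p.1.2 + ival p.1.2))))
      (clamp (v p.1.2 p.2)))) => //=.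
- by apply: (@cts_comp _ _ _ (cone_in R f)); cts.
- apply: (@cts_comp _ _ _ (fun p => cn f p.1 p.2)
    (fun p => (H (p.1.1, clamp (ival p.2 * (ival p.1.2 + ival p.1.2))),
               clamp (v p.1.2 p.2)))); first exact: cn_cts.
  apply: cts_pair; last by rewrite /v; cts.
  by apply: (@cts_comp _ _ _ H); cts.
- by move=> x; rewrite -/(cone_in R f' x) hin.
- by move=> x; rewrite -/(cone_in R f' x) gin.
- move=> a t; rewrite hcn /v ival0 !mul0r subr0 -/(itv0 R) H0.
  by rewrite clampK.
- move=> a t; rewrite gcn /v ival1 !mul1r.
  have -> : ival t - (1 - ival t) = ival t + ival t - 1 by ring.
  have [t0|t0] := leP (ival t + ival t - 1) 0.
    rewrite collar_lo// (clamp_le0 t0) cn0 /K.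
    by have -> : 1 + (ival t + ival t - 1) = ival t + ival t by ring.
  rewrite collar_hi ?ltW// (@clamp_ge1 _ (_ + _)) ?H1//.
  by rewrite ltW// -subr_gt0.
- move=> a s; rewrite /v ival0 addr0 mulr0 -/(itv0 R) H0 clamp_le0 ?cn0 ?ff'//.
  by have := ival_ge0 s; lra.
- by move=> a s; rewrite /v ival1 subrr mulr0 subr0 -/(itv1 R) cn1.
- by move=> t s; rewrite Hp cnp.
Qed.

(** A homotopy inverse be of al induces maps in the other direction, but
    between cones of other maps: f \o al \o be and f \o al \o be \o al. Both
    composites of two consecutive ones fall under the previous case, whence two-out-of-six. *)
Lemma cone_pre_hequiv K A X (al : bmap K A) (f : bmap A X) (f' : bmap K X)
    (h : bmap (mapping_cone R f') (mapping_cone R f)) :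
  hequiv R al -> (forall k, f' k = f (al k)) ->
  (forall x, h (cone_in R f' x) = cone_in R f x) ->
  (forall k t, h (cn f' k t) = cn f (al k) t) -> hequiv R h.
Proof.
move=> [be [ba ab]] ff' hin hcn.
pose f2 := pcomp f' be; pose f3 := pcomp f2 al.
have [b bin bcn] := @cone_pre _ _ _ be f' f2 (fun _ => erefl).
have [c cin ccn] := @cone_pre _ _ _ al f2 f3 (fun _ => erefl).
have hb : hiso (hcomp (hclass R h) (hclass R b)).
  rewrite hcompE; apply/hequivP.
  apply: (@cone_pre_id _ _ (pcomp al be) f f2) => //=.
  - by move=> x; rewrite -/(cone_in R f2 x) bin hin.
  - by move=> a t; rewrite bcn hcn.
have bc : hiso (hcomp (hclass R b) (hclass R c)).
  rewrite hcompE; apply/hequivP.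
  apply: (@cone_pre_id _ _ (pcomp be al) f' f3) => //=.
  - by move=> x; rewrite -/(cone_in R f3 x) cin bin.
  - by move=> a t; rewrite ccn bcn.
have [d [db bd]] := hiso_2of6 bc hb.
apply/hequivP; rewrite -(hcompf1 (hclass R h)) -bd hcompA.
by apply: hiso_comp => //; exists (hclass R b).
Qed.

Lemma cone_pre_same_type K A X (al : bmap K A) (f : bmap A X) (f' : bmap K X) :
  hequiv R al -> (forall k, f' k = f (al k)) ->
  same_type R (mapping_cone R f') (mapping_cone R f).
Proof.
move=> eal ff'; have [h hin hcn] := cone_pre ff'.
by exists h; exact: cone_pre_hequiv hcn.
Qed.

End change_of_source.

(** * Killing length bounds nilpotency *)

Section wedge.
Variables (R : realType) (J : pointedType) (A : J -> ptopologicalType).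

Lemma wedge_in_pt j : wedge_lift (fun i => @point (A i)) (@point (A j)) =
  (point : pwedge A).
Proof. exact: (wedge_liftE (fun i => @point (A i)) point point). Qed.

Definition wedge_in j : bmap (A j) (pwedge A) :=
  @BMap (A j) (pwedge A) (@wedge_lift _ A (fun i => @point (A i)) j)
    (@wedge_lift_continuous _ A (fun i => @point (A i)) j) (wedge_in_pt j).

Lemma wedge_quotient_map :
  quotient_map (fun x : {j & A j} => wedge_in (projT1 x) (projT2 x)).
Proof.
split=> [w|V oV].
  have : (\bigcup_j (@wedge_lift _ A (fun i => point) j) @` setT) w.
    by rewrite wedgeTE.
  by move=> [j _ [a _ <-]]; exists tt, (existT _ j a).
apply/(@wedge_openP _ A (fun i => point)) => j.
by move/sigT_openP : (oV tt) => /(_ j).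
Qed.

Lemma wedge_prod_cts (P Y : topologicalType) (h : pwedge A * P -> Y) :
  compact [set: P] -> hausdorff_space P ->
  (forall j, continuous (fun x : A j * P => h (wedge_in j x.1, x.2))) ->
  continuous h.
Proof.
move=> cP hP cj.
apply: (quotient_map_cts (quotient_map_prod cP hP wedge_quotient_map)).
by apply: sigT_quotient_cts => j; exact: cj.
Qed.

Lemma wedge_in_ind (Q : pwedge A -> Prop) :
  (forall j a, Q (wedge_in j a)) -> forall w, Q w.
Proof. by move=> Qj w; have [_ [[j a] <-]] := wedge_quotient_map.1 w. Qed.

Lemma wedge_rec_in (Z : Type) (z : Z) (g : forall j, A j -> Z) j a :
  (forall j, g j point = z) ->
  wedge_fun (p0 := fun i => @point (A i)) g (wedge_in j a) = g j a.
Proof. by move=> gz; apply: wedge_lift_funE => i k; rewrite !gz. Qed.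

(** The null homotopies on the summands are stationary at the base point, so they
    agree there; an infinite wedge times the interval still has the quotient
    topology by Whitehead's lemma. *)
Lemma wedge_null (X : ptopologicalType) (v : bmap (pwedge A) X) :
  (forall j, homotopic R (pcomp v (wedge_in j)) (pconst (A j) X)) ->
  homotopic R v (pconst (pwedge A) X).
Proof.
move=> Hex; pose H j := projT1 (cid (Hex j)); 
have Hj j : [/\ continuous (H j), forall a, H j (a, itv0 R) = v (wedge_in j a),
    forall a, H j (a, itv1 R) = point & forall t, H j (point, t) = point].
  exact: projT2 (cid (Hex j)).
have Hp t j : H j (point, t) = point by have [_ _ _ ->] := Hj j.
pose h (p : pwedge A * unit_itv R) :=
  wedge_fun (p0 := fun i => @point (A i)) (fun j a => H j (a, p.2)) p.1.
have hE j a t : h (wedge_in j a, t) = H j (a, t).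
  by rewrite /h /= (@wedge_rec_in _ point).
exists h; split=> [|w|w|t].
- apply: wedge_prod_cts; [exact: unit_itv_compact|exact: unit_itv_hausdorff|].
  move=> j; have [cH _ _ _] := Hj j.
  by apply: cts_eq cH => -[a t] /=; rewrite hE.
- by elim/wedge_in_ind: w => j a; rewrite hE; have [_ -> _ _] := Hj j.
- by elim/wedge_in_ind: w => j a; rewrite hE; have [_ _ -> _] := Hj j.
- by rewrite -(bmap_pt (wedge_in point)) hE Hp.
Qed.

End wedge.

Section killing.
Variables (R : realType) (F : ptopologicalType -> Prop).
Implicit Types X Y Z : ptopologicalType.

Lemma cone_extend A X Z (f : bmap A X) (g : bmap X Z) :
  homotopic R (pcomp g f) (pconst A Z) ->
  exists h : bmap (mapping_cone R f) Z, pcomp h (cone_in R f) = g.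
Proof.
move=> [H [cH H0 H1 Hp]].
have [h hin _] := @cone_mapP _ _ _ f _ g H cH H0 H1 Hp.
by exists h; apply: bmap_ext.
Qed.

Lemma cofiber_extend A X Y Z (f : bmap A X) (g : bmap X Y) (h : bmap X Z) :
  cofiber_seq R f g -> homotopic R (pcomp h f) (pconst A Z) ->
  exists k : hclasses R Y Z, hclass R h = hcomp k (hclass R g).
Proof.
move=> [e [/hequivP[e' [e'e _]] /hclassP eg]] /cone_extend[k <-].
exists (hcomp (hclass R k) e').
by rewrite -eg -!hcompE -hcompA (hcompA e') e'e hcomp1f.
Qed.

(** An element of Z_F(Z) kills every map into Z from a member of F, so it kills
    the attaching map from the wedge and extends over the next stage. *)
Lemma killing_extend X Y Z (a : hclasses R Z Z) (h : hclasses R X Z) :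
  wedge_cofibration R F X Y -> Z_ F a ->
  exists (k : hclasses R Y Z) (g : hclasses R X Y), hcomp a h = hcomp k g.
Proof.
move=> [J [A [FA [f [g fg]]]]] Za; elim/hclass_ind: h => h.
elim/hclass_ind: a Za => a Za; rewrite hcompE.
have [|k kg] := @cofiber_extend _ _ _ Z f g (pcomp a h) fg.
  apply: wedge_null => j; apply/hclassP.
  have := Za _ (FA j) (hclass R (pcomp h (pcomp f (wedge_in A j)))).
  by rewrite -/(hzero R _ _) hcompE => <-; congr hclass; exact: bmap_ext.
by exists k, (hclass R g).
Qed.

(** Induction on m, absorbing the last letter of the word, which is the first to
    be applied. *)
Lemma killing_word m (X_ : nat -> ptopologicalType) Z (h : hclasses R (X_ 0%N) Z)
    (s : seq (hclasses R Z Z)) (b : hclasses R Z Z) :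
  (forall i, (i < m)%N -> wedge_cofibration R F (X_ i) (X_ i.+1)) ->
  same_type R (X_ m) one_point ->
  size s = m -> (forall y, y \in s -> Z_ F y) ->
  hcomp (foldl (@hcomp R Z Z Z) b s) h = hzero R (X_ 0%N) Z.
Proof.
elim: m X_ h s => [|m IH] X_ h s wc Xm.
  move=> _ _; exact: contractible_zero.
case/lastP: s => // s a; rewrite size_rcons => -[sm] Zs.
have Za : Z_ F a by apply: Zs; rewrite mem_rcons mem_head.
have [k [g kg]] := killing_extend h (wc 0%N isT) Za.
rewrite foldl_rcons -hcompA kg hcompA.
rewrite (IH (fun i => X_ i.+1) k s) ?hcomp0f//.
  by move=> i im; exact: wc.
by move=> y ys; apply: Zs; rewrite mem_rcons inE ys orbT.
Qed.

End killing.

Lemma least_le (R : realType) (P Q : set nat) :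
  P `<=` Q -> (least R Q <= least R P)%E.
Proof.
by move=> PQ; apply: le_ereal_inf => _ [n /PQ Qn <-]; exists n.
Qed.

Lemma t_le_kl (R : realType) (F : ptopologicalType -> Prop)
    (X : ptopologicalType) : (t_ R F X <= kl R F X)%E.
Proof.
rewrite /t_ /kl; case: ifPn => // /asboolPn Xnc.
apply: least_le => m [X_ [[sX wc] X0 Xm]].
case: m => [|m] in sX wc Xm *.
  by exfalso; apply: Xnc; apply: same_type_trans Xm; exact: same_type_sym.
split=> // x s sm Zs.
(* The product is zero after composition with an equivalence X_0 -> X. *)
have /same_typeP[p [h [hp ph]]] := X0.
have := killing_word p (hid R X) wc Xm sm Zs.
rewrite /= hcomp1f => e.
by rewrite -(hcompf1 (foldl _ _ _)) -ph hcompA e hcomp0f.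
Qed.

(** * Suspensions *)

Section suspension.
Variables (R : realType) (A : ptopologicalType).
Local Notation I := (unit_itv R).
Let S : ptopologicalType := suspension R A.

Definition sp (a : A) (t : I) : S := \pi_S (a, t).

Lemma spp t : sp point t = point.
Proof. by apply/glue_eqP; apply: rst_step; constructor. Qed.

Lemma sp0 a : sp a (itv0 R) = point.
Proof. by apply/glue_eqP; apply: rst_step; constructor. Qed.

Lemma sp1 a : sp a (itv1 R) = point.
Proof. by apply/glue_eqP; apply: rst_step; constructor. Qed.

Lemma sp_cts : continuous (fun p : A * I => sp p.1 p.2).
Proof.
apply: (@cts_eq _ _ (\pi_S : A * I -> S)) => [[a t]//|].
exact: pi_continuous.
Qed.

Lemma sp_ind (Q : S -> Prop) : (forall a t, Q (sp a t)) -> forall y, Q y.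
Proof. by move=> Qat y; rewrite -(reprK y); case: (repr y). Qed.

Lemma susp_prod_cts (P Y : topologicalType) (h : S * P -> Y) :
  compact [set: P] -> hausdorff_space P ->
  continuous (fun x : (A * I) * P => h (sp x.1.1 x.1.2, x.2)) ->
  continuous h.
Proof.
move=> cP hP ch.
apply: (quotient_map_cts
  (quotient_map_prod cP hP (@glue_quotient_map _ (@susp_rel R A)))).
by apply: cts_eq ch => -[[a t] p].
Qed.

Definition susp_rec (Z : Type) (H : A * I -> Z) (y : S) : Z := H (repr y).

Lemma susp_recE (Z : Type) (z : Z) (H : A * I -> Z) a t :
  (forall a, H (a, itv0 R) = z) -> (forall a, H (a, itv1 R) = z) ->
  (forall t, H (point, t) = z) -> susp_rec H (sp a t) = H (a, t).
Proof.
move=> H0 H1 Hp; apply: (@glue_recE _ _ (@susp_rel R A) H).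
by move=> x y [b|b|s]; rewrite ?H0 ?H1 ?Hp.
Qed.

Lemma susp_mapP (Z : ptopologicalType) (H : A * I -> Z) :
  continuous H -> (forall a, H (a, itv0 R) = point) ->
  (forall a, H (a, itv1 R) = point) -> (forall t, H (point, t) = point) ->
  {h : bmap S Z | forall a t, h (sp a t) = H (a, t)}.
Proof.
move=> cH H0 H1 Hp.
have hE a t : susp_rec H (sp a t) = H (a, t) by rewrite (susp_recE _ _ H0).
have hc : continuous (susp_rec H).
  apply: (quotient_map_cts (@glue_quotient_map _ (@susp_rel R A))).
  by apply: cts_eq cH => -[a t]; rewrite -hE.
by exists (BMap hc (etrans (hE point (itv0 R)) (H0 _))).
Qed.

End suspension.

Lemma wedge_mapP (J : pointedType) (A : J -> ptopologicalType)
    (Z : ptopologicalType) (g : forall j, bmap (A j) Z) :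
  {h : bmap (pwedge A) Z | forall j a, h (wedge_in A j a) = g j a}.
Proof.
pose h : pwedge A -> Z := wedge_fun (p0 := fun i => @point (A i)) (fun j => g j).
have hE j a : h (wedge_in A j a) = g j a.
  by apply: (@wedge_rec_in _ _ _ point (fun j => g j)) => i; exact: bmap_pt.
have hc : continuous h.
  by apply: wedge_fun_continuous => [i|i j]; rewrite ?bmap_pt //; cts.
have hp : h point = point.
  by rewrite -(bmap_pt (wedge_in A point)) hE bmap_pt.
by exists (BMap hc hp).
Qed.

(** The two canonical maps are inverse to each other on the nose, on the points
    (a, t) of the cylinders. *)
Lemma susp_wedge (R : realType) (J : pointedType) (A : J -> ptopologicalType) :
  exists w : bmap (pwedge (fun j => suspension R (A j) : ptopologicalType))
                  (suspension R (pwedge A)), hequiv R w.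
Proof.
have /all_sig[b bE] j : {b : bmap (suspension R (A j)) (suspension R (pwedge A)) |
    forall a t, b (sp a t) = sp (wedge_in A j a) t}.
  apply: (@susp_mapP R (A j) _ (fun p => sp (wedge_in A j p.1) p.2)).
  - apply: (@cts_comp _ _ _ (fun p => sp p.1 p.2)
      (fun p => (wedge_in A j p.1, p.2))); first exact: sp_cts.
    apply: cts_pair; last by cts.
    by apply: (@cts_comp _ _ _ (wedge_in A j)); cts.
  - by move=> a; rewrite sp0.
  - by move=> a; rewrite sp1.
  - by move=> t; rewrite bmap_pt spp.
have [w wE] := wedge_mapP b.
pose B j : ptopologicalType := suspension R (A j).
pose H (p : pwedge A * unit_itv R) : pwedge B :=
  wedge_fun (p0 := fun i => @point (A i)) (fun j a => wedge_in B j (sp a p.2)) p.1.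
have HE j a t : H (wedge_in A j a, t) = wedge_in B j (sp a t).
  rewrite /H (@wedge_rec_in _ _ _ point (fun j a => wedge_in B j (sp a t))) //.
  by move=> i; rewrite spp bmap_pt.
have [||||v vE] := @susp_mapP R (pwedge A) (pwedge B) H.
- apply: wedge_prod_cts; [exact: unit_itv_compact|exact: unit_itv_hausdorff|].
  move=> j; apply: (@cts_eq _ _ (fun p => wedge_in B j (sp p.1 p.2))).
    by move=> [a t]; rewrite HE.
  by apply: (@cts_comp _ _ _ (wedge_in B j)); [cts|exact: sp_cts].
- by elim/wedge_in_ind => j a; rewrite HE sp0 bmap_pt.
- by elim/wedge_in_ind => j a; rewrite HE sp1 bmap_pt.
- by move=> t; rewrite -(bmap_pt (wedge_in A point)) HE spp bmap_pt.
exists w; exists v; split; apply/hclassP; congr hclass; apply: bmap_ext.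
  elim/wedge_in_ind => j; elim/sp_ind => a t /=.
  by rewrite wE bE vE HE.
by elim/sp_ind => + t; elim/wedge_in_ind => j a /=; rewrite vE HE wE bE.
Qed.

(** * The Puppe sequence of a composite *)

Section puppe.
Variables (R : realType) (L X Z : ptopologicalType).
Variables (f : bmap L X) (g : bmap (mapping_cone R f) Z).
Local Notation I := (unit_itv R).

Let gj : bmap X Z := pcomp g (cone_in R f).
Let Y : ptopologicalType := mapping_cone R gj.
Let C : ptopologicalType := mapping_cone R g.

(** The two edges u = 0 and t = 0 of the square of all points [[l, u], t] of
    the iterated cone; both are seen in Y. *)
Let edge (p : L * R) : Y :=
  if p.2 <= 0 then cn gj (f p.1) (clamp (- p.2))
  else cone_in R gj (g (cn f p.1 (clamp p.2))).

Let edge_lo l s : s <= 0 -> edge (l, s) = cn gj (f l) (clamp (- s)).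
Proof. by rewrite /edge /= => ->. Qed.

Let edge_hi l s : 0 <= s -> edge (l, s) = cone_in R gj (g (cn f l (clamp s))).
Proof.
rewrite le_eqVlt => /orP[/eqP <-|s0]; last by rewrite /edge /= leNgt s0.
by rewrite edge_lo// oppr0 -/(itv0 R) !cn0.
Qed.

Let edge_cts : continuous edge.
Proof.
apply: cts_paste; first by cts.
- apply: (@cts_comp _ _ _ (fun p => cn gj p.1 p.2)
    (fun p => (f p.1, clamp (- p.2)))); first exact: cn_cts.
  by apply: cts_pair; [apply: (@cts_comp _ _ _ f)|]; cts.
- apply: (@cts_comp _ _ _ (cone_in R gj)); first by cts.
  apply: (@cts_comp _ _ _ g); first by cts.
  apply: (@cts_comp _ _ _ (fun p => cn f p.1 p.2) (fun p => (p.1, clamp p.2))).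
    exact: cn_cts.
  by cts.
- by move=> [l s] /= ->; rewrite oppr0 -/(itv0 R) !cn0.
Qed.

(** Suspension coordinates are stretched to [-1, 1], with 0 where the edges meet. *)
Let dbl (t : I) : R := ival t + ival t - 1.

Let puppe_map : {s : bmap (suspension R L) Y |
  forall l t, s (sp l t) = edge (l, dbl t)}.
Proof.
apply: (@susp_mapP R L Y (fun p => edge (p.1, dbl p.2))) => [|l|l|t] /=.
- by apply: (@cts_comp _ _ _ edge); [exact: edge_cts|rewrite /dbl; cts].
- rewrite edge_lo /dbl ival0; last by lra.
  by rewrite clamp_ge1 ?cn1//; lra.
- rewrite edge_hi /dbl ival1; last by lra.
  by rewrite clamp_ge1 ?cn1 ?bmap_pt//; lra.
- have [?|/ltW ?] := leP (dbl t) 0; first by rewrite edge_lo// bmap_pt cnp.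
  by rewrite edge_hi// cnp !bmap_pt.
Qed.

Let s := sval puppe_map.
Let sE l t : s (sp l t) = edge (l, dbl t). Proof. exact: (svalP puppe_map). Qed.

Let D : ptopologicalType := mapping_cone R s.

Let cone_j : {h : bmap Y C | (forall x, h (cone_in R gj x) = cone_in R g x) &
    (forall k t, h (cn gj k t) = cn g (cone_in R f k) t)}.
Proof. exact: cone_pre. Qed.

Let sq (l : L) (u t : R) : C := cn g (cn f l (clamp u)) (clamp t).

Let sq_cts (T : topologicalType) (l : T -> L) (u t : T -> R) :
  continuous l -> continuous u -> continuous t ->
  continuous (fun p => sq (l p) (u p) (t p)).
Proof.
move=> cl cu ct; apply: (@cts_comp _ _ _ (fun p => cn g p.1 p.2)
  (fun p => (cn f (l p) (clamp (u p)), clamp (t p)))); first exact: cn_cts.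
apply: cts_pair; last by cts.
apply: (@cts_comp _ _ _ (fun p => cn f p.1 p.2) (fun p => (l p, clamp (u p)))).
  exact: cn_cts.
by cts.
Qed.

Let sq_u1 l u t : 1 <= u -> sq l u t = point.
Proof. by move=> u1; rewrite /sq clamp_ge1// cn1 cnp. Qed.

Let sq_t1 l u t : 1 <= t -> sq l u t = point.
Proof. by move=> t1; rewrite /sq (clamp_ge1 t1) cn1. Qed.

Let sq_pt u t : sq point u t = point.
Proof. by rewrite /sq !cnp. Qed.

Let pos (x : R) := Num.max x 0.

Let posE x : (0 <= x /\ pos x = x /\ pos (- x) = 0) \/
             (x <= 0 /\ pos x = 0 /\ pos (- x) = - x).
Proof.
rewrite /pos; have /orP[x0|x0] := le_total 0 x; [left|right].
  by rewrite (max_idPl x0) (max_idPr _)// oppr_le0.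
by rewrite (max_idPr x0) (max_idPl _)// oppr_ge0.
Qed.

(** Radial coordinates on the square, centred at the corner u = t = 1: x is the
    position on the edge and r the distance travelled towards the corner. *)
Let ray (x r : R) : R := (1 - r) * pos x + r.

Let Wfun (p : L * I * I) : C :=
  sq p.1.1 (ray (dbl p.1.2) (ival p.2)) (ray (- dbl p.1.2) (ival p.2)).

Let Wfun_cts : continuous Wfun.
Proof. by apply: sq_cts; rewrite /ray /pos /dbl; cts. Qed.

Let Wfun0 l r : Wfun (l, itv0 R, r) = point.
Proof.
apply: sq_t1; rewrite /ray /dbl /pos /= ival0 (max_idPl _); last by lra.
by rewrite le_eqVlt; apply/orP; left; apply/eqP; ring.
Qed.

Let Wfun1 l r : Wfun (l, itv1 R, r) = point.
Proof.
apply: sq_u1; rewrite /ray /dbl /pos /= ival1 (max_idPl _); last by lra.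
by rewrite le_eqVlt; apply/orP; left; apply/eqP; ring.
Qed.

Let Wfunp t r : Wfun (point, t, r) = point. Proof. exact: sq_pt. Qed.

Let WH (p : suspension R L * I) : C := susp_rec (fun q => Wfun (q, p.2)) p.1.

Let WHE l t r : WH (sp l t, r) = Wfun (l, t, r).
Proof.
by rewrite /WH (susp_recE (z := point)) // => ?; rewrite ?Wfun0 ?Wfun1 ?Wfunp.
Qed.

Let W : {h : bmap D C | (forall y, h (cone_in R s y) = sval cone_j y) &
  (forall y r, h (cn s y r) = WH (y, r))}.
Proof.
have [jin jcn] := svalP cone_j.
apply: cone_mapP.
- apply: susp_prod_cts; [exact: unit_itv_compact|exact: unit_itv_hausdorff|].
  by apply: cts_eq Wfun_cts => -[[l t] r]; rewrite WHE.
- elim/sp_ind => l t; rewrite WHE sE /Wfun /= ival0 /ray subr0 !mul1r !addr0.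
  have [[t0 [-> ->]]|[t0 [-> ->]]] := posE (dbl t).
    by rewrite edge_hi// jin /sq -/(itv0 R) cn0.
  by rewrite edge_lo// jcn /sq -/(itv0 R) cn0.
- by elim/sp_ind => l t; rewrite WHE; apply: sq_u1; rewrite /ray ival1; lra.
- by move=> t; rewrite -(spp L (itv0 R)) WHE Wfunp.
Qed.

Let den (r : R) : R := Num.max (1 - r) 2^-1.

Let den_neq0 r : den r != 0.
Proof. by rewrite gt_eqF// /den lt_max invr_gt0 ltr0n orbT. Qed.

Let pol (u t : R) : R := (u - t) / den (Num.min u t).

(** Inverse of the radial coordinates, truncated at half the distance to the
    corner so that it stays continuous there. *)
Let Vfun (p : L * I * I) : D :=
  let u := ival p.1.2 in let t := ival p.2 in
  cn s (sp p.1.1 (clamp (2^-1 * (1 + pol u t)))) (clamp (2 * Num.min u t)).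

Let Vfun_cts : continuous Vfun.
Proof.
apply: (@cts_comp _ _ _ (fun p => cn s p.1 p.2) (fun p : L * I * I =>
  (sp p.1.1 (clamp (2^-1 * (1 + pol (ival p.1.2) (ival p.2)))),
   clamp (2 * Num.min (ival p.1.2) (ival p.2))))); first exact: cn_cts.
apply: cts_pair; last by cts.
apply: (@cts_comp _ _ _ (fun p => sp p.1 p.2) (fun p : L * I * I =>
  (p.1.1, clamp (2^-1 * (1 + pol (ival p.1.2) (ival p.2)))))).
  exact: sp_cts.
rewrite /pol; cts; apply: cts_inv => [x|]; first exact: den_neq0.
by rewrite /den; cts.
Qed.

Let Vfun_u0 l t : Vfun (l, itv0 R, t) = cone_in R s (cn gj (f l) t).
Proof.
have t0 := ival_ge0 t; have t1 := ival_le1 t.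
rewrite /Vfun /pol /= ival0 (min_idPl t0) mulr0 -/(itv0 R) cn0 sE /den.
rewrite subr0 (max_idPl _); last by lra.
rewrite divr1 /dbl ival_clamp; last by apply/andP; split; lra.
rewrite edge_lo; last by lra.
by congr (cone_in R s (cn gj (f l) _)); rewrite -[RHS]clampK; congr clamp; lra.
Qed.

Let Vfun_t0 l u :
  Vfun (l, u, itv0 R) = cone_in R s (cone_in R gj (g (cn f l u))).
Proof.
have t0 := ival_ge0 u; have t1 := ival_le1 u.
rewrite /Vfun /pol /= ival0 (min_idPr t0) mulr0 -/(itv0 R) cn0 sE /den.
rewrite !subr0 (max_idPl _); last by lra.
rewrite divr1 /dbl ival_clamp; last by apply/andP; split; lra.
rewrite edge_hi; last by lra.
congr (cone_in R s (cone_in R gj (g (cn f l _)))).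
by rewrite -[RHS]clampK; congr clamp; lra.
Qed.

Let Vfun_u1 l t : Vfun (l, itv1 R, t) = point.
Proof.
have t0 := ival_ge0 t; have t1 := ival_le1 t.
rewrite /Vfun /pol /= ival1 (min_idPr t1).
have [th|/ltW th] := leP 2^-1 (ival t).
  by rewrite (@clamp_ge1 _ (2 * _)) ?cn1//; lra.
rewrite /den (max_idPl _); last by lra.
rewrite divff; last by rewrite gt_eqF//; lra.
by rewrite clamp_ge1 ?sp1 ?cnp//; lra.
Qed.

Let Vfun_t1 l u : Vfun (l, u, itv1 R) = point.
Proof.
have t0 := ival_ge0 u; have t1 := ival_le1 u.
rewrite /Vfun /pol /= ival1 (min_idPl t1).
have [th|/ltW th] := leP 2^-1 (ival u).
  by rewrite (@clamp_ge1 _ (2 * _)) ?cn1//; lra.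
rewrite /den (max_idPl _); last by lra.
have -> : (ival u - 1) / (1 - ival u) = -1.
  by rewrite -opprB mulNr divff// gt_eqF//; lra.
by rewrite clamp_le0 ?sp0 ?cnp//; lra.
Qed.

Let Vfunp u t : Vfun (point, u, t) = point.
Proof. by rewrite /Vfun /= spp cnp. Qed.

Let VH (p : mapping_cone R f * I) : D :=
  cone_rec (fun x => cone_in R s (cn gj x p.2)) (fun q => Vfun (q, p.2)) p.1.

Let VH_in x t : VH (cone_in R f x, t) = cone_in R s (cn gj x t).
Proof.
by rewrite /VH cone_rec_in// => *; rewrite ?Vfun_u0 ?Vfun_u1 ?Vfunp ?cnp ?bmap_pt.
Qed.

Let VH_cn l u t : VH (cn f l u, t) = Vfun (l, u, t).
Proof.
by rewrite /VH cone_rec_cn// => *; rewrite ?Vfun_u0 ?Vfun_u1 ?Vfunp ?cnp ?bmap_pt.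
Qed.

Let V : {h : bmap C D |
  (forall z, h (cone_in R g z) = cone_in R s (cone_in R gj z)) &
  (forall c t, h (cn g c t) = VH (c, t))}.
Proof.
apply: (@cone_mapP _ _ _ g _ (pcomp (cone_in R s) (cone_in R gj))).
- apply: cone_prod_cts; [exact: unit_itv_compact|exact: unit_itv_hausdorff| |].
    apply: (@cts_eq _ _ (fun p => cone_in R s (cn gj p.1 p.2))) => [[x t]|].
      by rewrite VH_in.
    by apply: (@cts_comp _ _ _ (cone_in R s)); [cts|exact: cn_cts].
  by apply: cts_eq Vfun_cts => -[[l u] t]; rewrite VH_cn.
- move=> c; have [[x ->]|[l [u ->]]] := cone_case c.
    by rewrite VH_in cn0.
  by rewrite VH_cn Vfun_t0.
- move=> c; have [[x ->]|[l [u ->]]] := cone_case c.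
    by rewrite VH_in cn1 bmap_pt.
  by rewrite VH_cn Vfun_t1.
- by move=> t; rewrite (VH_in point) cnp bmap_pt.
Qed.

(** W \o V moves points along the rays, which keeps each of the four edges in
    itself, so it is joined to the identity by a straight line. *)
Let WVfun (p : L * I * (I * I)) : C :=
  let u := ival p.1.2 in let t := ival p.2.1 in let c := ival p.2.2 in
  let x := dbl (clamp (2^-1 * (1 + pol u t))) in
  let r := ival (clamp (2 * Num.min u t)) in
  sq p.1.1 ((1 - c) * ray x r + c * u) ((1 - c) * ray (- x) r + c * t).

Let WVfun_cts : continuous WVfun.
Proof.
have cpol : continuous (fun p : L * I * (I * I) => pol (ival p.1.2) (ival p.2.1)).
  rewrite /pol; cts; apply: cts_inv => [x|]; first exact: den_neq0.
  by rewrite /den; cts.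
by apply: sq_cts; rewrite /ray /dbl /pos; cts.
Qed.

Let pol_bound (u t : R) : 0 <= u <= 1 -> 0 <= t <= 1 -> -1 <= pol u t <= 1.
Proof.
move=> /andP[u0 u1] /andP[t0 t1]; rewrite /pol /den.
set d := Num.max _ _; have d0 : 0 < d by rewrite lt_max invr_gt0 ltr0n orbT.
have dm : 1 - Num.min u t <= d by rewrite le_max lexx.
rewrite ler_pdivlMr// ler_pdivrMr//.
have /orP[ut|tu] := le_total u t.
  by rewrite (min_idPl ut) in dm; apply/andP; split; lra.
by rewrite (min_idPr tu) in dm; apply/andP; split; lra.
Qed.

Let dbl_pol (u t : I) :
  dbl (clamp (2^-1 * (1 + pol (ival u) (ival t)))) = pol (ival u) (ival t).
Proof.
have /andP[p0 p1] := pol_bound (ivalP u) (ivalP t).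
by rewrite /dbl ival_clamp; [lra|apply/andP; split; lra].
Qed.

Let WVfun_u0 l t c : WVfun (l, itv0 R, (t, c)) = cn g (cone_in R f (f l)) t.
Proof.
have t0 := ival_ge0 t; have t1 := ival_le1 t.
rewrite /WVfun dbl_pol /= /pol ival0 (min_idPl t0) mulr0 -/(itv0 R) ival0.
rewrite /den subr0 (max_idPl _); last by lra.
rewrite divr1 sub0r opprK /ray subr0 !mul1r !addr0 mulr0 addr0 /pos.
rewrite (max_idPr _) ?oppr_le0// (max_idPl t0) mulr0 /sq -/(itv0 R) cn0.
by congr cn; rewrite -[RHS]clampK; congr clamp; ring.
Qed.

Let WVfun_t0 l u c : WVfun (l, u, (itv0 R, c)) = cone_in R g (g (cn f l u)).
Proof.
have t0 := ival_ge0 u; have t1 := ival_le1 u.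
rewrite /WVfun dbl_pol /= /pol ival0 (min_idPr t0) mulr0 -/(itv0 R) ival0.
rewrite /den !subr0 (max_idPl _); last by lra.
rewrite divr1 /ray subr0 !mul1r !addr0 mulr0 addr0 /pos.
rewrite (max_idPl t0) (max_idPr _) ?oppr_le0// mulr0 /sq -/(itv0 R) cn0.
by congr (cone_in R g (g (cn f l _))); rewrite -[RHS]clampK; congr clamp; ring.
Qed.

Let WVfun_u1 l t c : WVfun (l, itv1 R, (t, c)) = point.
Proof.
have t0 := ival_ge0 t; have t1 := ival_le1 t.
apply: sq_u1; rewrite /= dbl_pol /pol ival1 (min_idPr t1).
suff -> : ray ((1 - ival t) / den (ival t)) (ival (clamp (2 * ival t))) = 1.
  by rewrite !mulr1 subrK.
have [th|/ltW th] := leP 2^-1 (ival t).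
  by rewrite clamp_ge1 ?ival1 /ray; [ring|lra].
rewrite /den (max_idPl _); last by lra.
rewrite divff /ray /pos; last by rewrite gt_eqF//; lra.
by rewrite (max_idPl _) ?ler01//; ring.
Qed.

Let WVfun_t1 l u c : WVfun (l, u, (itv1 R, c)) = point.
Proof.
have t0 := ival_ge0 u; have t1 := ival_le1 u.
apply: sq_t1; rewrite /= dbl_pol /pol ival1 (min_idPl t1).
suff -> : ray (- ((ival u - 1) / den (ival u))) (ival (clamp (2 * ival u))) = 1.
  by rewrite !mulr1 subrK.
have [th|/ltW th] := leP 2^-1 (ival u).
  by rewrite clamp_ge1 ?ival1 /ray; [ring|lra].
rewrite /den (max_idPl _); last by lra.
rewrite -mulNr opprB divff /ray /pos; last by rewrite gt_eqF//; lra.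
by rewrite (max_idPl _) ?ler01//; ring.
Qed.

Let WVfunp u q : WVfun (point, u, q) = point. Proof. exact: sq_pt. Qed.

Let WVH (p : mapping_cone R f * (I * I)) : C :=
  cone_rec (fun x => cn g (cone_in R f x) p.2.1) (fun q => WVfun (q, p.2)) p.1.

Let WVH_in x t c : WVH (cone_in R f x, (t, c)) = cn g (cone_in R f x) t.
Proof.
by rewrite /WVH cone_rec_in// => *;
  rewrite ?WVfun_u0 ?WVfun_u1 ?WVfunp ?bmap_pt ?cnp.
Qed.

Let WVH_cn l u t c : WVH (cn f l u, (t, c)) = WVfun (l, u, (t, c)).
Proof.
by rewrite /WVH cone_rec_cn// => *;
  rewrite ?WVfun_u0 ?WVfun_u1 ?WVfunp ?bmap_pt ?cnp.
Qed.

Let WV_id : homotopic R (pcomp (s2val W) (s2val V)) (pid C).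
Proof.
have [Win Wcn] := (s2valP W, s2valP' W).
have [Vin Vcn] := (s2valP V, s2valP' V).
have [jin jcn] := (s2valP cone_j, s2valP' cone_j).
apply: (@cone_homotopy _ _ _ g _ _ _ (fun p => cone_in R g p.1)
  (fun p => WVH (p.1.1, (p.1.2, p.2)))) => //.
- by apply: (@cts_comp _ _ _ (cone_in R g)); cts.
- apply: (@cts_comp _ _ _ WVH (fun p => (p.1.1, (p.1.2, p.2)))); last by cts.
  apply: cone_prod_cts.
  + by apply: prod_compact; exact: unit_itv_compact.
  + by apply: prod_hausdorff; exact: unit_itv_hausdorff.
  + apply: (@cts_eq _ _ (fun p => cn g (cone_in R f p.1) p.2.1)).
      by move=> [x [t c]]; rewrite WVH_in.
    apply: (@cts_comp _ _ _ (fun p => cn g p.1 p.2)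
      (fun p => (cone_in R f p.1, p.2.1))); first exact: cn_cts.
    by apply: cts_pair; [apply: (@cts_comp _ _ _ (cone_in R f)); cts|cts].
  + by apply: cts_eq WVfun_cts => -[[l u] [t c]]; rewrite WVH_cn.
- move=> z; rewrite -[RHS]/(s2val W (s2val V (cone_in R g z))).
  by rewrite Vin Win jin.
- move=> c t; rewrite -[RHS]/(s2val W (s2val V (cn g c t))) Vcn.
  have [[x ->]|[l [u ->]]] := cone_case c.
    by rewrite VH_in Win jcn WVH_in.
  rewrite VH_cn WVH_cn Wcn WHE /Wfun /WVfun /= ival0 subr0 !mul1r !mul0r.
  by rewrite !addr0.
- move=> c t; have [[x ->]|[l [u ->]]] := cone_case c; first by rewrite WVH_in.
  rewrite WVH_cn /WVfun /= ival1 subrr !mul0r !mul1r !add0r /sq !clampK //.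
- move=> c r; have [[x ->]|[l [u ->]]] := cone_case c.
    by rewrite WVH_in cn0.
  by rewrite WVH_cn WVfun_t0.
- move=> c r; have [[x ->]|[l [u ->]]] := cone_case c.
    by rewrite WVH_in cn1.
  by rewrite WVH_cn WVfun_t1.
- by move=> t r; rewrite (WVH_in point) cnp.
Qed.

Let VW_id : homotopic R (pcomp (s2val V) (s2val W)) (pid D).
Proof.
have [Win Wcn] := (s2valP W, s2valP' W).
have [Vin Vcn] := (s2valP V, s2valP' V).
have [jin jcn] := (s2valP cone_j, s2valP' cone_j).
(* V \o W is a reparametrization of the cone coordinate: for r at least 1/2,
   where pol no longer inverts ray, both sides are at the apex. *)
pose v (r c : I) : R := (1 - ival c) * ival (clamp (2 * ival r)) + ival c * ival r.
apply: (@cone_homotopy _ _ _ s _ _ _ (fun p => cone_in R s p.1)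
  (fun p => cn s p.1.1 (clamp (v p.1.2 p.2)))) => //.
- by apply: (@cts_comp _ _ _ (cone_in R s)); cts.
- apply: (@cts_comp _ _ _ (fun p => cn s p.1 p.2)
    (fun p => (p.1.1, clamp (v p.1.2 p.2)))); first exact: cn_cts.
  by rewrite /v; cts.
- move=> y; rewrite -[RHS]/(s2val V (s2val W (cone_in R s y))) Win.
  have [[z ->]|[x [t ->]]] := cone_case y; first by rewrite jin Vin.
  by rewrite jcn Vcn VH_in.
- move=> y r; rewrite -[RHS]/(s2val V (s2val W (cn s y r))) Wcn /v ival0 subr0.
  rewrite mul1r mul0r addr0 clampK; elim/sp_ind: y => l t.
  rewrite WHE /Wfun /sq /= Vcn VH_cn /Vfun /=.
  have r0 := ival_ge0 r; have r1 := ival_le1 r.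
  have t0 := ival_ge0 t; have t1 := ival_le1 t.
  have [p0 p1] : 0 <= pos (dbl t) <= 1 /\ 0 <= pos (- dbl t) <= 1.
    have dE : dbl t = ival t + ival t - 1 by [].
    by have [[? [-> ->]]|[? [-> ->]]] := posE (dbl t); split; apply/andP; split;
      lra.
  have ray_bound x : 0 <= pos x <= 1 -> 0 <= ray x (ival r) <= 1.
    by move=> /andP[? ?]; rewrite /ray; apply/andP; split; nra.
  rewrite !ival_clamp; try exact: ray_bound.
  have mE : Num.min (ray (dbl t) (ival r)) (ray (- dbl t) (ival r)) = ival r.
    rewrite /ray; have [[? [-> ->]]|[? [-> ->]]] := posE (dbl t).
      by rewrite mulr0 add0r (min_idPr _)//; nra.
    by rewrite mulr0 add0r (min_idPl _)//; nra.
  rewrite /pol mE; have [rh|/ltW rh] := leP 2^-1 (ival r).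
    by rewrite (@clamp_ge1 _ (2 * _)) ?cn1//; lra.
  congr (cn s (sp l _) _); rewrite -[LHS]clampK; congr clamp.
  have -> : ray (dbl t) (ival r) - ray (- dbl t) (ival r) = (1 - ival r) * dbl t.
    by rewrite /ray; have [[? [-> ->]]|[? [-> ->]]] := posE (dbl t); ring.
  rewrite /den (max_idPl _); last by lra.
  rewrite mulrAC divff ?mul1r; last by rewrite gt_eqF//; lra.
  by rewrite /dbl; lra.
- by move=> y r; rewrite /v ival1 subrr mul0r mul1r add0r clampK.
- by move=> y r; rewrite /v ival0 mulr0 -/(itv0 R) ival0 !mulr0 addr0 -/(itv0 R) cn0.
- move=> y r; rewrite /v ival1 mulr1 (@clamp_ge1 _ 2) ?ler1n// ival1 mulr1.
  by rewrite mulr1 subrK -/(itv1 R) cn1.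
- by move=> t r; rewrite cnp.
Qed.

(** Over each point of L the cone of g has a square more than the cone of its
    restriction to X; seen from the collapsed corner, it is a cone on
    the two edges u = 0 and t = 0, which together form a suspension coordinate. *)
Lemma puppe_cofiber : exists (k : bmap (suspension R L) (mapping_cone R (pcomp g (cone_in R f))))
    (j : bmap (mapping_cone R (pcomp g (cone_in R f))) (mapping_cone R g)),
  cofiber_seq R k j.
Proof.
exists s, (s2val cone_j), (s2val W); split.
  by exists (s2val V); split; [exact: VW_id|exact: WV_id].
by apply/hclassP; congr hclass; apply: bmap_ext => y; exact: (s2valP W).
Qed.

End puppe.

(** The equivalence between the cone of the attaching map and X1 carries the
    Puppe sequence over to g, by invariance of the cone in its source. *)
Lemma wedge_cofibration_puppe (R : realType) (F : ptopologicalType -> Prop)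
    (X0 X1 Z : ptopologicalType) (g : bmap X1 Z) :
  (forall A, F A -> F (suspension R A)) -> wedge_cofibration R F X0 X1 ->
  exists g0 : bmap X0 Z,
    wedge_cofibration R F (mapping_cone R g0) (mapping_cone R g).
Proof.
move=> FS [J [A [FA [f [i [e [ee ei]]]]]]].
have [k [j [w [ew wj]]]] := puppe_cofiber (pcomp g e : bmap (mapping_cone R f) Z).
exists (pcomp (pcomp g e) (cone_in R f)).
have [b eb] := susp_wedge R A.
have [c cin ccn] := @cone_pre R _ _ _ b k (pcomp k b) (fun _ => erefl).
have ec : hequiv R c by exact: cone_pre_hequiv ccn.
have [d din dcn] := @cone_pre R _ _ _ e g (pcomp g e) (fun _ => erefl).
have ed : hequiv R d by exact: cone_pre_hequiv dcn.
exists J, (fun j => suspension R (A j)); split; first by move=> ?; apply: FS.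
exists (pcomp k b), (pcomp d j), (pcomp d (pcomp w c)); split.
  apply/hequivP; rewrite -!hcompE; apply: hiso_comp; last exact/hequivP.
  by apply: hiso_comp; exact/hequivP.
apply/hclassP; rewrite -[hclass R (pcomp d j)]hcompE.
move/hclassP : wj => <-; rewrite hcompE; congr hclass; apply: bmap_ext => y.
by rewrite -[LHS]/(d (w (c (cone_in R (pcomp k b) y)))) cin.
Qed.

(** * Connectedness *)

Lemma unit_itv_connected (R : realType) : connected [set: unit_itv R].
Proof.
have -> : [set: unit_itv R] = (@clamp R) @` `[0, 1]%classic.
  apply/seteqP; split => // t _; exists (ival t); last exact: clampK.
  by rewrite /= in_itv /=; exact: ivalP.
apply: connected_continuous_connected; first exact: segment_connected.
by apply: continuous_subspaceT; exact: clamp_continuous.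
Qed.

Lemma image_connected (S T : topologicalType) (f : S -> T) :
  connected [set: S] -> continuous f -> connected (range f).
Proof.
by move=> cS cf; apply: connected_continuous_connected => //;
  exact: continuous_subspaceT.
Qed.

Lemma connected_star (T : topologicalType) (B : set T) :
  connected B -> B !=set0 ->
  (forall x, exists C : set T, [/\ connected C, C x & C `&` B !=set0]) ->
  connected [set: T].
Proof.
move=> cB [b Bb] /choice[C CP].
have -> : [set: T] = \bigcup_(x in [set: T]) (C x `|` B).
  by apply/seteqP; split => // x _; exists x => //; left; have [] := CP x.
apply: bigcup_connected; first by exists b => x _; right.
by move=> x _; have [? ? ?] := CP x; exact: connectedU.
Qed.

Lemma same_type_connected (R : realType) (X Y : ptopologicalType) :
  same_type R X Y -> connected [set: X] -> connected [set: Y].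
Proof.
move=> [f [g [_ [H [cH H0 H1 _]]]]] cX.
apply: (@connected_star _ (range f)).
- by apply: image_connected => //; exact: bmap_cts.
- by exists (f point), point.
- move=> y; exists (range (fun t => H (y, t))); split.
  + apply: image_connected; first exact: unit_itv_connected.
    by apply: (@cts_comp _ _ _ H (fun t => (y, t))) => //; cts.
  + by exists (itv1 R) => //; rewrite H1.
  + by exists (f (g y)); split; [exists (itv0 R)|exists (g y)]; rewrite ?H0.
Qed.

Lemma cone_connected (R : realType) (A X : ptopologicalType) (f : bmap A X) :
  connected [set: X] -> connected [set: mapping_cone R f].
Proof.
move=> cX; pose C : ptopologicalType := mapping_cone R f.
apply: (@connected_star C (range (cone_in R f))).
- by apply: image_connected => //; exact: bmap_cts.
- by exists (cone_in R f point), point.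
move=> c; have [[x ->]|[a [t ->]]] := cone_case c.
  exists [set cone_in R f x]; split; first exact: connected1.
    by [].
  by exists (cone_in R f x); split => //; exists x.
exists (range (fun t => cn f a t)); split.
- apply: image_connected; first exact: unit_itv_connected.
  apply: (@cts_comp _ _ _ (fun p => cn f p.1 p.2) (fun t => (a, t))).
    exact: cn_cts.
  by cts.
- by exists t.
- by exists (cn f a (itv0 R)); split; [exists (itv0 R)|exists (f a); rewrite ?cn0].
Qed.

(** * Cubes *)

Section cubes.
Variable R : realType.
Local Notation cubeT n := (set_type (@cube R n)).

Lemma rV_norm_le n (x : 'rV[R]_n) (r : R) :
  0 <= r -> (forall i, `|x 0 i| <= r) -> `|x| <= r.
Proof.
move=> r0 xr; rewrite [`|x|]mx_normrE; apply: bigmax_le => // -[i j] _ /=.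
by rewrite ord1.
Qed.

Lemma rV_norm_lt n (x : 'rV[R]_n) (r : R) :
  0 < r -> (forall i, `|x 0 i| < r) -> `|x| < r.
Proof.
move=> r0 xr; rewrite [`|x|]mx_normrE; apply: bigmax_lt => // -[i j] _ /=.
by rewrite ord1.
Qed.

Lemma rV_coord_le n (x : 'rV[R]_n) i : `|x 0 i| <= `|x|.
Proof.
rewrite [`|x|]mx_normrE.
exact: (@le_bigmax _ _ _ 0 (fun ij : 'I_1 * 'I_n => `|x ij.1 ij.2|) (0, i)).
Qed.

Lemma cts_coord (T : topologicalType) n (f : T -> 'rV[R]_n) i :
  continuous f -> continuous (fun x => f x 0 i).
Proof.
by move=> cf; apply: (@cts_comp _ _ _ (fun v : 'rV[R]_n => v 0 i)) => //;
  exact: coord_continuous.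
Qed.

Lemma cts_row (T : topologicalType) n (F : T -> 'I_n -> R) :
  (forall i, continuous (fun x => F x i)) -> continuous (fun x => \row_i F x i).
Proof.
move=> cF x; apply/cvgrPdist_lt => e e0; near=> y.
apply: rV_norm_lt => // i; rewrite !mxE; move: i.
near: y; apply: filter_forall => i.
by have /cvgrPdist_lt/(_ e e0) := cF i x.
Unshelve. all: by end_near. Qed.

Lemma cube_compact n : compact (@cube R n).
Proof.
rewrite (_ : @cube R n = [set v | forall i, `[0, 1]%classic (v ord0 i)]).
  apply: (@rV_compact R n (fun=> `[0, 1]%classic)) => _.
  exact: segment_compact.
by apply/seteqP; split=> v /= h i; have := h i; rewrite in_itv.
Qed.

Lemma rV_hausdorff n : hausdorff_space 'rV[R]_n.
Proof. exact: norm_hausdorff. Qed.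

Lemma cube_closed n : closed (@cube R n).
Proof. by apply: compact_closed; [exact: rV_hausdorff|exact: cube_compact]. Qed.

Lemma cubeT_compact n : compact [set: cubeT n].
Proof. by apply: set_type_compact; exact: cube_compact. Qed.

Lemma cubeT_hausdorff n : hausdorff_space (cubeT n).
Proof. by apply: set_type_hausdorff; exact: rV_hausdorff. Qed.

Definition cval n (z : cubeT n) : 'rV[R]_n := set_val z.

Lemma cvalP n (z : cubeT n) i : 0 <= cval z 0 i <= 1.
Proof. by have /(_ i) := set_valP z. Qed.

Lemma cval_cts n : continuous (@cval n).
Proof. exact: initial_continuous. Qed.

Lemma cval_inj n : injective (@cval n).
Proof. exact: set_val_inj. Qed.

Lemma cclamp_subproof n (x : 'rV[R]_n) :
  \row_i Num.max 0 (Num.min (x 0 i) 1) \in @cube R n.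
Proof.
rewrite inE => i; rewrite mxE; have := @clamp_subproof R (x 0 i).
by rewrite inE /= in_itv.
Qed.

Definition cclamp n (x : 'rV[R]_n) : cubeT n := SigSub (cclamp_subproof x).

Lemma cclamp_cts n : continuous (@cclamp n).
Proof.
apply: set_type_cts; apply: (@cts_eq _ _
  (fun x : 'rV[R]_n => \row_i Num.max 0 (Num.min (x 0 i) 1))) => [x|].
  by rewrite set_valE.
apply: cts_row => i; apply: cts_max; first exact: cst_continuous.
by apply: cts_min; [apply: cts_coord; exact: cts_id|exact: cst_continuous].
Qed.

Lemma cval_cclamp n (x : 'rV[R]_n) : cube x -> cval (cclamp x) = x.
Proof.
move=> cx; apply/rowP => i; rewrite /cval set_valE /= mxE.
by have /andP[x0 x1] := cx i; rewrite (min_idPl x1) (max_idPr x0).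
Qed.

Lemma cclampK n (z : cubeT n) : cclamp (cval z) = z.
Proof. by apply: cval_inj; rewrite cval_cclamp// => i; exact: cvalP. Qed.

(** Position relative to the centre; in the sup norm the cube is the ball of
    radius one half, whence the radial constructions below. *)
Definition ctr n : 'rV[R]_n := const_mx 2^-1.
Definition off n (z : cubeT n) : 'rV[R]_n := cval z - ctr n.
Definition at_off n (y : 'rV[R]_n) : cubeT n := cclamp (ctr n + y).

Lemma off_cts n : continuous (@off n).
Proof.
rewrite /off; apply: cts_add; first exact: cval_cts.
exact: cst_continuous.
Qed.

Lemma at_off_cts n : continuous (@at_off n).
Proof.
apply: (@cts_comp _ _ _ (@cclamp n)); first exact: cclamp_cts.
by apply: cts_add; [exact: cst_continuous|exact: cts_id].
Qed.

Lemma at_offK n (z : cubeT n) : at_off (off z) = z.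
Proof. by rewrite /at_off /off addrC subrK cclampK. Qed.

Lemma off_le n (z : cubeT n) : `|off z| <= 2^-1.
Proof.
apply: rV_norm_le => [|i]; first by rewrite invr_ge0.
by rewrite !mxE ler_norml; have /andP[? ?] := cvalP z i; apply/andP; split; lra.
Qed.

Lemma offK n (y : 'rV[R]_n) : `|y| <= 2^-1 -> off (at_off y) = y.
Proof.
move=> y2; rewrite /off /at_off cval_cclamp; first by rewrite addrC addKr.
move=> i; rewrite !mxE; have := le_trans (rV_coord_le y i) y2.
by rewrite ler_norml => /andP[? ?]; apply/andP; split; lra.
Qed.

Definition inner n (z : cubeT n) : Prop := `|off z| < 2^-1.

Lemma innerP n (z : cubeT n) : inner z <-> open_cube (cval z).
Proof.
split=> [zi i|zi].
  have := le_lt_trans (rV_coord_le (off z) i) zi.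
  by rewrite !mxE ltr_norml => /andP[? ?]; apply/andP; split; lra.
apply: rV_norm_lt => [|i]; first by rewrite invr_gt0.
by rewrite !mxE ltr_norml; have /andP[? ?] := zi i; apply/andP; split; lra.
Qed.

Lemma not_inner n (z : cubeT n) : ~ inner z -> `|off z| = 2^-1.
Proof.
by move=> /negP; rewrite -leNgt => h; apply/eqP; rewrite eq_le off_le.
Qed.

End cubes.
Notation cubeT R n := (set_type (@cube R n)).

Lemma cts_distP (R : realType) (T : topologicalType) (f : T -> R) :
  continuous f <->
  forall x r, 0 < r -> nbhs x [set y | `|f x - f y| <= r].
Proof.
split=> [cf x r r0|cf x].
  by have /cvgrPdist_le/(_ r r0) := cf x.
by apply/cvgrPdist_le => r r0; exact: cf.
Qed.

(** * Moving a map of a cube off a point of a space of larger dimension *)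

Section avoid.
Variables (R : realType) (n : nat).
Local Notation T := (cubeT R n).
Let d (x y : T) : R := `|cval x - cval y|.

Let d_cts (S : topologicalType) (f g : S -> T) :
  continuous f -> continuous g -> continuous (fun x => d (f x) (g x)).
Proof.
move=> cf cg; apply: cts_norm; apply: cts_add.
  by apply: (@cts_comp _ _ _ (@cval R n)) => //; exact: cval_cts.
apply: cts_opp; apply: (@cts_comp _ _ _ (@cval R n)) => //; exact: cval_cts.
Qed.

(** The approximation is the inf-convolution with a steep cone. Compactness of the
    square of the cube gives a slope for which it stays close to the function. *)
Lemma lipschitz_approx (u : T -> R) (e : R) : continuous u -> 0 < e ->
  exists (w : T -> R) (l : R), [/\ 0 <= l, forall x, `|w x - u x| <= e
    & forall x y, w x <= w y + l * d x y].
Proof.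
move=> cu e0.
have cTT : compact [set: T * T] by apply: prod_compact; exact: cubeT_compact.
have [l [l0 ul]] : exists l : R, 0 <= l /\
    forall x y : T, u x - e <= u y + l * d x y.
  have cov : \forall l \near +oo%R, [set: T * T] `<=`
      (fun p : T * T => u p.1 - e <= u p.2 + l * d p.1 p.2).
    have /compact_near_coveringP := cTT; apply => -[x0 y0] _.
    have [l1 ll1] : exists l1, u x0 - e < u y0 + l1 * d x0 y0.
      have [xy|xy] := eqVneq (d x0 y0) 0.
        exists 0; have -> : x0 = y0.
          by apply: cval_inj; apply/eqP; rewrite -subr_eq0 -normr_eq0; apply/eqP.
        by rewrite mul0r addr0; lra.
      exists ((u x0 - u y0) / d x0 y0); rewrite divfK//; lra.
    pose c (p : T * T) : R := u p.2 + l1 * d p.1 p.2 - (u p.1 - e).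
    have cc : continuous c.
      apply: cts_addR; last first.
        apply: cts_oppR; apply: cts_addR; last exact: cst_continuous.
        by apply: (@cts_comp _ _ _ u) => //; cts.
      apply: cts_addR; first by apply: (@cts_comp _ _ _ u) => //; cts.
      by apply: cts_mul; [exact: cst_continuous|apply: d_cts; cts].
    have oc : open (c @^-1` [set r | 0 < r]).
      by apply: open_comp => [? _|]; [exact: cc|exact: open_gt].
    exists (c @^-1` [set r | 0 < r], [set l | l1 <= l]) => /=.
      split; last by apply: nbhs_pinfty_ge; exact: num_real.
      by apply: open_nbhs_nbhs; split => //=; rewrite /c /=; lra.
    move=> [[x y] l] [/= cxy l1l]; rewrite /c /= in cxy.
    have := ler_wpM2r (normr_ge0 (cval x - cval y)) l1l; rewrite -/(d x y); lra.
  have /filter_ex[l [l0 ul]] : \forall l \near +oo%R, 0 <= l /\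
      [set: T * T] `<=` (fun p : T * T => u p.1 - e <= u p.2 + l * d p.1 p.2).
    by apply: filterI => //; apply: nbhs_pinfty_ge; exact: num_real.
  by exists l; split => // x y; exact: (ul (x, y)).
pose W x := [set u y + l * d x y | y in [set: T]].
have dxx x : d x x = 0 by rewrite /d subrr normr0.
have Wlb x : lbound (W x) (u x - e) by move=> _ [y _ <-]; exact: ul.
have W0 x : W x !=set0 by exists (u x + l * d x x), x.
have Wh x : has_lbound (W x) by exists (u x - e).
exists (fun x => inf (W x)), l; split=> // [x|x y].
  have h1 : u x - e <= inf (W x) by apply: lb_le_inf.
  have h2 : inf (W x) <= u x.
    by apply: ge_inf => //; exists x => //; rewrite dxx mulr0 addr0.
  by rewrite ler_norml; apply/andP; split; lra.
rewrite -lerBlDr; apply: lb_le_inf => // _ [z _ <-].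
have h : inf (W x) <= u z + l * d x z by apply: ge_inf => //; exists z.
have := ler_wpM2l l0 (ler_distD (cval y) (cval x) (cval z)).
by rewrite -/(d x y) -/(d y z) -/(d x z); lra.
Qed.

(** A Lipschitz map sends the N ^ n small cubes of a subdivision into balls that
    are too small to contain two points of a grid of mesh comparable to 1 / N,
    and for k > n and N large this grid has more than N ^ n points. *)
Lemma lipschitz_misses k (w : T -> 'I_k -> R) (l : 'I_k -> R) (e : R) :
  (n < k)%N -> 0 < e -> (forall j, 0 <= l j) ->
  (forall j x y, w x j <= w y j + l j * d x y) ->
  exists p : 'I_k -> R, (forall j, `|p j| <= e) /\
    forall x, exists j, w x j != p j.
Proof.
move=> nk e0 l0 wl; apply: contrapT => hit.
have {}hit (p : 'I_k -> R) : (forall j, `|p j| <= e) ->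
    exists x, forall j, w x j = p j.
  move=> pe; apply: contrapT => nx; apply: hit; exists p; split=> // x.
  apply: contrapT => nj; apply: nx; exists x => j; apply/eqP.
  by apply: contrapT => /negP h; apply: nj; exists j.
(* With N = c * M a cell of side 1 / N has image of diameter less than the mesh
   e / M of the grid, and M > (2 * c) ^ n gives (N + 1) ^ n < M ^ n.+1; the N + 1
   accounts for points with a coordinate equal to 1. *)
pose L := \sum_j l j.
have lL j : l j <= L.
  rewrite /L (bigD1 j)//= lerDl; exact: sumr_ge0.
have L0 : 0 <= L by exact: sumr_ge0.
pose c := (Num.trunc (L / e)).+1.
have cL : L < c%:R * e.
  have Le : 0 <= L / e by apply: divr_ge0 => //; exact: ltW.
  by rewrite -ltr_pdivrMr//; have /andP[] := truncn_itv Le.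
pose M := ((2 * c) ^ n).+1; pose N := (c * M)%N.
have M0 : 0 < M%:R :> R by rewrite ltr0n.
have N0 : 0 < N%:R :> R by rewrite ltr0n muln_gt0.
pose p (a : {ffun 'I_k -> 'I_M}) j : R := e * ((a j)%:R / M%:R).
have pe a j : `|p a j| <= e.
  rewrite ger0_norm ?mulr_ge0 ?divr_ge0 ?ler0n ?(ltW e0)//.
  rewrite ler_piMr ?(ltW e0)// ler_pdivrMr// mul1r ler_nat.
  exact/ltnW/ltn_ord.
have /choice[x xp] a : exists x, forall j, w x j = p a j by exact: hit.
pose t a i := Num.trunc (N%:R * cval (x a) 0 i).
have tb a i : (t a i)%:R <= N%:R * cval (x a) 0 i < (t a i).+1%:R.
  by apply: truncn_itv; rewrite mulr_ge0 ?ler0n//; have /andP[] := cvalP (x a) i.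
have tN a i : (t a i < N.+1)%N.
  rewrite ltnS -(ler_nat R); have /andP[h _] := tb a i.
  apply: le_trans h _; rewrite ler_piMr ?ler0n//.
  by have /andP[] := cvalP (x a) i.
pose b a : {ffun 'I_n -> 'I_N.+1} := [ffun i => Ordinal (tN a i)].
have close a a' : b a = b a' -> d (x a) (x a') <= N%:R^-1.
  move=> /ffunP ba; apply: rV_norm_le => [|i]; first by rewrite invr_ge0 ltW.
  have tt : t a i = t a' i by have /(congr1 val) := ba i; rewrite !ffunE.
  have /andP[h1 h2] := tb a i; have /andP[h3 h4] := tb a' i.
  rewrite tt -natr1 in h1 h2; rewrite -natr1 in h4; rewrite !mxE.
  rewrite -(ler_pM2l N0) divff ?gt_eqF// -{1}(gtr0_norm N0) -normrM ler_norml.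
  by rewrite mulrBr; apply/andP; split; lra.
have half a a' : b a = b a' -> forall j, (a j <= a' j)%N.
  move=> ba j; rewrite leqNgt; apply/negP => aa.
  have h := wl j (x a) (x a'); rewrite !xp in h.
  have h1 : p a' j + e / M%:R <= p a j.
    rewrite /p -mulrDr ler_pM2l// -[X in _ + X]mul1r -mulrDl.
    by rewrite ler_pM2r ?invr_gt0// natr1 ler_nat.
  have h2 : l j * d (x a) (x a') <= L / N%:R.
    by apply: ler_pM => //; [exact: normr_ge0|exact: close].
  have h3 : L / N%:R < e / M%:R.
    rewrite /N natrM invfM mulrA ltr_pM2r ?invr_gt0//.
    by rewrite ltr_pdivrMr ?ltr0n// mulrC.
  by lra.
have bi : injective b.
  move=> a a' ba; apply/ffunP => j; apply/val_inj/eqP.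
  by rewrite eqn_leq !half.
have := leq_card b bi; rewrite !card_ffun !card_ord leqNgt => /negP; apply.
have NN : (N.+1 <= (2 * c) * M)%N.
  rewrite -mulnA -/N mul2n -addnn -addn1 leq_add2l.
  by rewrite muln_gt0.
apply: (@leq_ltn_trans (((2 * c) * M) ^ n)).
  by elim: (n) => // m IH; rewrite !expnS leq_mul.
rewrite expnMn; apply: (@leq_trans (M ^ n.+1)); last by rewrite leq_pexp2l.
by rewrite expnS ltn_pmul2r ?expn_gt0// ltnSn.
Qed.

(** Half of e is spent on the approximation, half on translating a missed point
    to the origin. *)
Lemma perturb_off_origin k (u : T -> 'rV[R]_k) (e : R) :
  (n < k)%N -> 0 < e -> continuous u ->
  exists v : T -> 'rV[R]_k, [/\ continuous v, forall x, `|v x - u x| <= e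
    & forall x, v x != 0].
Proof.
move=> nk e0 cu.
have e20 : 0 < e / 2 by lra.
have /choice[w wP] j : exists w : T -> R, exists l : R, [/\ 0 <= l,
    forall x, `|w x - u x 0 j| <= e / 2 & forall x y, w x <= w y + l * d x y].
  by apply: lipschitz_approx => //; exact: cts_coord.
have /choice[l lP] := wP.
have [||p [pe pw]] := @lipschitz_misses k (fun x j => w j x) l _ nk e20.
- by move=> j; have [] := lP j.
- by move=> j; have [] := lP j.
exists (fun x => \row_j (w j x - p j)); split.
- apply: cts_row => j; have [l0 _ wl] := lP j.
  apply: cts_addR; last exact: cst_continuous.
  apply/cts_distP => x r r0.
  have dc : continuous (fun y => l j * d x y).
    apply: cts_mul; first exact: cst_continuous.
    by apply: d_cts; [exact: cst_continuous|exact: cts_id].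
  have /cts_distP/(_ x r r0) := dc.
  apply: (@filterS _ _ (nbhs_filter x)) => y /=.
  rewrite {1}/d subrr normr0 mulr0 sub0r normrN ger0_norm ?mulr_ge0 ?normr_ge0// => lr.
  have h1 := wl x y; have h2 := wl y x.
  have dS : d y x = d x y by rewrite /d distrC.
  by rewrite dS in h2; rewrite ler_norml; apply/andP; split; lra.
- move=> x; apply: rV_norm_le => [|j]; first exact: ltW.
  rewrite !mxE; have [_ /(_ x) wu _] := lP j; have := pe j.
  by move: wu; rewrite !ler_norml => /andP[? ?] /andP[? ?]; apply/andP; split; lra.
- move=> x; have [j wj] := pw x; apply/eqP => /rowP/(_ j).
  by rewrite !mxE => /eqP; rewrite subr_eq0 (negbTE wj).
Qed.

End avoid.

(** * CW complexes *)

(** Over each piece S i the pairs (t, z) with g t = q i z form a compact set, so a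
    closed condition on them projects to a closed subset of T. *)
Lemma finite_cover_cts (T X Y : topologicalType) (I : choiceType)
    (S : I -> topologicalType) (q : forall i, S i -> X) (D : set I)
    (g : T -> X) (k : T -> X -> Y) :
  compact [set: T] -> hausdorff_space T -> hausdorff_space X ->
  (forall i, compact [set: S i]) -> (forall i, continuous (q i)) ->
  finite_set D -> continuous g ->
  (forall t, exists i z, D i /\ q i z = g t) ->
  (forall i, D i -> continuous
    (fun p : set_type [set p : T * S i | g p.1 = q i p.2] =>
       k (set_val p).1 (q i (set_val p).2))) ->
  continuous (fun t => k t (g t)).
Proof.
move=> cT hT hX cS cq fD cg gD ck; apply/continuous_closedP => A cA.
pose G i := [set p : T * S i | g p.1 = q i p.2].
have cG i : closed (G i).
  pose h (p : T * S i) := (g p.1, q i p.2).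
  have ch : continuous h.
    apply: cts_pair; first by apply: (@cts_comp _ _ _ g) => //; cts.
    by apply: (@cts_comp _ _ _ (q i)) => //; cts.
  have : closed [set xy : X * X | xy.1 = xy.2].
    move=> [x y] cl /=; apply: hX => U V xU yV.
    have [|[a b] /= [ab [/= aU bV]]] := cl (U `*` V); first by exists (U, V).
    by exists a; split => //; rewrite ab.
  by move=> /(closed_comp (f := h)); apply => ? _; exact: ch.
have kG i : compact [set: set_type (G i)].
  apply: set_type_compact; apply: (subclosed_compact (cG i)) (_ : G i `<=` setT) => //.
  exact: prod_compact.
pose P i : set T := (fun p : set_type (G i) => (set_val p).1) @`
  [set p | A (k (set_val p).1 (q i (set_val p).2))].
rewrite (_ : _ @^-1` A = \bigcup_(i in D) P i).
  apply: closed_bigcup => // i Di; apply: compact_closed => //.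
  apply: continuous_compact.
    apply: continuous_subspaceT; apply: cts_fst.
    exact: set_val_cts.
  apply: (subclosed_compact _ (kG i)) => //.
  by move/continuous_closedP : (ck i Di); exact.
apply/seteqP; split=> [t At|_ [i Di [p Ap <-]]] /=.
  have [i [z [Di qz]]] := gD t; exists i => //.
  have Gtz : G i (t, z) by rewrite /G /= qz.
  by exists (SigSub (mem_set Gtz)); rewrite //= qz.
have pE : g (set_val p).1 = q i (set_val p).2 := set_valP p.
by rewrite pE.
Qed.

Section cw_basics.
Variables (R : realType) (X : ptopologicalType) (E : nat -> Type).
Variable phi : forall n, E n -> 'rV[R]_n -> X.

(** The classical choice structure lets cells index finite sequences. *)
Definition cell := {classic {n & E n}}.
Definition cdim (c : cell) : nat := projT1 c.
Definition cmap (c : cell) (z : cubeT R (cdim c)) : X :=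
  phi (projT2 c) (cval z).
Arguments cmap : clear implicits.
Definition ocell (c : cell) : set X := phi (projT2 c) @` @open_cube R (cdim c).

Hypothesis cw : cw_structure phi.

Lemma cmap_cts c : continuous (cmap c).
Proof. by have /subspace_sigL_continuousP := @cw_continuous _ _ _ _ cw _ (projT2 c). Qed.

Lemma ocellP c x : ocell c x <-> exists z, inner z /\ cmap c z = x.
Proof.
split=> [[y yo <-]|[z [zi <-]]]; last first.
  by exists (cval z) => //; exact/innerP.
exists (cclamp y); have yE : cval (cclamp y) = y.
  by apply: cval_cclamp => i; have /andP[? ?] := yo i; apply/andP; split; exact: ltW.
by split; [apply/innerP; rewrite yE|rewrite /cmap yE].
Qed.

Lemma ocell_inner c z : inner z -> ocell c (cmap c z).
Proof. by move=> zi; apply/ocellP; exists z. Qed.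

Lemma ocell_ex x : exists c, ocell c x.
Proof. by have [c [cx _]] := cw_partition cw x; exists c. Qed.

Lemma ocell_uniq c d x : ocell c x -> ocell d x -> c = d.
Proof.
by move=> cx dx; have [e [_ eu]] := cw_partition cw x; rewrite -(eu c)// -(eu d).
Qed.

Lemma cmap_inj c (z z' : cubeT R (cdim c)) :
  inner z -> inner z' -> cmap c z = cmap c z' -> z = z'.
Proof.
move=> /innerP zi /innerP zi' e; apply: cval_inj.
by apply: (@cw_injective _ _ _ _ cw _ (projT2 c)) => //; exact/mem_set.
Qed.

Lemma cell_boundary c : exists2 S : set cell, finite_set S &
  forall z : cubeT R (cdim c), ~ inner z ->
    exists d, [/\ S d, (cdim d < cdim c)%N & ocell d (cmap c z)].
Proof.
have [S [fS Sd bS]] := @cw_closure_finite _ _ _ _ cw _ (projT2 c).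
exists S => // z zi; have [|d Sd' od] := bS (cmap c z).
  exists (cval z) => //; split; first by move=> i; exact: cvalP.
  by move=> /innerP.
by exists d; split => //; exact: Sd.
Qed.

Lemma cell_boundary_dim c (z : cubeT R (cdim c)) : ~ inner z ->
  exists d, (cdim d < cdim c)%N /\ ocell d (cmap c z).
Proof.
by have [S _ bS] := cell_boundary c; move=> /bS[d [_ ? ?]]; exists d.
Qed.

Lemma cmap_closed_cell c : exists2 S : set cell, finite_set S &
  forall z : cubeT R (cdim c), exists d,
    [/\ S d, (cdim d <= cdim c)%N & ocell d (cmap c z)].
Proof.
have [S fS bS] := cell_boundary c.
exists (S `|` [set c]); first by rewrite finite_setU; split => //; exact: finite_set1.
move=> z; have [zi|/bS[d [Sd dc dz]]] := pselect (inner z).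
  by exists c; split => //; [right|exact: ocell_inner].
by exists d; split => //; [left|exact: ltnW].
Qed.

Lemma cw_closedP (A : set X) : (forall c, closed (cmap c @^-1` A)) -> closed A.
Proof.
move=> cA; apply/(cw_weak cw) => n e.
have := cA (existT _ n e : cell); rewrite -openC => -[U oU UE].
rewrite (_ : _ `&` _ = @cube R n `&` ~` U).
  by apply: closedI; [exact: cube_closed|exact: open_closedC].
apply/seteqP; split=> x [cx xA]; split=> //=.
  move=> Ux; have : (set_val @^-1` U) (cclamp x : cubeT R n).
    by rewrite /= -/(cval _) cval_cclamp.
  by rewrite UE; apply; rewrite /= /cmap /= cval_cclamp.
apply: contrapT => nA; apply: xA.
have : (~` (cmap (existT _ n e : cell) @^-1` A)) (cclamp x : cubeT R n).
  by rewrite /= /cmap /= cval_cclamp.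
by rewrite -UE /= -/(cval _) cval_cclamp.
Qed.

Lemma cw_quotient_family : quotient_family cmap.
Proof.
split=> [x|V oV].
  by have [c /ocellP[z [_ <-]]] := ocell_ex x; exists c, z.
rewrite -closedC; apply: cw_closedP => c.
by rewrite preimage_setC; exact: open_closedC.
Qed.

(** Choosing a point of the set in every cell that it meets gives a set all of
    whose subsets are closed, since a closed cell meets finitely many cells. *)
Lemma compact_finite_cells (K : set X) : compact K ->
  finite_set [set c | exists2 x, K x & ocell c x].
Proof.
move=> cK; pose B := [set c | exists2 x, K x & ocell c x].
have /choice[x xP] c : exists x, B c -> K x /\ ocell c x.
  by have [[x Kx cx]|] := pselect (B c); [exists x|exists point].
have hX := cw_hausdorff cw.
have subclosed (Q : set X) : Q `<=` x @` B -> closed Q.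
  move=> QB; apply: cw_closedP => c.
  have [S fS SP] := cmap_closed_cell c.
  rewrite (_ : cmap c @^-1` Q = cmap c @^-1` (Q `&` x @` (B `&` S))).
    apply: (closed_comp (f := cmap c)); first by move=> ? _; exact: cmap_cts.
    rewrite (_ : _ `&` _ = \bigcup_(y in Q `&` x @` (B `&` S)) [set y]).
      apply: closed_bigcup => [|y _].
        apply: (@sub_finite_set _ _ (x @` S)) => [_ [_ [d [_ Sd] <-]]|].
          by exists d.
        exact: finite_image.
      by apply: accessible_closed_set1; exact: hausdorff_accessible.
    by apply/seteqP; split=> [y ?|_ [y ? ->]]; first exists y.
  apply/seteqP; split=> z /=; last by case.
  move=> Qz; split => //; have [d Bd dz] := QB _ Qz; exists d => //; split => //.
  have [d' [Sd' _ od']] := SP z.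
  by have [_ od] := xP d Bd; rewrite dz in od; rewrite (ocell_uniq od od').
pose P := x @` B.
have cP : compact P.
  apply: (subclosed_compact _ cK); first exact: subclosed.
  by move=> _ [c Bc <-]; have [] := xP c Bc.
have fP : finite_set P.
  have := cP; rewrite compact_cover => /(_ X P (fun y => ~` (P `\` [set y]))).
  move=> [y _|y Py|D _ PD].
  - by apply: closed_openC; apply: subclosed => z [].
  - by exists y => // -[_]; apply.
  - apply: (sub_finite_set _ (finite_fset D)) => y Py.
    have [z Dz /= nPz] := PD y Py.
    have -> // : y = z by apply: contrapT => yz; apply: nPz.
rewrite -/B (_ : B = \bigcup_(y in P) [set c | B c /\ x c = y]); last first.
  apply/seteqP; split=> [c Bc|c [y _ []]//].
  by exists (x c) => //; exists c.
apply: bigcup_finite => // y _.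
have [[c0 [Bc0 xc0]]|n0] := pselect (exists c, B c /\ x c = y).
  apply: (sub_finite_set _ (finite_set1 c0)) => c [Bc xc].
  have [_ oc] := xP c Bc; have [_ oc0] := xP c0 Bc0.
  by apply: (ocell_uniq oc); rewrite xc -xc0.
by apply: (sub_finite_set _ (finite_set0 _)) => c Bc; apply: n0; exists c.
Qed.

Definition subcomplex (s : seq cell) : Prop :=
  forall c, c \in s -> forall z, ~ inner z ->
    exists d, [/\ d \in s, (cdim d < cdim c)%N & ocell d (cmap c z)].

(** Closing up under boundaries terminates because dimensions decrease. *)
Lemma subcomplex_ex (A : set cell) : finite_set A ->
  exists s, subcomplex s /\ forall c, A c -> c \in s.
Proof.
pose closed_cells (S : set cell) := forall c, S c -> forall z, ~ inner z ->
  exists d, [/\ S d, (cdim d < cdim c)%N & ocell d (cmap c z)].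
have one n c : (cdim c < n)%N ->
    exists S, [/\ finite_set S, S c & closed_cells S].
  elim: n c => // n IH c cn; have [B fB BP] := cell_boundary c.
  have /choice[S SP] d : exists S, (cdim d < cdim c)%N ->
      [/\ finite_set S, S d & closed_cells S].
    have [dc|] := boolP (cdim d < cdim c)%N; last by exists set0.
    by have [S ?] := IH d (leq_trans dc cn); exists S.
  pose U := \bigcup_(d in B `&` [set d | (cdim d < cdim c)%N]) S d.
  exists ([set c] `|` U); split.
  - rewrite finite_setU; split; first exact: finite_set1.
    apply: bigcup_finite => [|d [_ /SP[]]//].
    by apply: sub_finite_set fB => ? [].
  - by left.
  - move=> c' [->|[d [Bd dc] Sc']] z zi.
      have [d [Bd dc od]] := BP z zi; exists d; split=> //.
      by right; exists d => //; have [] := SP d dc.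
    have [_ _ /(_ c' Sc' z zi)[d' [Sd' ? ?]]] := SP d dc.
    by exists d'; split => //; right; exists d.
move=> fA; have /choice[S SP] c := one (cdim c).+1 c (ltnSn _).
have : finite_set (\bigcup_(c in A) S c).
  by apply: bigcup_finite => // c _; have [] := SP c.
move=> /finite_seqP[s sE].
have sP c : (c \in s) = `[< (\bigcup_(c in A) S c) c >].
  by apply/idP/asboolP; rewrite sE.
exists s; split=> [c|c Ac]; rewrite sP; last first.
  by apply/asboolP; exists c => //; have [] := SP c.
move=> /asboolP[c' Ac' Sc] z zi; have [_ _ /(_ c Sc z zi)[d [Sd ? ?]]] := SP c'.
by exists d; split => //; rewrite sP; apply/asboolP; exists c'.
Qed.

Definition covered (s : seq cell) (x : X) : Prop := exists2 d, d \in s & ocell d x.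

Lemma compact_covered (T : topologicalType) (g : T -> X) :
  compact [set: T] -> continuous g ->
  exists s, subcomplex s /\ forall t, covered s (g t).
Proof.
move=> cT cg; have cg' : compact (range g).
  by apply: continuous_compact => //; exact: continuous_subspaceT.
have [s [ss sP]] := subcomplex_ex (compact_finite_cells cg').
exists s; split => // t; have [c ct] := ocell_ex (g t).
by exists c => //; apply: sP; exists (g t) => //; exists t.
Qed.

Lemma cw_paste (T Y : topologicalType) (g : T -> X) (k : T -> X -> Y)
    (s : seq cell) :
  compact [set: T] -> hausdorff_space T -> continuous g ->
  (forall t, covered s (g t)) ->
  (forall c, c \in s -> continuous
    (fun p : set_type [set p : T * cubeT R (cdim c) | g p.1 = cmap c p.2] =>
       k (set_val p).1 (cmap c (set_val p).2))) ->
  continuous (fun t => k t (g t)).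
Proof.
move=> cT hT cg gs ck.
apply: (@finite_cover_cts _ _ _ cell (fun c => cubeT R (cdim c)) cmap [set` s]) => //.
- exact: cw_hausdorff cw.
- by move=> c; exact: cubeT_compact.
- by move=> c; exact: cmap_cts.
- exact: finite_seq.
- by move=> t; have [c cs /ocellP[z [_ zt]]] := gs t; exists c, z.
Qed.

Definition skel (n : nat) (x : X) : Prop :=
  exists2 c : cell, (cdim c <= n)%N & ocell c x.

Lemma skel_cmap n c (z : cubeT R (cdim c)) : (cdim c <= n)%N -> skel n (cmap c z).
Proof.
move=> cn; have [zi|/cell_boundary_dim[d [dc od]]] := pselect (inner z).
  by exists c => //; exact: ocell_inner.
by exists d => //; exact: leq_trans (ltnW dc) cn.
Qed.

(** The boundary of a cell of s lies in cells of s of smaller dimension. *)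
Lemma top_cell_disjoint s e d (z : cubeT R (cdim d)) :
  subcomplex s -> (forall c, c \in s -> (cdim c <= cdim e)%N) ->
  d \in s -> d != e -> ~ ocell e (cmap d z).
Proof.
move=> ss emax ds /eqP de oe; have [zi|zi] := pselect (inner z).
  by apply: de; exact: ocell_uniq (ocell_inner zi) oe.
have [c [cs cd oc]] := ss d ds z zi.
have ce := ocell_uniq oc oe; move: cd (emax d ds); rewrite ce => cd dm.
by have := leq_trans cd dm; rewrite ltnn.
Qed.

Local Notation I := (unit_itv R).

(** Radial projection of the cube minus a point to its boundary. The map is
    first moved off the centre of the top cell e, within e; this is possible
    because e has larger dimension than the source. *)
Lemma push_off_top_cell n s e (g : cubeT R n -> X) :
  continuous g -> subcomplex s -> e \in s ->
  (forall c, c \in s -> (cdim c <= cdim e)%N) -> (n < cdim e)%N ->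
  (forall x, covered s (g x)) ->
  exists D : cubeT R n * I -> X, [/\ continuous D, forall x, D (x, itv0 R) = g x,
    forall x t, ~ ocell e (g x) -> D (x, t) = g x
    & forall x, covered [seq d <- s | d != e] (D (x, itv1 R))].
Proof.
move=> cg ss es emax ne gs; set k := cdim e in ne *.
have [pt ptP] : exists pt : X -> cubeT R k, forall x, ocell e x ->
    inner (pt x) /\ cmap e (pt x) = x.
  suff /choice[pt ptP] : forall x, exists z : cubeT R k, ocell e x ->
      inner z /\ cmap e z = x by exists pt.
  move=> x; have [/ocellP[z zP]|nx] := pselect (ocell e x); first by exists z.
  by exists (at_off 0).
have ptK z : inner z -> pt (cmap e z) = z.
  move=> zi; have [pi pe] := ptP _ (ocell_inner zi); exact: (@cmap_inj e).
have bdry z : ~ inner z -> ~ ocell e (cmap e z).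
  move=> zi oe; have [d [dd od]] := cell_boundary_dim zi.
  by have de := ocell_uniq od oe; rewrite de ltnn in dd.
pose rho (y : 'rV[R]_k) : R := Num.min 1 (2 - 4 * `|y|).
have rho_cts (S : topologicalType) (f : S -> 'rV[R]_k) :
    continuous f -> continuous (fun x => rho (f x)).
  move=> cf; apply: cts_min; first exact: cst_continuous.
  apply: cts_addR; first exact: cst_continuous.
  apply: cts_oppR; apply: cts_mul; first exact: cst_continuous.
  exact: cts_norm.
have rho_ge0 z : 0 <= rho (@off R k z).
  by rewrite /rho le_min ler01 /=; have := off_le z; lra.
have rho_bd z : ~ inner z -> rho (@off R k z) = 0.
  by move=> /not_inner zE; rewrite /rho zE (min_idPr _); lra.
have off_pair (S : topologicalType) (f : S -> cubeT R k) : continuous f ->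
    continuous (fun x => off (f x)).
  by move=> cf; apply: (@cts_comp _ _ _ (@off R k)) => //; exact: off_cts.
(* The position in the cell e, scaled by rho, which vanishes on the boundary,
   so that it extends by zero outside e. *)
pose w (x : X) : 'rV[R]_k :=
  if `[< ocell e x >] then rho (off (pt x)) *: off (pt x) else 0.
have w_e z : w (cmap e z) = rho (off z) *: off z.
  rewrite /w; case: asboolP => [oe|noe].
    have [zi|/bdry//] := pselect (inner z); by rewrite ptK.
  have [/ocell_inner//|zi] := pselect (inner z).
  by rewrite rho_bd// scale0r.
have w_d d z : d \in s -> d != e -> w (cmap d z) = 0.
  move=> ds de; rewrite /w; case: asboolP => // oe.
  by have := top_cell_disjoint ss emax ds de oe.
have cw0 : continuous (fun x => w (g x)).
  apply: (@cw_paste _ _ g (fun _ => w) s) => //.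
  - exact: cubeT_compact.
  - exact: cubeT_hausdorff.
  move=> d ds; set G := [set p : cubeT R n * cubeT R (cdim d) | _].
  have [dE|de] := eqVneq d e; last first.
    apply: (@cts_eq _ _ (fun _ : G => 0 : 'rV[R]_k)) => [p|]; first by rewrite w_d.
    exact: cst_continuous.
  subst d; apply: (@cts_eq _ _ (fun p : G =>
    rho (off (set_val p).2) *: off (set_val p).2)) => [p|]; first by rewrite w_e.
  apply: cts_scale; first apply: rho_cts; apply: off_pair;
    by apply: cts_snd; exact: set_val_cts.
(* The position is perturbed by at most 1/8. Where the cut-off rho is 1, at
   distance at most 1/4 from the centre, the perturbed position b is v x, which
   is not 0; further out it has norm at least 1/4 - 1/8. *)
have [|v [cv vw v0]] := perturb_off_origin ne (_ : 0 < 8^-1) cw0.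
  by rewrite invr_gt0.
pose b (x : cubeT R n) (y : 'rV[R]_k) := y + rho y *: (v x - rho y *: y).
have b0 x z : g x = cmap e z -> b x (off z) != 0.
  move=> gx; have := vw x; rewrite gx w_e => vx.
  have [z4|z4] := leP `|off z| 4^-1.
    have r1 : rho (off z) = 1 by rewrite /rho (min_idPl _)//; lra.
    by rewrite /b r1 !scale1r addrC subrK v0.
  rewrite -normr_gt0 /b; set q := rho _ *: (_ - _).
  have : `|q| <= 8^-1.
    rewrite normrZ ger0_norm//; apply: le_trans vx.
    by rewrite ler_piMl// /rho ge_min lexx.
  have := ler_normB (off z + q) q; rewrite addrK; lra.
pose rad (y : 'rV[R]_k) := (2 * `|y|)^-1 *: y.
have rad_norm y : y != 0 -> `|rad y| = 2^-1.
  move=> y0; have y1 : `|y| != 0 by rewrite normr_eq0.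
  rewrite normrZ ger0_norm ?invr_ge0 ?mulr_ge0//.
  by rewrite invfM mulfVK.
(* The straight line from a point of the cell to the radial projection of its
   perturbed position. On the boundary rho vanishes and nothing moves. *)
pose K (p : cubeT R n * I) (x : X) : X := if `[< ocell e x >] then
  cmap e (at_off (off (pt x) + ival p.2 *: (rad (b p.1 (off (pt x))) - off (pt x))))
  else x.
have K_e p z : g p.1 = cmap e z -> K p (cmap e z) =
    cmap e (at_off (off z + ival p.2 *: (rad (b p.1 (off z)) - off z))).
  move=> gz; rewrite /K; case: asboolP => [oe|noe].
    have [zi|/bdry//] := pselect (inner z); by rewrite ptK.
  have [/ocell_inner//|zi] := pselect (inner z).
  rewrite /b rho_bd// scale0r addr0 /rad not_inner// divff// invr1 scale1r.
  by rewrite subrr scaler0 addr0 at_offK.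
have K_d p d z : d \in s -> d != e -> K p (cmap d z) = cmap d z.
  move=> ds de; rewrite /K; case: asboolP => // oe.
  by have := top_cell_disjoint ss emax ds de oe.
exists (fun p => K p (g p.1)); split.
- apply: (@cw_paste _ _ (fun p : cubeT R n * I => g p.1) K s).
  + by apply: prod_compact; [exact: cubeT_compact|exact: unit_itv_compact].
  + by apply: prod_hausdorff; [exact: cubeT_hausdorff|exact: unit_itv_hausdorff].
  + by apply: (@cts_comp _ _ _ g) => //; cts.
  + by move=> p; exact: gs.
  move=> d ds; have [dE|de] := eqVneq d e; last first.
    apply: (@cts_eq _ _ (fun p : set_type [set p : cubeT R n * I * cubeT R (cdim d) |
      g p.1.1 = cmap d p.2] => cmap d (set_val p).2)) => [p|].
      by rewrite K_d.
    apply: (@cts_comp _ _ _ (cmap d)); first exact: cmap_cts.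
    by apply: cts_snd; exact: set_val_cts.
  subst d; set G := [set p : cubeT R n * I * cubeT R (cdim e) | _].
  have GP (p : G) : g (set_val p).1.1 = cmap e (set_val p).2 := set_valP p.
  apply: (@cts_eq _ _ (fun p : G => cmap e (at_off (off (set_val p).2 +
    ival (set_val p).1.2 *: (rad (b (set_val p).1.1 (off (set_val p).2)) -
      off (set_val p).2))))) => [p|].
    by rewrite K_e.
  have c2 : continuous (fun p : G => off (set_val p).2).
    by apply: off_pair; apply: cts_snd; exact: set_val_cts.
  have cb : continuous (fun p : G => b (set_val p).1.1 (off (set_val p).2)).
    rewrite /b; apply: cts_add => //; apply: cts_scale; first exact: rho_cts.
    apply: cts_add; last by apply: cts_opp; apply: cts_scale => //; exact: rho_cts.
    apply: (@cts_comp _ _ _ v) => //; do 2 apply: cts_fst; exact: set_val_cts.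
  apply: (@cts_comp _ _ _ (cmap e)); first exact: cmap_cts.
  apply: (@cts_comp _ _ _ (@at_off R k)); first exact: at_off_cts.
  apply: cts_add => //; apply: cts_scale.
    by apply: cts_ival; apply: cts_snd; apply: cts_fst; exact: set_val_cts.
  apply: cts_add; last exact: cts_opp.
  rewrite /rad; apply: cts_scale => //; apply: cts_inv => [p|].
    by rewrite mulf_neq0 ?pnatr_eq0// normr_eq0; exact/b0/GP.
  by apply: cts_mul; [exact: cst_continuous|exact: cts_norm].
- move=> x; rewrite /K /= ival0; case: asboolP => // oe.
  by have [_ pe] := ptP _ oe; rewrite scale0r addr0 at_offK.
- by move=> x t noe; rewrite /K /=; case: asboolP.
- move=> x; rewrite /K /= ival1; case: asboolP => [oe|noe]; last first.
    have [d ds od] := gs x; exists d => //; rewrite mem_filter ds andbT.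
    by apply/eqP => de; rewrite -de in noe.
  have [_ pe] := ptP _ oe; rewrite scale1r [off _ + _]addrC subrK.
  set z := at_off _.
  have bx : b x (off (pt (g x))) != 0 by apply: b0; rewrite pe.
  have zi : ~ inner z.
    by rewrite /inner /z offK rad_norm// ltxx.
  have [d [ds de od]] := ss e es z zi; exists d => //.
  by rewrite mem_filter ds andbT; apply/eqP => dE; rewrite dE ltnn in de.
Qed.

Lemma homotopy_concat (T Y : topologicalType) (H G : T * I -> Y) :
  continuous H -> continuous G ->
  (forall x, H (x, itv1 R) = G (x, itv0 R)) ->
  exists K : T * I -> Y, [/\ continuous K,
    forall x, K (x, itv0 R) = H (x, itv0 R),
    forall x, K (x, itv1 R) = G (x, itv1 R)
    & forall x y, (forall t, H (x, t) = y) -> (forall t, G (x, t) = y) ->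
        forall t, K (x, t) = y].
Proof.
move=> cH cG HG; pose q (p : T * I) : R := ival p.2 + ival p.2 - 1.
exists (fun p => if q p <= 0 then H (p.1, clamp (ival p.2 + ival p.2))
                 else G (p.1, clamp (q p))); split.
- apply: cts_paste.
  + by rewrite /q; cts.
  + by apply: (@cts_comp _ _ _ H) => //; cts.
  + by apply: (@cts_comp _ _ _ G) => //; rewrite /q; cts.
  + move=> [x t] /= q0; rewrite q0 -/(itv0 R) -HG; congr (H (x, _)).
    by apply: clamp_ge1; move: q0; rewrite /q /=; lra.
- by move=> x; rewrite /q /= ival0 add0r sub0r oppr_le0 ler01.
- by move=> x; rewrite /q /= ival1 addrK ifN -?ltNge ?ltr01.
- by move=> x y Hy Gy t; case: ifP.
Qed.

(** The cells of dimension more than n that the image meets are emptied one after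
    the other, starting with the largest dimension. *)
Lemma compress_cell n (g : cubeT R n -> X) : continuous g ->
  exists D : cubeT R n * I -> X, [/\ continuous D, forall x, D (x, itv0 R) = g x,
    forall x t, skel n (g x) -> D (x, t) = g x
    & forall x, skel n (D (x, itv1 R))].
Proof.
move=> cg; have [s [ss gs]] := compact_covered (@cubeT_compact R n) cg.
have [m sm] := ubnP (size s); elim: m s g cg ss gs sm => // m IH s g cg ss gs sm.
have [/hasP[c cs nc]|/hasPn sn] := boolP (has (fun c => n < cdim c)%N s); last first.
  exists (fun p => g p.1); split=> //.
    by apply: (@cts_comp _ _ _ g) => //; cts.
  by move=> x; have [c cs cx] := gs x; exists c => //; rewrite leqNgt; exact: sn.
have [e es emax] : exists2 e, e \in s & forall d, d \in s -> (cdim d <= cdim e)%N.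
  elim: (s) c cs {nc} => // a l IHl c _.
  case: l IHl => [_|b l /(_ b (mem_head _ _))[e el emax]].
    by exists a; rewrite ?mem_head// => d; rewrite inE => /eqP ->.
  have [ae|/ltnW ea] := leqP (cdim a) (cdim e).
    by exists e; [rewrite in_cons el orbT|move=> d /predU1P[->//|/emax]].
  exists a; first exact: mem_head.
  by move=> d /predU1P[->//|/emax de]; exact: leq_trans de ea.
have ne : (n < cdim e)%N by exact: leq_trans nc (emax c cs).
have [D [cD D0 De D1]] := push_off_top_cell cg ss es emax ne gs.
have cg1 : continuous (fun x => D (x, itv1 R)).
  by apply: (@cts_comp _ _ _ D (fun x => (x, itv1 R))) => //; cts.
have ss' : subcomplex [seq d <- s | d != e].
  move=> d; rewrite mem_filter => /andP[_ ds] z zi.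
  have [d' [d's dd' od']] := ss d ds z zi; exists d'; split=> //.
  rewrite mem_filter d's andbT; apply/eqP => d'e.
  by have := leq_trans dd' (emax d ds); rewrite d'e ltnn.
have [|D' [cD' D'0 D'n D'1]] := IH _ _ cg1 ss' D1.
  rewrite ltnS in sm; apply: leq_trans sm.
  rewrite size_filter -(count_predC (pred1 e) s) -addn1 addnC leq_add2r.
  by rewrite -has_count has_pred1.
have [K [cK K0 K1 Kc]] := homotopy_concat cD cD' (fun x => esym (D'0 x)).
exists K; split => //; first by move=> x; rewrite K0.
  move=> x t gx; have Dx u : D (x, u) = g x.
    apply: De => oe; have [c' c'n oc'] := gx.
    by rewrite (ocell_uniq oc' oe) leqNgt ne in c'n.
  by apply: Kc => // u; rewrite D'n ?Dx.
by move=> x; rewrite K1.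
Qed.

Section extend_cell.
Variable n : nat.
Local Notation B := (set_type [set z : cubeT R n | ~ inner z]).
Variables (f : cubeT R n -> X) (h : B * I -> X).
Hypotheses (cf : continuous f) (ch : continuous h).
Hypothesis h0 : forall b, h (b, itv0 R) = f (set_val b).

Let bdp z (zi : ~ inner z) : B :=
  exist _ z (mem_set (zi : [set z : cubeT R n | ~ inner z] z)).

Let nrm (z : cubeT R n) : R := 2 * `|off z|.

Let nrm_cts : continuous nrm.
Proof.
by apply: cts_mul; [exact: cst_continuous|apply: cts_norm; exact: off_cts].
Qed.

Let dil (z : cubeT R n) : cubeT R n := at_off ((Num.max (nrm z) 2^-1)^-1 *: off z).

Let dil_cts : continuous dil.
Proof.
apply: (@cts_comp _ _ _ (@at_off R n)); first exact: at_off_cts.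
apply: cts_scale; last exact: off_cts.
apply: cts_inv => [z|]; first by rewrite gt_eqF// lt_max invr_gt0 ltr0n orbT.
by apply: cts_max => //; exact: cst_continuous.
Qed.

Let dil_off z : off (dil z) = (Num.max (nrm z) 2^-1)^-1 *: off z.
Proof.
rewrite offK// normrZ ger0_norm; last by rewrite invr_ge0 le_max invr_ge0 ler0n orbT.
set m := Num.max _ _; have m0 : 0 < m by rewrite lt_max invr_gt0 ltr0n orbT.
rewrite mulrC ler_pdivrMr// (_ : `|off z| = 2^-1 * nrm z).
  by rewrite ler_pM2l ?invr_gt0// le_max lexx.
by rewrite /nrm mulKf.
Qed.

Let dil_bd z : 0 <= 2 * nrm z - 1 -> ~ inner (dil z).
Proof.
move=> z1; rewrite /inner dil_off normrZ (max_idPl _); last by lra.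
rewrite ger0_norm; last by rewrite invr_ge0; lra.
rewrite /nrm invfM mulfVK ?ltxx//; move: z1; rewrite /nrm => z1.
by apply/eqP => z0; move: z1; rewrite z0; lra.
Qed.

(** The map f on a concentric half-size cube, surrounded by a collar on which
    the homotopy of the boundary is spread out. *)
Let G (z : cubeT R n) : X :=
  if pselect (~ inner (dil z)) is left bz then
    h (bdp bz, clamp (2 * nrm z - 1)) else f (dil z).

Let G_lo z : 2 * nrm z - 1 <= 0 -> G z = f (dil z).
Proof.
move=> z1; rewrite /G; case: pselect => // bz.
by rewrite clamp_le0// -/(itv0 R) h0.
Qed.

Let G_hi z (b : B) : set_val b = dil z -> G z = h (b, clamp (2 * nrm z - 1)).
Proof.
move=> bz; rewrite /G; case: pselect => bz'.
  by congr (h (_, _)); apply: set_val_inj; rewrite bz.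
by exfalso; apply: bz'; rewrite -bz; exact: (set_valP b).
Qed.

Let G_cts : continuous G.
Proof.
apply: (@cts_paste_sub R _ _ (fun z => 2 * nrm z - 1)).
- apply: cts_addR; last exact: cst_continuous.
  by apply: cts_mul => //; exact: cst_continuous.
- set S := set_type _; apply: (@cts_eq _ _ (fun z : S => f (dil (set_val z)))).
    by move=> z; rewrite G_lo//; exact: (set_valP z).
  apply: (@cts_comp _ _ _ f) => //.
  by apply: (@cts_comp _ _ _ dil) => //; exact: set_val_cts.
- set S := set_type _; pose b (z : S) : B := bdp (dil_bd (set_valP z)).
  apply: (@cts_eq _ _ (fun z : S => h (b z, clamp (2 * nrm (set_val z) - 1)))).
    by move=> z; rewrite (@G_hi _ (b z)).
  apply: (@cts_comp _ _ _ h) => //; apply: cts_pair.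
    apply: set_type_cts; apply: (@cts_comp _ _ _ dil) => //; exact: set_val_cts.
  apply: cts_clamp; apply: cts_addR; last exact: cst_continuous.
  apply: cts_mul; first exact: cst_continuous.
  by apply: (@cts_comp _ _ _ nrm) => //; exact: set_val_cts.
Qed.

(** The homotopy extension property of the boundary of a cube: K is G on
    concentric cubes that grow from half size to full size. *)
Lemma extend_homotopy : exists K : cubeT R n * I -> X, [/\ continuous K,
    forall z, K (z, itv0 R) = f z,
    forall b t, K (set_val b, t) = h (b, t)
    & n = 0%N -> forall z t, K (z, t) = f z].
Proof.
pose shr (p : cubeT R n * I) : cubeT R n :=
  at_off ((2^-1 * (1 + ival p.2)) *: off p.1).
have half t : 0 <= 2^-1 * (1 + @ival R t) <= 1.
  by have := ivalP t; move=> /andP[? ?]; apply/andP; split; lra.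
have shrE z t : off (shr (z, t)) = (2^-1 * (1 + ival t)) *: off z.
  have /andP[t0 t1] := half t.
  rewrite offK// normrZ ger0_norm// (le_trans _ (off_le z))//.
  by rewrite ler_piMl.
have nshr z t : nrm (shr (z, t)) = (1 + ival t) * `|off z|.
  have /andP[t0 t1] := half t.
  by rewrite /nrm shrE normrZ ger0_norm// mulrA mulrA mulfV// mul1r.
exists (fun p => G (shr p)); split.
- apply: (@cts_comp _ _ _ G) => //.
  apply: (@cts_comp _ _ _ (@at_off R n)); first exact: at_off_cts.
  apply: cts_scale.
    by apply: cts_mul; first exact: cst_continuous; cts.
  by apply: (@cts_comp _ _ _ (@off R n)); [exact: off_cts|cts].
- move=> z; have zh := off_le z.
  rewrite G_lo; last by rewrite nshr ival0 addr0 mul1r; lra.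
  congr f; rewrite -[RHS]at_offK -[LHS]at_offK dil_off shrE ival0 addr0 mulr1.
  rewrite nshr ival0 addr0 mul1r (max_idPr zh) invrK scalerA mulfV//.
  by rewrite scale1r.
- move=> b t; have bh := not_inner (set_valP b).
  have tge : 0 <= ival t := ival_ge0 t.
  have dE : set_val b = dil (shr (set_val b, t)).
    rewrite -[LHS]at_offK -[RHS]at_offK dil_off shrE nshr bh scalerA.
    rewrite (max_idPl _); last by lra.
    by rewrite (mulrC _ 2^-1) mulVf ?scale1r// mulf_neq0 ?invr_eq0 ?pnatr_eq0//
      gt_eqF//; lra.
  rewrite (G_hi dE) nshr bh; congr (h (_, _)); rewrite -[RHS]clampK.
  by congr clamp; lra.
- move=> n0 z t; have ze (z' : cubeT R n) : z' = z.
    by apply: cval_inj; apply/rowP => i; exfalso; case: i => i; rewrite n0.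
  rewrite G_lo; first by rewrite (ze (dil _)).
  rewrite nshr (_ : off z = 0) ?normr0; first by lra.
  by apply/rowP => i; exfalso; case: i => i; rewrite n0.
Qed.

(** First the homotopy given on the boundary is extended, until it is stationary
    there; then the cell is compressed during [a, b] relative to its boundary. *)
Lemma extend_cell (a b : R) : 0 <= a -> a < b -> b <= 1 ->
  (forall x t, a <= ival t -> h (x, t) = h (x, clamp a)) ->
  (forall x, skel n (h (x, clamp a))) ->
  exists K : cubeT R n * I -> X, [/\ continuous K,
    forall z, K (z, itv0 R) = f z, forall b t, K (set_val b, t) = h (b, t),
    (forall z t, b <= ival t -> K (z, t) = K (z, clamp b)) /\
    (forall z, skel n (K (z, itv1 R)))
    & n = 0%N -> forall z t, skel 0 (f z) -> K (z, t) = f z].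
Proof.
move=> a0 ab b1 ha hs; have [K1 [cK1 K10 K1b K1n]] := extend_homotopy.
have cg : continuous (fun z => K1 (z, clamp a)).
  by apply: (@cts_comp _ _ _ K1 (fun z => (z, clamp a))) => //; cts.
have [D [cD D0 Ds D1]] := compress_cell cg.
have ba0 : 0 < b - a by lra.
have cla : ival (clamp a) = a by rewrite ival_clamp//; apply/andP; split; lra.
pose r (t : I) : R := (b - a)^-1 * (ival t - a).
have rE t : b <= ival t -> clamp (r t) = itv1 R.
  move=> bt; apply: clamp_ge1; rewrite /r mulrC ler_pdivlMr// mul1r.
  by rewrite lerB.
exists (fun p => if ival p.2 - a <= 0 then K1 p else D (p.1, clamp (r p.2))); split.
- apply: cts_paste; first by cts.
  + exact: cK1.
  + by apply: (@cts_comp _ _ _ D) => //; rewrite /r; cts.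
  + move=> [z t] /= ta; rewrite /r ta mulr0 -/(itv0 R) D0; congr (K1 (z, _)).
    by apply: ival_inj; rewrite cla; lra.
- by move=> z; rewrite ival0 sub0r oppr_le0 a0.
- move=> x t /=; case: ifPn => [_//|]; rewrite -ltNge => ta.
  rewrite Ds; rewrite K1b //; symmetry; apply: ha; lra.
- split=> [z t bt|z] /=.
    rewrite ival_clamp; last by apply/andP; split; lra.
    rewrite !ifN -?ltNge; [|lra..].
    rewrite !rE// ival_clamp// ?lexx//; apply/andP; split; lra.
  by rewrite ival1 ifN -?ltNge; [rewrite rE ?ival1|lra].
- move=> n0 z t fz /=; have K1c u : K1 (z, u) = f z by exact: K1n.
  by case: ifP => // _; rewrite Ds K1c// n0.
Qed.

End extend_cell.

End cw_basics.
Arguments cmap {R X E} phi c z.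

(** * Cellular approximation *)

Section cellular_approximation.
Variables (R : realType) (X Y : ptopologicalType) (E E' : nat -> Type).
Variables (phi : forall n, E n -> 'rV[R]_n -> X).
Variables (psi : forall n, E' n -> 'rV[R]_n -> Y).
Hypotheses (cwX : cw_structure phi) (cwY : cw_structure psi).
Variables (f : X -> Y).
Hypothesis cf : continuous f.
Local Notation I := (unit_itv R).

(** The n-cells are compressed during the interval [tau n, tau n.+1] and the
    homotopy is stationary on them afterwards, so that it is defined on each cell after
    finitely many steps. *)
Let tau (n : nat) : R := 1 - n.+1%:R^-1.

Let tau_ge0 n : 0 <= tau n.
Proof. by rewrite subr_ge0 invf_le1 ?ltr0n// ler1n. Qed.

Let tau_le1 n : tau n <= 1.
Proof. by rewrite gerBl invr_ge0 ler0n. Qed.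

Let tau_lt n : tau n < tau n.+1.
Proof. by rewrite ltrD2l ltrN2 ltf_pV2 ?posrE ?ltr0n// ltr_nat. Qed.

Let tau_le m n : (m <= n)%N -> tau m <= tau n.
Proof. by move=> mn; rewrite lerD2l lerN2 lef_pV2 ?posrE ?ltr0n// ler_nat. Qed.

(** The invariants of the construction on a single closed cell. The last one fixes
    the vertices that f maps to vertices, so that the homotopy is based. *)
Let moved (H : X -> I -> Y) (c : cell E) : Prop :=
  [/\ continuous (fun p : cubeT R (cdim c) * I => H (cmap phi c p.1) p.2),
      forall z, H (cmap phi c z) (itv0 R) = f (cmap phi c z),
      forall z t, tau (cdim c).+1 <= ival t ->
        H (cmap phi c z) t = H (cmap phi c z) (clamp (tau (cdim c).+1)),
      forall z, skel psi (cdim c) (H (cmap phi c z) (itv1 R))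
    & cdim c = 0%N -> forall z t, skel psi 0 (f (cmap phi c z)) ->
        H (cmap phi c z) t = f (cmap phi c z)].

Let skel_le m n (y : Y) : (m <= n)%N -> skel psi m y -> skel psi n y.
Proof. by move=> mn [c cm yc]; exists c => //; exact: leq_trans cm mn. Qed.

(** The boundary of c lies in finitely many cells of smaller dimension, on each of
    which H is continuous, so H restricts to a homotopy on the boundary. *)
Let extend_to_cell n (H : X -> I -> Y) (c : cell E) :
  (forall d, (cdim d < n)%N -> moved H d) -> cdim c = n ->
  exists K : cubeT R (cdim c) * I -> Y, [/\ continuous K,
    forall z, K (z, itv0 R) = f (cmap phi c z),
    forall z t, ~ inner z -> K (z, t) = H (cmap phi c z) t,
    (forall z t, tau n.+1 <= ival t -> K (z, t) = K (z, clamp (tau n.+1))) /\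
    (forall z, skel psi n (K (z, itv1 R)))
    & n = 0%N -> forall z t, skel psi 0 (f (cmap phi c z)) ->
        K (z, t) = f (cmap phi c z)].
Proof.
move=> Hm cn; subst n; set B := set_type [set z : cubeT R (cdim c) | ~ inner z].
have low (b : B) : exists d z, (cdim d < cdim c)%N /\
    cmap phi d z = cmap phi c (set_val b).
  have [d [dc /ocellP[z [_ zb]]]] := cell_boundary_dim cwX (set_valP b).
  by exists d, z.
have cB : compact [set: B].
  apply: set_type_compact; apply: (subclosed_compact _ (@cubeT_compact R (cdim c))) => //.
  rewrite (_ : [set z | _] = (fun z => `|off z|) @^-1` [set r | 2^-1 <= r]).
    apply: closed_comp => [z _|]; last exact: closed_ge.
    by apply: cts_norm; exact: off_cts.
  by apply/seteqP; split=> z /=; rewrite /inner => h; [rewrite leNgt|];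
    apply/negP => //; rewrite -leNgt.
have hB : hausdorff_space B by apply: set_type_hausdorff; exact: cubeT_hausdorff.
have ch : continuous (fun p : B * I => H (cmap phi c (set_val p.1)) p.2).
  have cg : continuous (fun p : B * I => cmap phi c (set_val p.1)).
    apply: (@cts_comp _ _ _ (cmap phi c)); first exact: cmap_cts.
    by apply: (@cts_comp _ _ _ set_val); [exact: set_val_cts|cts].
  have cBI : compact [set: B * I].
    by apply: prod_compact => //; exact: unit_itv_compact.
  have [s [_ gs]] := compact_covered cwX cBI cg.
  apply: (@cw_paste _ _ _ _ cwX _ _ _ (fun (p : B * I) x => H x p.2)
    [seq d <- s | (cdim d < cdim c)%N]) => //.
  - by apply: prod_hausdorff => //; exact: unit_itv_hausdorff.
  - move=> p; have [d ds od] := gs p; exists d => //.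
    rewrite mem_filter ds andbT.
    have [d' [dd' od']] := cell_boundary_dim cwX (set_valP p.1).
    by rewrite (ocell_uniq cwX od od').
  move=> d; rewrite mem_filter => /andP[dc _]; have [cH _ _ _ _] := Hm d dc.
  apply: (@cts_comp _ _ _ (fun p : cubeT R (cdim d) * I => H (cmap phi d p.1) p.2)
    (fun p => ((set_val p).2, (set_val p).1.2))) => //.
  apply: cts_pair; first by apply: cts_snd; exact: set_val_cts.
  by apply: cts_snd; apply: cts_fst; exact: set_val_cts.
have cfc : continuous (fun z => f (cmap phi c z)).
  by apply: (@cts_comp _ _ _ f) => //; exact: cmap_cts.
have tauE n : ival (clamp (tau n)) = tau n by rewrite ival_clamp// tau_ge0 tau_le1.
have stat (b : B) t : tau (cdim c) <= ival t ->
    H (cmap phi c (set_val b)) t = H (cmap phi c (set_val b)) (clamp (tau (cdim c))).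
  move=> ct; have [d [z [dc <-]]] := low b; have [_ _ Hs _ _] := Hm d dc.
  have tt := tau_le dc.
  by rewrite Hs ?(le_trans tt)// [RHS]Hs// tauE.
have [|||K [cK K0 Kb Ks Kn]] := extend_cell cwY cfc ch _ (tau_ge0 (cdim c))
    (tau_lt (cdim c)) (tau_le1 (cdim c).+1).
- by move=> b /=; have [d [z [dc <-]]] := low b; have [_ -> _ _ _] := Hm d dc.
- by move=> b t; exact: stat.
- move=> b /=; rewrite -(stat b (itv1 R)) ?ival1 ?tau_le1//.
  have [d [z [dc <-]]] := low b; have [_ _ _ Hs _] := Hm d dc.
  by apply: skel_le (Hs z); exact: ltnW.
exists K; split=> // z t zi.
have := Kb (exist _ z (mem_set (zi : [set z : cubeT R (cdim c) | ~ inner z] z)) : B) t.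
by rewrite set_valE.
Qed.

Let extend_to_skeleton n (H : X -> I -> Y) :
  (forall d, (cdim d < n)%N -> moved H d) ->
  exists H' : X -> I -> Y, (forall d, (cdim d < n.+1)%N -> moved H' d) /\
    forall x t, (exists2 c, (cdim c < n)%N & ocell phi c x) -> H' x t = H x t.
Proof.
move=> Hm.
pose P c (K : cubeT R (cdim c) * I -> Y) := [/\ continuous K,
    forall z, K (z, itv0 R) = f (cmap phi c z),
    forall z t, ~ inner z -> K (z, t) = H (cmap phi c z) t,
    (forall z t, tau n.+1 <= ival t -> K (z, t) = K (z, clamp (tau n.+1))) /\
    (forall z, skel psi n (K (z, itv1 R)))
    & n = 0%N -> forall z t, skel psi 0 (f (cmap phi c z)) ->
        K (z, t) = f (cmap phi c z)].
have Kex c : exists K, cdim c = n -> @P c K.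
  have [cn|] := eqVneq (cdim c) n; last by move=> /eqP nc; exists (fun=> point).
  by have [K KP] := extend_to_cell Hm cn; exists K.
pose K c := projT1 (cid (Kex c)).
have KP c : cdim c = n -> P c (K c) := projT2 (cid (Kex c)).
(* Cell and coordinate are chosen together, as the type of the coordinate depends
   on the cell. *)
pose Q x (s : {c : cell E & cubeT R (cdim c)}) :=
  [/\ cdim (projT1 s) = n, inner (projT2 s) & cmap phi (projT1 s) (projT2 s) = x].
pose H' x t := if pselect (exists s, Q x s) is left ex then
  let s := projT1 (cid ex) in K (projT1 s) (projT2 s, t) else H x t.
have H'new c z t : cdim c = n -> H' (cmap phi c z) t = K c (z, t).
  move=> cn; rewrite /H'; case: pselect => [ex|nex].
    case: (cid ex) => -[c' z'] [/= cn' zi' zz'].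
    have oc' : ocell phi c' (cmap phi c z) by rewrite -zz'; exact: ocell_inner.
    have [zi|zi] := pselect (inner z).
      have cc : c' = c by exact: (ocell_uniq cwX oc' (ocell_inner phi zi)).
      by subst c'; rewrite (cmap_inj cwX zi' zi zz').
    have [d [dc od]] := cell_boundary_dim cwX zi.
    by have dc' := ocell_uniq cwX od oc'; rewrite dc' cn' cn ltnn in dc.
  have [zi|zi] := pselect (inner z).
    by exfalso; apply: nex; exists (existT _ c z).
  by have [_ _ Kb _ _] := KP c cn; rewrite Kb.
have H'old x t : (exists2 c, (cdim c < n)%N & ocell phi c x) -> H' x t = H x t.
  move=> [c cn oc]; rewrite /H'; case: pselect => // -[[c' z'] [/= cn' zi' zz']].
  have oc' : ocell phi c' x by rewrite -zz'; exact: ocell_inner.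
  by have cc := ocell_uniq cwX oc oc'; rewrite cc cn' ltnn in cn.
exists H'; split => // c; rewrite ltnS leq_eqVlt => /orP[/eqP cn|cn].
  have [cK K0 Kb [Ks K1] Kn] := KP c cn; split.
  - by apply: cts_eq cK => -[z t]; rewrite H'new.
  - by move=> z; rewrite H'new.
  - by move=> z t; rewrite cn => zt; rewrite !H'new// Ks.
  - by move=> z; rewrite cn H'new.
  - by move=> c0 z t fz; rewrite H'new// Kn// -cn.
have old z t : H' (cmap phi c z) t = H (cmap phi c z) t.
  apply: H'old; have [d dc od] := skel_cmap cwX z (leqnn _).
  by exists d => //; exact: leq_ltn_trans dc cn.
have [cH H0 Hs H1 Hn] := Hm c cn; split.
- by apply: cts_eq cH => -[z t]; rewrite old.
- by move=> z; rewrite old.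
- by move=> z t zt; rewrite !old Hs.
- by move=> z; rewrite old.
- by move=> c0 z t fz; rewrite old Hn.
Qed.

(** On each cell all stages but finitely many agree, and their limit is continuous
    because it is so on each closed cell. *)
Theorem cellular_approximation : exists H : X * I -> Y, [/\ continuous H,
    forall x, H (x, itv0 R) = f x,
    forall n x, skel phi n x -> skel psi n (H (x, itv1 R))
    & forall x t, skel phi 0 x -> skel psi 0 (f x) -> H (x, t) = f x].
Proof.
pose stage n := {H : X -> I -> Y | forall d, (cdim d < n)%N -> moved H d}.
pose next n (H : stage n) : stage n.+1 :=
  let e := cid (extend_to_skeleton (svalP H)) in
  exist _ (projT1 e) (projT2 e).1.
pose G := fix G n : stage n := if n is m.+1 then next m (G m)
  else exist _ (fun x _ => f x) (fun d (h : (cdim d < 0)%N) => False_ind _ (notF h)).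
have GS n x t : (exists2 c, (cdim c < n)%N & ocell phi c x) ->
    sval (G n.+1) x t = sval (G n) x t.
  by move=> nx; exact: (projT2 (cid (extend_to_skeleton (svalP (G n))))).2.
have GE m n c x t : ocell phi c x -> (cdim c < m)%N -> (m <= n)%N ->
    sval (G n) x t = sval (G m) x t.
  move=> cx cm /subnKC <-; elim: (n - m)%N => [|k IH]; first by rewrite addn0.
  rewrite addnS GS//; exists c => //; exact: leq_trans cm (leq_addr _ _).
have /choice[cl clP] : forall x, exists c, ocell phi c x := ocell_ex cwX.
pose H (p : X * I) := sval (G (cdim (cl p.1)).+1) p.1 p.2.
have HE c z t : H (cmap phi c z, t) = sval (G (cdim c).+1) (cmap phi c z) t.
  have [d dc od] := skel_cmap cwX z (leqnn _).
  rewrite -[LHS]/(sval (G (cdim (cl (cmap phi c z))).+1) (cmap phi c z) t).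
  rewrite (ocell_uniq cwX (clP _) od); symmetry; exact: (GE (cdim d).+1 (cdim c).+1 d _ t od (ltnSn _) dc).
have GP c := svalP (G (cdim c).+1) c (ltnSn _).
exists H; split.
- apply: (quotient_family_cts (quotient_family_prod (@unit_itv_compact R)
    (@unit_itv_hausdorff R) (cw_quotient_family cwX))) => c.
  by have [cG _ _ _ _] := GP c; apply: cts_eq cG => -[z t]; rewrite HE.
- move=> x; have [c /ocellP[z [_ <-]]] := ocell_ex cwX x.
  by rewrite HE; have [_ -> _ _ _] := GP c.
- move=> n x [c cn /ocellP[z [_ <-]]]; rewrite HE.
  by have [_ _ _ G1 _] := GP c; exact: skel_le (G1 z).
- move=> x t [c c0 /ocellP[z [_ <-]]] fx; rewrite HE.
  by have [_ _ _ _ Gn] := GP c; apply: Gn => //; apply/eqP; rewrite -leqn0.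
Qed.

End cellular_approximation.

(** * The mapping cone of a cellular map *)

Section row_cons.
Variable (R : realType).
Implicit Types m : nat.

Definition row_hd m (x : 'rV[R]_m.+1) : R := x 0 ord0.
Definition row_tl m (x : 'rV[R]_m.+1) : 'rV[R]_m := \row_i x 0 (lift ord0 i).
Definition row_cons m (t : R) (y : 'rV[R]_m) : 'rV[R]_m.+1 :=
  \row_i oapp (fun j => y 0 j) t (unlift ord0 i).

Lemma row_hd_cons m t (y : 'rV[R]_m) : row_hd (row_cons t y) = t.
Proof. by rewrite /row_hd mxE unlift_none. Qed.

Lemma row_tl_cons m t (y : 'rV[R]_m) : row_tl (row_cons t y) = y.
Proof. by apply/rowP => i; rewrite !mxE liftK. Qed.

Lemma row_eq m (x y : 'rV[R]_m.+1) :
  row_hd x = row_hd y -> row_tl x = row_tl y -> x = y.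
Proof.
move=> h /rowP t; apply/rowP => i; case: (unliftP ord0 i) => [j ->|->//].
by have := t j; rewrite !mxE.
Qed.

Lemma row_forall m (P : R -> Prop) (x : 'rV[R]_m.+1) :
  (forall i, P (x 0 i)) <-> P (row_hd x) /\ forall i, P (row_tl x 0 i).
Proof.
split=> [Px|[Ph Pt] i]; first by split=> [|i]; rewrite ?mxE; exact: Px.
case: (unliftP ord0 i) => [j ->|->//].
by have := Pt j; rewrite mxE.
Qed.

Lemma row_hd_cts m : continuous (@row_hd m).
Proof. exact: coord_continuous. Qed.

Lemma row_tl_cts m : continuous (@row_tl m).
Proof. by apply: cts_row => i; exact: coord_continuous. Qed.

Lemma row_cons_cts (T : topologicalType) m (t : T -> R) (y : T -> 'rV[R]_m) :
  continuous t -> continuous y -> continuous (fun x => row_cons (t x) (y x)).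
Proof.
move=> ct cy; apply: cts_row => i; case: (unlift ord0 i) => [j|] //=.
exact: cts_coord.
Qed.

End row_cons.

Section cone_cw.
Variables (R : realType) (X Y : ptopologicalType) (E E' : nat -> Type).
Variables (phi : forall n, E n -> 'rV[R]_n -> X).
Variables (psi : forall n, E' n -> 'rV[R]_n -> Y).
Hypotheses (cwX : cw_structure phi) (cwY : cw_structure psi).
Variables (x0 : E 0%N) (y0 : E' 0%N).
Hypotheses (x0pt : phi x0 0 = point) (y0pt : psi y0 0 = point).
Variable f : bmap X Y.
Hypothesis f_cell : forall n x, skel phi n x -> skel psi n (f x).
Local Notation I := (unit_itv R).
Let C : ptopologicalType := mapping_cone R f.
Let c0 : cell E := existT _ 0%N x0.
Let d0 : cell E' := existT _ 0%N y0.

(** A normal form that decides equality in the cone. *)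
Let unglue_sum (z : cone_sum R X Y) : Y + X * I :=
  match z with
  | existT b u => (if b as b return cone_part R X Y b -> Y + X * I
      then fun p => if `[< p.2 = itv0 R >] then inl (f p.1)
        else if `[< p.2 = itv1 R \/ p.1 = point >] then inl point else inr p
      else inl) u
  end.

Let unglue (c : C) : Y + X * I := unglue_sum (repr c).

Let itv01 : itv0 R <> itv1 R.
Proof.
move=> /(congr1 (@ival R)); rewrite ival0 ival1 => /esym/eqP.
by rewrite oner_eq0.
Qed.

Let unglue_rel z z' : cone_rel f z z' -> unglue_sum z = unglue_sum z'.
Proof.
case=> [a|a|t] /=; first by rewrite asboolT.
  by rewrite asboolF 1?asboolT//; [left|move=> /esym/itv01].
by case: asboolP => _; rewrite ?bmap_pt// asboolT//; right.
Qed.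

Let unglue_in y : unglue (cone_in R f y) = inl y.
Proof. exact: (glue_recE unglue_rel). Qed.

Let unglue_cn a t : unglue (cn f a t) = if `[< t = itv0 R >] then inl (f a)
  else if `[< t = itv1 R \/ a = point >] then inl point else inr (a, t).
Proof. exact: (glue_recE unglue_rel). Qed.

Let mid (t : I) : Prop := 0 < ival t < 1.

Let midP t : [\/ t = itv0 R, t = itv1 R | mid t].
Proof.
have /andP[t0 t1] := ivalP t.
have [e0|n0] := eqVneq (ival t) 0; first by constructor 1; exact: ival_eq0.
have [e1|n1] := eqVneq (ival t) 1; first by constructor 2; exact: ival_eq1.
by constructor 3; rewrite /mid lt0r n0 t0 lt_neqAle n1.
Qed.

Let mid0 : ~ mid (itv0 R). Proof. by rewrite /mid ival0 ltxx. Qed.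
Let mid1 : ~ mid (itv1 R). Proof. by rewrite /mid ival1 ltxx andbF. Qed.

Let unglue_mid a t : mid t -> a <> point -> unglue (cn f a t) = inr (a, t).
Proof.
move=> mt ap; rewrite unglue_cn asboolF; last by move=> t0; rewrite t0 in mt; exact: mid0.
by rewrite asboolF// => -[t1|//]; rewrite t1 in mt; exact: mid1.
Qed.

Let unglueP (c : C) : (exists y, c = cone_in R f y) \/
  exists a t, [/\ a <> point, mid t & c = cn f a t].
Proof.
have [[y ->]|[a [t ->]]] := cone_case c; first by left; exists y.
have [->|->|mt] := midP t.
- by left; exists (f a); rewrite cn0.
- by left; exists point; rewrite cn1 bmap_pt.
have [->|ap] := pselect (a = point); first by left; exists point; rewrite cnp bmap_pt.
by right; exists a, t.
Qed.

Let cone_in_inj y y' : cone_in R f y = cone_in R f y' -> y = y'.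
Proof. by move=> /(congr1 unglue); rewrite !unglue_in => -[]. Qed.

Let cn_inj a t a' t' : a <> point -> mid t -> a' <> point -> mid t' ->
  cn f a t = cn f a' t' -> a = a' /\ t = t'.
Proof. by move=> ? ? ? ? /(congr1 unglue); rewrite !unglue_mid// => -[]. Qed.

Let cn_in a t y : a <> point -> mid t -> cn f a t <> cone_in R f y.
Proof. by move=> ? ? /(congr1 unglue); rewrite unglue_mid// unglue_in. Qed.

Let cone_open (O : set C) : open (cone_in R f @^-1` O) ->
  open [set p : X * I | O (cn f p.1 p.2)] -> open O.
Proof.
move=> oY oX; apply: (@glue_quotient_map _ (cone_rel f)).2 => _.
apply/sigT_openP => -[] //=.
by move: oX; congr open; apply/seteqP; split => -[a t].
Qed.

Let hX := cw_hausdorff cwX.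
Let hY := cw_hausdorff cwY.

Let open_ival_lt (r : R) : open [set p : X * I | ival p.2 < r].
Proof.
apply: (@open_comp _ _ (fun p : X * I => ival p.2) [set s | s < r]).
  by move=> p _; move: p; cts.
exact: open_lt.
Qed.

Let open_ival_gt (r : R) : open [set p : X * I | r < ival p.2].
Proof.
apply: (@open_comp _ _ (fun p : X * I => ival p.2) [set s | r < s]).
  by move=> p _; move: p; cts.
exact: open_gt.
Qed.

Let open_fst (U : set X) : open U -> open [set p : X * I | U p.1].
Proof.
by move=> oU; apply: (@open_comp _ _ (fun p : X * I => p.1)) => // p _; move: p; cts.
Qed.

(** The lower half of the cylinder over U; if U contains the base point, also the
    axis and the upper half, whose end and axis are glued to that point. *)
Let base_nbhd (U : set Y) : set C := [set c | match unglue c with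
  | inl y => U y
  | inr p => U (f p.1) /\ (ival p.2 < 2^-1 \/ U point) \/
             2^-1 < ival p.2 /\ U point
  end].

Let base_nbhd_open U : open U -> open (base_nbhd U).
Proof.
move=> oU; apply: cone_open.
  by rewrite (_ : _ @^-1` _ = U)//; apply/seteqP; split=> y;
    rewrite /base_nbhd /= unglue_in.
have ofU : open [set p : X * I | U (f p.1)].
  apply: (@open_fst (f @^-1` U)); apply: open_comp => // x _.
  exact: bmap_cts.
have oUp : open [set p : X * I | U point].
  have [Up|nUp] := pselect (U point).
    by rewrite (_ : [set _ | _] = setT); [exact: openT|apply/seteqP; split].
  by rewrite (_ : [set _ | _] = set0); [exact: open0|apply/seteqP; split].
rewrite (_ : [set _ | _] = ([set p : X * I | U (f p.1)] `&`
  ([set p : X * I | ival p.2 < 2^-1] `|` [set p : X * I | U point])) `|`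
  ([set p : X * I | 2^-1 < ival p.2] `&` [set p : X * I | U point])).
  apply: openU; apply: openI => //; exact: openU.
have h2 : 0 < 2^-1 :> R by rewrite invr_gt0.
have h21 : 2^-1 < 1 :> R by lra.
apply/seteqP; split=> -[a t]; rewrite /base_nbhd /= unglue_cn.
  case: asboolP => [->|nt]; first by rewrite ival0; left; split => //; left.
  case: asboolP => [[->|->]|//] Up; first by right; rewrite ival1.
  by left; split; [rewrite bmap_pt|right].
case: asboolP => [->|nt].
  by rewrite ival0 => -[[]//|[]]; rewrite ltNge ltW.
case: asboolP => [[->|->]|//] [[h1 h]|[]//]; last by rewrite bmap_pt in h1.
by case: h => //; rewrite ival1 ltNge ltW.
Qed.

Let cone_hausdorff : hausdorff_space C.
Proof.
have sepY y y' : y <> y' -> exists2 UV : set C * set C,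
    cone_in R f y \in UV.1 /\ cone_in R f y' \in UV.2 &
    [/\ open UV.1, open UV.2 & UV.1 `&` UV.2 == set0].
  move=> /eqP; have := hY; rewrite open_hausdorff => /[apply].
  move=> [[U V] /= [Uy Vy] [oU oV /eqP UV]].
  have nUV z : U z -> V z -> False by move=> ? ?; have : set0 z by rewrite -UV.
  exists (base_nbhd U, base_nbhd V) => /=.
    by rewrite !inE in Uy Vy *; rewrite /base_nbhd /= !unglue_in.
  split; try exact: base_nbhd_open.
  apply/eqP/seteqP; split=> // c; rewrite /base_nbhd /=.
  case: (unglue c) => [z [/nUV]|p]; first exact.
  move=> [[[Uf h1]|[p1 Up]] [[Vf h2]|[p2 Vp]]].
  - exact: nUV Uf Vf.
  - by case: h1 => [h1|/nUV/(_ Vp)//]; have := lt_trans h1 p2; rewrite ltxx.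
  - by case: h2 => [h2|/(nUV _ Up)//]; have := lt_trans h2 p1; rewrite ltxx.
  - exact: nUV Up Vp.
(* A thin slab around (a, t), away from the axis, against everything outside a
   closed slab. *)
have sepXY a t y : a <> point -> mid t -> exists2 UV : set C * set C,
    cn f a t \in UV.1 /\ cone_in R f y \in UV.2 &
    [/\ open UV.1, open UV.2 & UV.1 `&` UV.2 == set0].
  move=> ap mt; have := hX; rewrite open_hausdorff => /(_ a point).
  move=> /(_ _)[|[U V] /= [Ua Vp] [oU oV /eqP UV]]; first exact/eqP.
  rewrite !inE in Ua Vp.
  have nUV z : U z -> V z -> False by move=> ? ?; have : set0 z by rewrite -UV.
  have /andP[t0 t1] := mt.
  pose lo := 2^-1 * ival t; pose hi := 2^-1 * (1 + ival t).
  pose O1 : set C := [set c | if unglue c is inr p then U p.1 /\ lo < ival p.2 < hi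
                              else False].
  pose O2 : set C := [set c | if unglue c is inr p then
     V p.1 \/ (ival p.2 < lo \/ hi < ival p.2) else True].
  have lo0 : 0 < lo by rewrite /lo; lra.
  have hi1 : hi < 1 by rewrite /hi; lra.
  exists (O1, O2) => /=.
    rewrite !inE /O1 /O2 /= unglue_mid// unglue_in; split => //; split => //=.
    by apply/andP; rewrite /lo /hi; split; lra.
  split.
  - apply: cone_open.
      rewrite (_ : _ @^-1` _ = set0); first exact: open0.
      by apply/seteqP; split=> z //; rewrite /O1 /= unglue_in.
    rewrite (_ : [set _ | _] = [set p : X * I | U p.1] `&`
      ([set p : X * I | lo < ival p.2] `&` [set p : X * I | ival p.2 < hi])).
      by apply: openI; [exact: open_fst|apply: openI].
    apply/seteqP; split=> -[x s]; rewrite /O1 /= unglue_cn.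
      by case: asboolP => // _; case: asboolP => // _ [? /andP[? ?]].
    move=> [Ux [ls sh]]; rewrite asboolF; last first.
      by move=> s0; move: ls; rewrite s0 ival0 ltNge (ltW lo0).
    rewrite asboolF; last first.
      case=> [s1|xp]; first by move: sh; rewrite s1 ival1 ltNge (ltW hi1).
      by rewrite xp in Ux; exact: nUV Ux Vp.
    by split=> //; rewrite ls sh.
  - apply: cone_open.
      rewrite (_ : _ @^-1` _ = setT); first exact: openT.
      by apply/seteqP; split=> z //; rewrite /O2 /= unglue_in.
    rewrite (_ : [set _ | _] = [set p : X * I | V p.1] `|`
      ([set p : X * I | ival p.2 < lo] `|` [set p : X * I | hi < ival p.2])).
      by apply: openU; [exact: open_fst|apply: openU].
    apply/seteqP; split=> -[x s]; rewrite /O2 /= unglue_cn.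
      case: asboolP => [->|_]; first by rewrite ival0; right; left.
      by case: asboolP => [[->|->]|//]; [rewrite ival1; right; right|left].
    by move=> h; case: asboolP => // _; case: asboolP.
  - apply/eqP/seteqP; split=> // c; rewrite /O1 /O2 /=.
    case: (unglue c) => [z []//|p] [[Up /andP[h1 h2]]].
    case=> [/(nUV _ Up)//|[h|h]]; first by have := lt_trans h h1; rewrite ltxx.
    by have := lt_trans h h2; rewrite ltxx.
have sepX a t a' t' : a <> point -> mid t -> a' <> point -> mid t' ->
    (a, t) <> (a', t') -> exists2 UV : set C * set C,
    cn f a t \in UV.1 /\ cn f a' t' \in UV.2 &
    [/\ open UV.1, open UV.2 & UV.1 `&` UV.2 == set0].
  move=> ap mt ap' mt' /eqP; have := prod_hausdorff hX (@unit_itv_hausdorff R).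
  rewrite open_hausdorff => /[apply] -[[U V] /= [Ua Va] [oU oV /eqP UV]].
  rewrite !inE in Ua Va.
  pose O (W : set (X * I)) : set C := [set c | if unglue c is inr p then W p else False].
  have oO W : open W -> open (O (W `&` [set p | p.1 <> point /\ mid p.2])).
    move=> oW; apply: cone_open.
      rewrite (_ : _ @^-1` _ = set0); first exact: open0.
      by apply/seteqP; split=> z //; rewrite /O /= unglue_in.
    rewrite (_ : [set _ | _] = W `&` ([set p : X * I | (~` [set point]) p.1] `&`
      ([set p : X * I | 0 < ival p.2] `&` [set p : X * I | ival p.2 < 1]))).
      apply: openI => //; apply: openI; last exact: openI.
      apply: open_fst; apply: closed_openC; apply: accessible_closed_set1.
      exact: hausdorff_accessible.
    apply/seteqP; split=> -[x s]; rewrite /O /= unglue_cn.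
      case: asboolP => // _; case: asboolP => // _ [Wx [xp /andP[? ?]]].
      by split.
    move=> [Wx [xp [s0 s1]]]; have ms : mid s by rewrite /mid s0.
    rewrite asboolF; last by move=> e; rewrite e in ms; exact: mid0 ms.
    rewrite asboolF; last by case=> // e; rewrite e in ms; exact: mid1 ms.
    by [].
  exists (O (U `&` [set p | p.1 <> point /\ mid p.2]),
          O (V `&` [set p | p.1 <> point /\ mid p.2])) => /=.
    by rewrite !inE /O /= !unglue_mid.
  split; try exact: oO.
  apply/eqP/seteqP; split=> // c; rewrite /O /=.
  case: (unglue c) => [z []//|p] [[Up _] [Vp _]].
  by have : set0 p by rewrite -UV.
rewrite open_hausdorff => c c' /eqP cc.
have flip (u v : C) : (exists2 UV : set C * set C, u \in UV.1 /\ v \in UV.2 &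
    [/\ open UV.1, open UV.2 & UV.1 `&` UV.2 == set0]) ->
    exists2 UV : set C * set C, v \in UV.1 /\ u \in UV.2 &
    [/\ open UV.1, open UV.2 & UV.1 `&` UV.2 == set0].
  by move=> [[U V] /= [? ?] [? ? UV]]; exists (V, U) => //=; split => //; rewrite setIC.
have [[y cy]|[a [t [ap mt ca]]]] := unglueP c;
  have [[y' cy']|[a' [t' [ap' mt' ca']]]] := unglueP c'.
- by rewrite cy cy'; apply: sepY => yy; apply: cc; rewrite cy cy' yy.
- by rewrite cy ca'; apply: flip; exact: sepXY.
- by rewrite ca cy'; exact: sepXY.
- by rewrite ca ca'; apply: sepX => // -[aa tt]; apply: cc; rewrite ca ca' aa tt.
Qed.

(** The base vertex of X contributes no cell, as the cylinder on it is collapsed. *)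
Definition cone_cells (n : nat) : Type :=
  match n with
  | 0%N => E' 0%N
  | m.+1 => (E' m.+1 + {e : E m | (existT E m e : cell E) <> c0})%type
  end.

Definition cone_char (n : nat) : cone_cells n -> 'rV[R]_n -> C :=
  match n with
  | 0%N => fun e x => cone_in R f (@psi 0%N e x)
  | m.+1 => fun e x => match e with
    | inl e => cone_in R f (@psi m.+1 e x)
    | inr e => cn f (phi (sval e) (row_tl x)) (clamp (row_hd x))
    end
  end.

Let index := {n & cone_cells n}.

(** The two kinds of cells as indices; the case distinction on the dimension is
    confined to these functions. *)
Let low (d : cell E') : index := match d with
  | existT 0%N e => existT cone_cells 0%N e
  | existT m.+1 e => existT cone_cells m.+1 (inl e)
  end.

Let up (c : cell E) : c <> c0 -> index := match c with
  | existT m e => fun h => existT cone_cells m.+1 (inr (exist _ e h))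
  end.

Let image_cell (i : index) : set C := cone_char (projT2 i) @` @open_cube R (projT1 i).

Let index_case (i : index) : (exists d, i = low d) \/ (exists c h, i = @up c h).
Proof.
case: i => -[|m] e; first by left; exists (existT E' 0%N e).
case: e => [e|[e h]]; first by left; exists (existT E' m.+1 e).
by right; exists (existT E m e), h.
Qed.

Let low_dim d : projT1 (low d) = cdim d. Proof. by case: d => -[|m] e. Qed.
Let up_dim c (h : c <> c0) : projT1 (up h) = (cdim c).+1. Proof. by case: c h. Qed.

Let low_cell d z : image_cell (low d) z <-> exists2 y, ocell psi d y & z = cone_in R f y.
Proof.
by case: d => -[|m] e; split=> [[x xo <-]|[_ [x xo <-] ->]]; try (by exists x);
  exists (psi e x) => //; exists x.
Qed.

Let up_cell c (h : c <> c0) z : image_cell (up h) z <->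
  exists a t, [/\ ocell phi c a, mid t & z = cn f a t].
Proof.
case: c h => m e h; split=> [[x xo <-]|[a [t [[y yo <-] mt ->]]]] /=.
  have /(row_forall (fun s => 0 < s < 1))[h1 h2] := xo.
  exists (phi e (row_tl x)), (clamp (row_hd x)); split => //; first by exists (row_tl x).
  rewrite /mid ival_clamp//; move: h1 => /andP[? ?]; apply/andP; split; exact: ltW.
exists (row_cons (ival t) y); last by rewrite /= row_tl_cons row_hd_cons clampK.
by apply/(row_forall (fun s => 0 < s < 1)); rewrite row_hd_cons row_tl_cons.
Qed.

Let c0_cell a : ocell phi c0 a -> a = point.
Proof.
by move=> [y _ <-] /=; rewrite -x0pt; congr (phi _ _); apply/rowP => -[].
Qed.

Let point_c0 : ocell phi c0 point.
Proof. by exists 0; [move=> -[]|]. Qed.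

Let point_d0 : ocell psi d0 point.
Proof. by exists 0; [move=> -[]|]. Qed.

Let ocell_neq c a : c <> c0 -> ocell phi c a -> a <> point.
Proof.
by move=> h ca ap; rewrite ap in ca; exact: h (ocell_uniq cwX ca point_c0).
Qed.

Let up_irr c (h h' : c <> c0) : up h = up h'.
Proof. by congr up; exact: Prop_irrelevance. Qed.

Let cone_partition z : exists! i : index, image_cell i z.
Proof.
have [[y ->]|[a [t [ap mt ->]]]] := unglueP z.
  have [d dy] := ocell_ex cwY y; exists (low d); split; first by apply/low_cell; exists y.
  move=> i; have [[d' ->]|[c [h ->]]] := index_case i.
    move=> /low_cell[y' dy' /cone_in_inj yy]; rewrite -yy in dy'.
    by rewrite (ocell_uniq cwY dy dy').
  move=> /up_cell[a [t [ca mt e]]]; exfalso; apply: cn_in (esym e) => //.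
  exact: ocell_neq ca.
have [c ca] := ocell_ex cwX a.
have h : c <> c0 by move=> cc; apply: ap; apply: c0_cell; rewrite -cc.
exists (up h); split; first by apply/up_cell; exists a, t.
move=> i; have [[d ->]|[c' [h' ->]]] := index_case i.
  by move=> /low_cell[y _ e]; exfalso; apply: cn_in e.
move=> /up_cell[a' [t' [ca' mt' e]]].
have [aa _] := cn_inj ap mt (ocell_neq h' ca') mt' e.
rewrite -aa in ca'; have cc := ocell_uniq cwX ca ca'; subst c'; exact: up_irr.
Qed.

Let tlT m (z : cubeT R m.+1) : cubeT R m := cclamp (row_tl (cval z)).

Let tlT_cts m : continuous (@tlT m).
Proof.
apply: (@cts_comp _ _ _ (@cclamp R m)); first exact: cclamp_cts.
by apply: (@cts_comp _ _ _ (@row_tl R m)); [exact: row_tl_cts|exact: cval_cts].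
Qed.

Let cval_tlT m (z : cubeT R m.+1) : cval (tlT z) = row_tl (cval z).
Proof.
by apply: cval_cclamp => i; rewrite mxE; exact: cvalP.
Qed.

Let cone_char_cts n (e : cone_cells n) :
  continuous (fun z : cubeT R n => cone_char e (cval z)).
Proof.
have low_cts k (e' : E' k) : continuous (fun z : cubeT R k => cone_in R f (psi e' (cval z))).
  apply: (@cts_comp _ _ _ (cone_in R f)); first exact: bmap_cts.
  exact: (@cmap_cts _ _ _ _ cwY (existT _ k e' : cell E')).
case: n e => [|m] e; first exact: low_cts.
case: e => [e|[e h]]; first exact: low_cts.
apply: (@cts_eq _ _ (fun z => cn f (cmap phi (existT _ m e : cell E) (tlT z))
  (clamp (row_hd (cval z))))) => [z|]; first by rewrite /cmap cval_tlT.
apply: (@cts_comp _ _ _ (fun p => cn f p.1 p.2)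
  (fun z => (cmap phi (existT _ m e : cell E) (tlT z), clamp (row_hd (cval z))))).
  exact: cn_cts.
apply: cts_pair.
  apply: (@cts_comp _ _ _ (cmap phi (existT _ m e : cell E))); first exact: cmap_cts.
  exact: tlT_cts.
apply: cts_clamp; apply: (@cts_comp _ _ _ (@row_hd R m)); first exact: row_hd_cts.
exact: cval_cts.
Qed.

Let cone_char_inj n (e : cone_cells n) : set_inj (@open_cube R n) (cone_char e).
Proof.
have low_inj k (e' : E' k) : set_inj (@open_cube R k) (fun x => cone_in R f (psi e' x)).
  move=> x x' xo xo' /cone_in_inj; exact: (@cw_injective _ _ _ _ cwY _ e').
case: n e => [|m] e; first exact: low_inj.
case: e => [e|[e h]]; first exact: low_inj.
move=> x x' /set_mem xo /set_mem xo' /=.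
have /(row_forall (fun s => 0 < s < 1))[h1 h2] := xo.
have /(row_forall (fun s => 0 < s < 1))[h1' h2'] := xo'.
have ap (y : 'rV[R]_m) : (forall i, 0 < y 0 i < 1) -> phi e y <> point.
  by move=> yo; apply: (ocell_neq h); exists y.
have cE s : 0 < s < 1 -> ival (clamp s) = s.
  by move=> /andP[? ?]; rewrite ival_clamp//; apply/andP; split; exact: ltW.
have mid_clamp s : 0 < s < 1 -> mid (clamp s) by move=> s01; rewrite /mid cE.
move=> /cn_inj[||||tt hh]; try by [exact: ap|exact: mid_clamp].
apply: row_eq; first by rewrite -[LHS]cE// hh cE.
by apply: (@cw_injective _ _ _ _ cwX _ e) => //; exact/mem_set.
Qed.

(** The lower face of the cell above c maps to Y by f, and cellularity of f is what
    keeps it in cells of dimension at most that of c. *)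
Let cone_closure_finite n (e : cone_cells n) : exists S : set {k & cone_cells k},
  [/\ finite_set S, forall i, S i -> (projT1 i < n)%N
    & cone_char e @` (@cube R n `\` @open_cube R n) `<=` \bigcup_(i in S) image_cell i].
Proof.
have low_fin k (e' : E' k) : exists S : set {k & cone_cells k},
    [/\ finite_set S, forall i, S i -> (projT1 i < k)%N
    & (fun x => cone_in R f (psi e' x)) @` (@cube R k `\` @open_cube R k) `<=`
      \bigcup_(i in S) image_cell i].
  have [S [fS Sd SP]] := @cw_closure_finite _ _ _ _ cwY _ e'.
  exists (low @` S); split; first exact: finite_image.
    by move=> _ [d /Sd dk <-]; rewrite low_dim.
  move=> _ [x xb <-]; have [|d Ss od] := SP (psi e' x); first by exists x.
  by exists (low d); [exists d|apply/low_cell; exists (psi e' x)].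
case: n e => [|m] e; first exact: low_fin.
case: e => [e|[e h]]; first exact: low_fin.
pose c : cell E := existT _ m e.
have [S0 fS0 S0P] := cell_boundary cwX c.
have [|s [_ sP]] := @compact_covered _ _ _ _ cwY _
    (fun z : cubeT R m => f (cmap phi c z)) (@cubeT_compact R m).
  by apply: (@cts_comp _ _ _ f); [cts|exact: (@cmap_cts _ _ _ _ cwX c)].
pose up' (d : cell E) : index := if pselect (d <> c0) is left h then up h else low d0.
pose S1 := S0 `&` [set d | (cdim d < m)%N].
pose S2 := [set` [seq d <- s | (cdim d <= m)%N]].
exists ((up' @` S1) `|` (low @` (S2 `|` [set d0]))); split.
- rewrite finite_setU; split; first by apply: finite_image; exact: finite_setIl.
  by apply: finite_image; rewrite finite_setU; split; [exact: finite_seq|exact: finite_set1].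
- move=> i [[d [_ dm] <-]|[d [ds|->] <-]].
  + by rewrite /up'; case: pselect => [h'|_]; rewrite ?up_dim ?low_dim.
  + by rewrite low_dim; move: ds; rewrite /S2 /= mem_filter => /andP[].
  + by rewrite low_dim.
move=> _ [x [xc xo] <-] /=.
have /(row_forall (fun s => 0 <= s <= 1))[h1 h2] := xc.
have zE : cval (cclamp (row_tl x)) = row_tl x by exact: cval_cclamp.
set z := cclamp (row_tl x) in zE.
have aE : phi e (row_tl x) = cmap phi c z by rewrite /cmap zE.
have pt_in : (\bigcup_(i in (up' @` S1) `|` (low @` (S2 `|` [set d0]))) image_cell i) point.
  exists (low d0); first by right; exists d0 => //; right.
  by apply/low_cell; exists point => //; rewrite bmap_pt.
rewrite aE; have [->|->|mt] := midP (clamp (row_hd x)).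
- rewrite cn0; have [d ds od] := sP z.
  exists (low d); last by apply/low_cell; exists (f (cmap phi c z)).
  right; exists d => //; left; rewrite /S2 /= mem_filter ds andbT.
  have [d' d'm od'] := f_cell (@skel_cmap _ _ _ _ cwX m c z (leqnn _)).
  by rewrite (ocell_uniq cwY od od').
- by rewrite cn1.
have zi : ~ inner z.
  move=> /innerP zo; apply: xo; apply/(row_forall (fun s => 0 < s < 1)); split.
    by move: mt; rewrite /mid ival_clamp.
  by rewrite -zE.
have [d [dS dm od]] : exists d, [/\ S0 d, (cdim d < m)%N & ocell phi d (cmap phi c z)].
  exact: S0P zi.
have [dc|dc] := pselect (d = c0).
  by rewrite dc in od; rewrite (c0_cell od) cnp.
exists (up dc); last by apply/up_cell; exists (cmap phi c z), (clamp (row_hd x)).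
left; exists d => //; rewrite /up'; case: pselect => // h'; exact: up_irr.
Qed.

(** Products of the closed cells of X with the interval determine the topology of
    X * I, by Whitehead's lemma. *)
Let cone_weak (A : set C) :
  closed A <-> forall n (e : cone_cells n), closed (@cube R n `&` cone_char e @^-1` A).
Proof.
have cubeP n (g : 'rV[R]_n -> C) :
    closed (@cube R n `&` g @^-1` A) <-> closed [set z : cubeT R n | A (g (cval z))].
  split=> [cA|cA].
    rewrite (_ : [set _ | _] = @cval R n @^-1` (@cube R n `&` g @^-1` A)).
      by apply: closed_comp => // z _; exact: cval_cts.
    by apply/seteqP; split=> z /=; [move=> Az; split => // i; exact: cvalP|case].
  rewrite (_ : _ `&` _ = @cval R n @` [set z : cubeT R n | A (g (cval z))]).
    apply: compact_closed; first exact: rV_hausdorff.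
    apply: continuous_compact; first by apply: continuous_subspaceT; exact: cval_cts.
    by apply: (subclosed_compact cA (@cubeT_compact R n)).
  apply/seteqP; split=> [x [cx Ax]|_ [z Az <-]].
    by exists (cclamp x); rewrite /= cval_cclamp.
  by split => // i; exact: cvalP.
split=> [cA n e|cA].
  apply/cubeP; apply: (closed_comp (f := fun z : cubeT R n => cone_char e (cval z))) => //.
  by move=> z _; exact: cone_char_cts.
rewrite -openC; apply: cone_open.
  rewrite preimage_setC openC; apply/(cw_weak cwY) => n e.
  by case: n e => [|m] e; [exact: (cA 0%N e)|exact: (cA m.+1 (inl e))].
apply: (quotient_family_prod (@unit_itv_compact R) (@unit_itv_hausdorff R)
  (cw_quotient_family cwX)).2 => c.
rewrite (_ : _ @^-1` _ = ~` [set p : cubeT R (cdim c) * I | A (cn f (cmap phi c p.1) p.2)]) //.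
rewrite openC; have [cc|cc] := pselect (c = c0).
  have ptE (z : cubeT R (cdim c)) : cmap phi c z = point.
    subst c; rewrite /cmap /= (_ : cval z = 0) ?x0pt//.
    by apply/rowP => -[].
  have [Ap|nAp] := pselect (A point).
    rewrite (_ : [set _ | _] = setT); first exact: closedT.
    by apply/seteqP; split=> p //= _; rewrite ptE cnp.
  rewrite (_ : [set _ | _] = set0); first exact: closed0.
  by apply/seteqP; split=> p //=; rewrite ptE cnp.
case: c cc => m e cc /=; have /cubeP cAe := cA m.+1 (inr (exist _ e cc)).
pose j (p : cubeT R m * I) : cubeT R m.+1 := cclamp (row_cons (ival p.2) (cval p.1)).
have jE p : cval (j p) = row_cons (ival p.2) (cval p.1).
  apply: cval_cclamp; apply/(row_forall (fun s => 0 <= s <= 1)).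
  by rewrite row_hd_cons row_tl_cons; split=> [|i]; [exact: ivalP|exact: cvalP].
have cj : continuous j.
  apply: (@cts_comp _ _ _ (@cclamp R m.+1)); first exact: cclamp_cts.
  by apply: row_cons_cts; [cts|apply: (@cts_comp _ _ _ (@cval R m)); [exact: cval_cts|cts]].
rewrite (_ : [set _ | _] = j @^-1` [set z | A (cone_char
    (inr (exist _ e cc) : cone_cells m.+1) (cval z))]).
  by apply: closed_comp => // p _; exact: cj.
by apply/seteqP; split=> p /=; rewrite jE row_hd_cons row_tl_cons clampK.
Qed.

Theorem cone_based_CW : based_CW_complex R C.
Proof.
exists cone_cells, cone_char; split; last first.
  by exists y0 => /=; rewrite y0pt.
split.
- exact: cone_hausdorff.
- by move=> n e; apply/subspace_sigL_continuousP; exact: cone_char_cts.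
- exact: cone_char_inj.
- exact: cone_partition.
- exact: cone_closure_finite.
- exact: cone_weak.
Qed.

End cone_cw.

(** * Cones are spaces *)

Lemma base_point_skel (R : realType) (X : ptopologicalType) (E : nat -> Type)
    (phi : forall n, E n -> 'rV[R]_n -> X) (e : E 0%N) :
  phi 0%N e 0 = point -> skel phi 0 point.
Proof.
move=> ep; exists (existT E 0%N e : cell E) => //.
by exists 0 => //= -[].
Qed.

(** The homotopy type of the cone does not change when the source is replaced by
    a complex and the map by a cellular one; then the cone is a complex. *)
Lemma cone_is_space (R : realType) (A Z : ptopologicalType) (f : bmap A Z) :
  is_space R A -> connected [set: Z] -> based_CW_complex R Z ->
  is_space R (mapping_cone R f).
Proof.
move=> [_ [K [E [phi [cwK [x0 x0pt]]]] AK]] cZ [E' [psi [cwZ [y0 y0pt]]]].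
split; first exact: cone_connected.
have [al eal] := same_type_sym AK; pose f' := pcomp f al.
have [H [cH H0 H1 Hc]] := cellular_approximation cwK cwZ (@bmap_cts _ _ f').
have Hp t : H (point, t) = point.
  rewrite Hc ?bmap_pt//; first exact: base_point_skel x0pt.
  exact: base_point_skel y0pt.
have cg : continuous (fun x => H (x, itv1 R)).
  by apply: (@cts_comp _ _ _ H (fun x => (x, itv1 R))) => //; cts.
pose g : bmap K Z := BMap cg (Hp (itv1 R)).
have fg : homotopic R f' g by exists H.
exists (mapping_cone R g); first by apply: (@cone_based_CW _ _ _ _ _ _ _ cwK cwZ x0 y0 x0pt y0pt g) => n x; exact: H1.
apply: (@same_type_trans _ _ (mapping_cone R f')).
  by apply: same_type_sym; exact: (cone_pre_same_type eal).
exact: cone_homotopic.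
Qed.

(** * Killing length is bounded by cone length *)

Section cone_length.
Variables (R : realType) (F : ptopologicalType -> Prop).

(** Induction from the far end: the map on the first stage is the composite of
    X_ 0 -> X_ 1 with the map already constructed on X_ 1. *)
Lemma cone_to_killing m (X_ : nat -> ptopologicalType) (Z : ptopologicalType)
    (g : bmap (X_ m) Z) :
  (forall A, F A -> F (suspension R A)) ->
  connected [set: Z] -> based_CW_complex R Z -> decomposition R F m X_ ->
  exists (Y : nat -> ptopologicalType) (g0 : bmap (X_ 0%N) Z),
    [/\ decomposition R F m Y, Y 0%N = mapping_cone R g0
      & Y m = mapping_cone R g].
Proof.
move=> FS cZ sZ; elim: m X_ g => [|m IH] X_ g [sX wX].
  exists (fun=> mapping_cone R g), g; split=> //; split=> // i im.
  by apply: cone_is_space => //; exact: sX.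
have [|Y [g1 [[sY wY] Y0 Ym]]] := IH (fun i => X_ i.+1) g.
  by split=> i im; [exact: sX|exact: wX].
have [g0 g01] := wedge_cofibration_puppe g1 FS (wX 0%N isT).
pose Y' i : ptopologicalType := if i is j.+1 then Y j else mapping_cone R g0.
exists Y', g0.
split=> //; split=> [[_|i im]|[_|i im]].
- by apply: cone_is_space => //; exact: sX.
- exact: sY.
- by rewrite /Y' Y0.
- exact: wY.
Qed.

(** The cone of f is equivalent to that of the identity, which contracts to its
    apex. *)
Lemma cone_contractible (A Z : ptopologicalType) (f : bmap A Z) :
  hequiv R f -> same_type R (mapping_cone R f) one_point.
Proof.
move=> ef; apply: (@same_type_trans _ _ (mapping_cone R (pid Z))).
  exact: (@cone_pre_same_type _ _ _ _ f (pid Z) f ef).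
pose D : ptopologicalType := mapping_cone R (pid Z).
exists (pconst D one_point), (pconst one_point D); split; last first.
  by apply/hclassP; congr hclass; apply: bmap_ext => -[].
apply: homotopic_sym.
pose v (t s : unit_itv R) : R := Num.max (ival t) (ival s).
apply: (@cone_homotopy _ _ _ (pid Z) D (pid D) _ (fun p => cn (pid Z) p.1 p.2)
  (fun p => cn (pid Z) p.1.1 (clamp (v p.1.2 p.2)))).
- exact: cn_cts.
- apply: (@cts_comp _ _ _ (fun p => cn (pid Z) p.1 p.2)
    (fun p => (p.1.1, clamp (v p.1.2 p.2)))); first exact: cn_cts.
  by rewrite /v; cts.
- by move=> z; rewrite cn0.
- by move=> z; rewrite cn1.
- by move=> t; rewrite cnp.
- by move=> a t; rewrite /v ival0 (max_idPl _) ?clampK// ival_ge0.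
- by move=> a t; rewrite /v ival1 (max_idPr _) ?ival_le1// -/(itv1 R) cn1.
- by move=> a s; rewrite /v ival0 (max_idPr _) ?clampK// ival_ge0.
- by move=> a s; rewrite /v ival1 (max_idPl _) ?ival_le1// -/(itv1 R) cn1.
- by move=> t s; rewrite cnp.
Qed.

(** The source may be replaced by a point, whose reduced cone adds nothing. *)
Lemma cone_of_contractible (A Z : ptopologicalType) (f : bmap A Z) :
  same_type R A one_point -> same_type R (mapping_cone R f) Z.
Proof.
move=> /same_type_sym[al eal].
apply: same_type_trans.
  apply: same_type_sym.
  exact: (@cone_pre_same_type _ _ _ _ al f (pcomp f al) eal).
apply: same_type_sym; pose k := pcomp f al.
have kp a : k a = point by case: a; exact: (bmap_pt k).
have [h hin hcn] : {h : bmap (mapping_cone R k) Z |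
    (forall x, h (cone_in R k x) = pid Z x) &
    (forall a t, h (cn k a t) = cst point (a, t))}.
  apply: cone_mapP => [|a|a|t] //; last by rewrite kp.
  by apply: cts_cst.
exists (cone_in R k), h; split; apply/hclassP; congr hclass; apply: bmap_ext.
  by move=> z; exact: hin.
move=> c; have [[x ->]|[[] [t ->]]] := cone_case c.
  by rewrite -[LHS]/(cone_in R k (h (cone_in R k x))) hin.
rewrite -[LHS]/(cone_in R k (h (cn k tt t))) hcn bmap_pt.
exact/esym/(cnp k).
Qed.

Lemma kl_le_cl (X : ptopologicalType) : is_space R X ->
  (forall A, F A -> F (suspension R A)) -> (kl R F X <= cl R F X)%E.
Proof.
move=> [cX [K cwK XK]] FS; rewrite /kl /cl; case: ifPn => // _.
apply: least_le => m [X_ [dX X0 XmX]].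
have [g eg] := same_type_trans XmX XK.
have [Y [g0 [dY Y0 Ym]]] := cone_to_killing g FS (same_type_connected XK cX) cwK dX.
exists Y; split => //.
  rewrite Y0; apply: same_type_trans (cone_of_contractible g0 X0) _.
  exact: same_type_sym.
by rewrite Ym; exact: cone_contractible.
Qed.

End cone_length.

Local Open Scope ereal_scope.

Theorem theorem3p3 (R : realType) (F : ptopologicalType -> Prop)
    (X : ptopologicalType) :
  (forall A : ptopologicalType, F A -> is_space R A) ->
  is_space R X ->
  t_ R F X <= kl R F X /\
  ((forall A : ptopologicalType, F A -> F (suspension R A)) ->
   kl R F X <= cl R F X).
Proof. by move=> _ sX; split; [exact: t_le_kl|exact: kl_le_cl]. Qed.
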